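(* Let $\bar e\in E$ and $\bar{\mathbf u}\in\mathcal A(\bar e)$. Suppose the sets $\mathbb U_i$ ($0\le i\le n-1$) are Clarke regular, the constraints $u_0\in S_0(e)$, $(q_i,u_i)\in S_i(e)$ ($1\le i\le n-1$), $q_n\in S_n(e)$ are $\varphi_i$-regular along $\bar{\mathbf u}\in\mathcal A(\bar e)$, and the control $\bar{\mathbf u}$ is strictly $\varphi_i$-normal. Then there exist $\varepsilon,\kappa>0$ such that for all $(e,\mathbf u)\in E\times\mathcal U$ satisfying $d_E(e,\bar e)+d_{\mathcal U}(\mathbf u,\bar{\mathbf u})<\varepsilon$ there holds $$d_{\mathcal A(e)}(\mathbf u)\le\kappa\,P(e,\mathbf u).$$ In particular, the sets $\mathcal A(e)$ are nonempty for $d_E(e,\bar e)<\varepsilon$.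
   Context: Control system. $n\ge 1$; $Q,U_0,\dots,U_{n-1}$ are finite-dimensional Riemannian manifolds (products carry product metrics); $\mathbb U_i\subseteq U_i$ closed, $\mathcal U=\prod_{i=0}^{n-1}\mathbb U_i$; $F_i:Q\times U_i\to Q$ are $C^1$; $q_0\in Q$ is fixed and $\mathbf u$ determines states $q_i=F_{i-1}(q_{i-1},u_{i-1})$, $1\le i\le n$. $d_{\mathcal U}$ is the Riemannian distance of $\prod_iU_i$; $d_S(x)=\inf_{s\in S}d(x,s)$, $d_\emptyset=+\infty$. $D_qF_i,D_uF_i$ are partial derivatives, ${}^*$ the dual map. Constraints. $E$ is a metric space with metric $d_E$; $\varphi_0:E\times U_0\to[0,\infty)$, $\varphi_i:E\times(Q\times U_i)\to[0,\infty)$ ($1\le i\le n-1$), $\varphi_n:E\times Q\to[0,\infty)$ are locally Lipschitz in the second argument, uniformly with respect to $e$; $S_i(e)$ is the zero set of $\varphi_i(e,\cdot)$ (a closed set). $\mathcal A(e)$ is the set of $\mathbf u\in\mathcal U$ which, with their states, satisfy $u_0\in S_0(e)$, $(q_i,u_i)\in S_i(e)$ ($1\le i\le n-1$), $q_n\in S_n(e)$. $P(e,\mathbf u)=\varphi_0(e,u_0)+\varphi_n(e,q_n)+\sum_{i=1}^{n-1}\varphi_i(e,q_i,u_i)$. Nonsmooth notions. For lower semicontinuous $f:M\to\mathbb R\cup\{\infty\}$: $p\in\partial_Ff(x)$ if there is a $C^1$ function $h$ with $p=dh(x)$ and $f-h$ having a local minimum at $x$; $p\in\partial_Lf(x)$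 if there are $x_k\to x$, $p_k\in\partial_Ff(x_k)$, $f(x_k)\to f(x)$, $p_k\to p$; $\partial_{L,x}\varphi(e,x)$ is the limiting subdifferential of $\varphi(e,\cdot)$ at $x$. For closed $S$: $N_S^L(s)=\partial_L\chi_S(s)$ ($\chi_S=0$ on $S$, $\infty$ off $S$) and $T_S^C(s)=\{v:\langle p,v\rangle\le0\ \forall p\in N_S^L(s)\}$. $S$ is Clarke regular if for every $s\in S$, $v\in T_S^C(s)$ and $s_k\to s$ in $S$ there are $v_k\in T_S^C(s_k)$ with $v_k\to v$. Regularity. $S(e_0)=\{x\in M:\varphi(e_0,x)=0\}$ is $\varphi$-regular at $x_0\in S(e_0)$ if (i) there are $\varepsilon,\Delta>0$ such that $\|p\|\ge\Delta$ whenever $d_E(e,e_0)+d_M(x,x_0)<\varepsilon$, $\varphi(e,x)>0$ and $p\in\partial_{L,x}\varphi(e,x)$; and (ii) if $(e_k,x_k)\to(e_0,x_0)$ and $p_k\in\partial_{L,x}\varphi(e_k,x_k)$ then a subsequence of $p_k$ converges to some $p\in\partial_{L,x}\varphi(e_0,x_0)$. The constraints are $\varphi_i$-regular along $\mathbf u\in\mathcal A(e)$ if $S_0(e)$ is $\varphi_0$-regular at $u_0$, $S_i(e)$ is $\varphi_i$-regular at $(q_i,u_i)$ for $1\le i\le n-1$, and $S_n(e)$ is $\varphi_n$-regular at $q_n$. Strict normality. $\mathbf u\in\mathcal A(e)$ is strictly $\varphi_i$-normal if the only sequences $\mathbf a=(a_i)_{i=1}^n$, $\mathbf b=(b_i)_{i=0}^{n-1}$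 with $b_0\in\partial_{L,u}\varphi_0(e,u_0)$, $(a_i,b_i)\in\partial_{L,(q,u)}\varphi_i(e,q_i,u_i)$ ($1\le i\le n-1$), $a_n\in\partial_{L,q}\varphi_n(e,q_n)$, for which the costates given by $-p_n=a_n$, $p_{i-1}=-a_{i-1}+D_qF_{i-1}(q_{i-1},u_{i-1})^*p_i$ ($2\le i\le n$) satisfy $0\le\langle b_{i-1}-D_uF_{i-1}(q_{i-1},u_{i-1})^*p_i,v\rangle$ for all $v\in T^C_{\mathbb U_{i-1}}(u_{i-1})$, $1\le i\le n$, are $\mathbf a\equiv0$, $\mathbf b\equiv0$.
   Formalization: Added hypothesis: e ↦ P(e,ū) is continuous at ē. Without it the claim fails: n=1, all spaces ℝ, ē not isolated, φ_1=0, ū=0, φ_0(ē,u)=|u|, φ_0(e,u)=max(1,5+u) for e≠ē; then A(e) is empty for e≠ē. *)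

(* Defs.v *)
From HB Require Import structures.
From mathcomp Require Import all_boot all_order all_algebra.
From mathcomp Require Import all_classical all_reals all_analysis.

Set Implicit Arguments.
Unset Strict Implicit.
Unset Printing Implicit Defensive.

Import Order.TTheory GRing.Theory Num.Theory.
Import numFieldNormedType.Exports.

Local Open Scope classical_set_scope.
Local Open Scope ring_scope.

(* C^k on A.  Only used for open A and finite-dimensional V, where this is the
   usual notion: differentiability at order k gives continuity at order k, and
   continuity of all directional derivatives is continuity of the derivative. *)
Fixpoint Ck (R : realType) (V W : normedModType R) (k : nat) (A : set V)
    (f : V -> W) : Prop :=
  if k is k'.+1 then
    (forall x, A x -> differentiable f x) /\
    (forall v, Ck k' A (fun x => 'D_v f x))
  else forall x, A x -> {for x, continuous f}.

(* A space with, for each point x, a chart [chart x : dom x -> 'rV_dim] around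
   x with inverse [chinv x], and the matrix [gram x z] of the metric tensor in
   that chart at the coordinates z.  The metric tensor and the charts only
   matter on [dom x] and [codm x].  The axioms are in [riemannian].

   Vectors are rows.  A tangent vector (resp. covector) at x is the row of its
   coordinates (resp. dual coordinates) in the preferred chart [chart x], so
   the tangent and cotangent spaces at any point are represented by 'rV_dim. *)
Record ratlas (R : realType) := RAtlas {
  carrier :> topologicalType ;
  dim : nat ;
  dom : carrier -> set carrier ;
  chart : carrier -> carrier -> 'rV[R]_dim ;
  chinv : carrier -> 'rV[R]_dim -> carrier ;
  gram : carrier -> 'rV[R]_dim -> 'M[R]_dim }.

Arguments dim {R} r.
Arguments dom {R r} x _.
Arguments chart {R r} x _.
Arguments chinv {R r} x _.
Arguments gram {R r} x _.

Section Geometry.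
Context {R : realType}.
Implicit Types X Y : ratlas R.

Definition codm X (x : X) : set 'rV[R]_(dim X) := chart x @` dom x.

Definition trans X (x y : X) : 'rV[R]_(dim X) -> 'rV[R]_(dim X) :=
  chart y \o chinv x.

(* X is a (Hausdorff, second countable) smooth manifold of dimension [dim X]
   with a smooth Riemannian metric. *)
Record riemannian X : Prop := Riemannian {
  riem_hausdorff : hausdorff_space X ;
  riem_second_countable : @second_countable X ;
  riem_dom_open : forall x : X, open (dom x) ;
  riem_dom_self : forall x : X, dom x x ;
  riem_codm_open : forall x : X, open (codm x) ;
  riem_chartK : forall x y : X, dom x y -> chinv x (chart x y) = y ;
  riem_chart_continuous : forall x y : X,
    dom x y -> {for y, continuous (chart x)} ;
  riem_chinv_continuous : forall (x : X) z,
    codm x z -> {for z, continuous (chinv x)} ;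
  riem_trans_smooth : forall (x y : X) (k : nat),
    Ck k (chart x @` (dom x `&` dom y)) (trans x y) ;
  riem_gram_smooth : forall (x : X) (k : nat), Ck k (codm x) (gram x) ;
  riem_gram_sym : forall (x : X) z, codm x z -> (gram x z)^T = gram x z ;
  riem_gram_pos : forall (x : X) z (v : 'rV[R]_(dim X)),
    codm x z -> v != 0 -> 0 < (v *m gram x z *m v^T) 0 0 ;
  riem_gram_trans : forall x y z : X, dom x z -> dom y z ->
    gram x (chart x z) =
      jacobian (trans x y) (chart x z) *m gram y (chart y z)
        *m (jacobian (trans x y) (chart x z))^T }.

(* The product manifold and product metric, for two factors and for a finite
   family. *)
Definition prod2 X Y : ratlas R :=
  @RAtlas R (X * Y)%type (dim X + dim Y)%N
    (fun x y => dom x.1 y.1 /\ dom x.2 y.2)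
    (fun x y => row_mx (chart x.1 y.1) (chart x.2 y.2))
    (fun x z => (chinv x.1 (lsubmx z), chinv x.2 (rsubmx z)))
    (fun x z => block_mx (gram x.1 (lsubmx z)) 0 0 (gram x.2 (rsubmx z))).

Definition prodn (n : nat) (U : 'I_n -> ratlas R) : ratlas R :=
  @RAtlas R (prod_topology (fun i => carrier (U i)))
    (\sum_i dim (U i))%N
    (fun x y => forall i, dom (x i) (y i))
    (fun x y => \mxrow_i chart (x i) (y i))
    (fun x z => fun i => chinv (x i) (submxrow z i))
    (fun x z => \mxdiag_i gram (x i) (submxrow z i)).

Definition pairing (d : nat) (p v : 'rV[R]_d) : R := (p *m v^T) 0 0.

Definition tnorm X (x : X) (v : 'rV[R]_(dim X)) : R :=
  Num.sqrt ((v *m gram x (chart x x) *m v^T) 0 0).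

Definition conorm X (x : X) (p : 'rV[R]_(dim X)) : R :=
  sup [set `|pairing p v| | v in [set v | tnorm x v <= 1]].

(* C^1 on a neighbourhood of [0, 1]; every C^1 curve on [0, 1] has such an
   extension. *)
Definition C1_curve X (g : R -> X) : Prop :=
  forall t : R, 0 <= t <= 1 -> exists W : set R^o,
    [/\ open_nbhs t W, (forall s, W s -> dom (g t) (g s)) &
        Ck 1 W (chart (g t) \o g : R^o -> 'rV[R]_(dim X))].

Definition speed X (g : R -> X) (t : R) : R :=
  tnorm (g t) ('D_1 (chart (g t) \o g : R^o -> 'rV[R]_(dim X)) t).

Definition curve_length X (g : R -> X) : \bar R :=
  \int[lebesgue_measure]_(t in `[0, 1]) (speed g t)%:E.

(* Riemannian distance; +oo between different components.  Curves need not be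
   regular, so C^1 curves give the same infimum as piecewise C^1 ones. *)
Definition rdist X (x y : X) : \bar R :=
  ereal_inf [set curve_length g | g in
    [set g : R -> X | [/\ C1_curve g, g 0 = x & g 1 = y]]].

Definition dist_set X (S : set X) (x : X) : \bar R :=
  ereal_inf [set rdist x s | s in S].

Definition C1_fun X (h : X -> R) : Prop :=
  forall x : X, Ck 1 (codm x) (h \o chinv x : 'rV[R]_(dim X) -> R^o).

Definition dfun X (h : X -> R) (x : X) : 'rV[R]_(dim X) :=
  \row_j 'D_(delta_mx 0 j) (h \o chinv x : 'rV[R]_(dim X) -> R^o) (chart x x).

Definition C1_map X Y (f : X -> Y) : Prop :=
  forall x : X, exists W : set 'rV[R]_(dim X),
    [/\ open_nbhs (chart x x) W, W `<=` codm x,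
        (forall z, W z -> dom (f x) (f (chinv x z))) &
        Ck 1 W (chart (f x) \o f \o chinv x)].

(* Since vectors are rows, the differential of f at x is v |-> v *m mjac f x
   and its dual map is [codiff f x]. *)
Definition mjac X Y (f : X -> Y) (x : X) : 'M[R]_(dim X, dim Y) :=
  jacobian (chart (f x) \o f \o chinv x) (chart x x).

Definition codiff X Y (f : X -> Y) (x : X) (p : 'rV[R]_(dim Y)) :
  'rV[R]_(dim X) := p *m (mjac f x)^T.

(* Coordinates in [chart x] of a vector, resp. covector, based at y \in dom x. *)
Definition tan_coord X (x y : X) (v : 'rV[R]_(dim X)) : 'rV[R]_(dim X) :=
  v *m jacobian (trans y x) (chart y y).

Definition cot_coord X (x y : X) (p : 'rV[R]_(dim X)) : 'rV[R]_(dim X) :=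
  p *m (jacobian (trans x y) (chart x y))^T.

(* Convergence in the (co)tangent bundle of vectors (covectors) vs k based at
   xs k to the one v based at x. *)
Definition tan_cvg X (xs : nat -> X) (vs : nat -> 'rV[R]_(dim X))
    (x : X) (v : 'rV[R]_(dim X)) : Prop :=
  xs @ \oo --> x /\ (fun k => tan_coord x (xs k) (vs k)) @ \oo --> v.

Definition cot_cvg X (xs : nat -> X) (ps : nat -> 'rV[R]_(dim X))
    (x : X) (p : 'rV[R]_(dim X)) : Prop :=
  xs @ \oo --> x /\ (fun k => cot_coord x (xs k) (ps k)) @ \oo --> p.

Definition frechet_subdiff X (f : X -> \bar R) (x : X) :
    set 'rV[R]_(dim X) :=
  [set p | f x \is a fin_num /\ exists h : X -> R,
    [/\ C1_fun h, p = dfun h x &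
        \forall y \near x, (f x - (h x)%:E <= f y - (h y)%:E)%E]].

Definition limiting_subdiff X (f : X -> \bar R) (x : X) :
    set 'rV[R]_(dim X) :=
  [set p | exists (xs : nat -> X) (ps : nat -> 'rV[R]_(dim X)),
    [/\ forall k, frechet_subdiff f (xs k) (ps k),
        (f \o xs) @ \oo --> f x & cot_cvg xs ps x p]].

Definition subdiffL X (f : X -> R) (x : X) : set 'rV[R]_(dim X) :=
  limiting_subdiff (EFin \o f) x.

Definition chi X (S : set X) (x : X) : \bar R :=
  if `[< S x >] then 0%E else +oo%E.

Definition normal_cone X (S : set X) (s : X) : set 'rV[R]_(dim X) :=
  limiting_subdiff (chi S) s.

Definition clarke_tangent X (S : set X) (s : X) : set 'rV[R]_(dim X) :=
  [set v | forall p, normal_cone S s p -> pairing p v <= 0].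

Definition clarke_regular X (S : set X) : Prop :=
  forall (s : X) (v : 'rV[R]_(dim X)) (sk : nat -> X),
    S s -> clarke_tangent S s v -> (forall k, S (sk k)) -> sk @ \oo --> s ->
    exists vk : nat -> 'rV[R]_(dim X),
      (forall k, clarke_tangent S (sk k) (vk k)) /\ tan_cvg sk vk s v.

End Geometry.

Section Constraints.
Context {R : realType} {E : metricType R}.
Implicit Types X : ratlas R.

Definition zero_set X (phi : E -> X -> R) (e : E) : set X :=
  [set x | phi e x = 0].

Definition loc_lipschitz X (phi : E -> X -> R) : Prop :=
  forall x0 : X, exists2 W : set X, nbhs x0 W & exists L : R,
    forall e x y, W x -> W y ->
      (`|phi e x - phi e y|%:E <= L%:E * rdist x y)%E.

Definition phi_regular X (phi : E -> X -> R) (e0 : E) (x0 : X) : Prop :=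
  (exists eps Delta : R, [/\ 0 < eps, 0 < Delta &
    forall (e : E) (x : X) (p : 'rV[R]_(dim X)),
      ((mdist e e0)%:E + rdist x x0 < eps%:E)%E -> 0 < phi e x ->
      subdiffL (phi e) x p -> Delta <= conorm x p]) /\
  (forall (ek : nat -> E) (xk : nat -> X) (pk : nat -> 'rV[R]_(dim X)),
    ek @ \oo --> e0 -> xk @ \oo --> x0 ->
    (forall k, subdiffL (phi (ek k)) (xk k) (pk k)) ->
    exists (sub : nat -> nat) (p : 'rV[R]_(dim X)),
      [/\ {homo sub : i j / (i < j)%N}, subdiffL (phi e0) x0 p &
          cot_cvg (xk \o sub) (pk \o sub) x0 p]).

End Constraints.

Section ControlSystem.
Context {R : realType} {m : nat} {Q : ratlas R} {U : 'I_m.+1 -> ratlas R}.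
Variables (F : forall i, prod2 Q (U i) -> Q) (q0 : Q).

(* The number of steps is n = m.+1 >= 1.  [state u k] is q_k for k <= n (and,
   as a junk value, q_n for k > n). *)
Fixpoint state (u : forall i, U i) (k : nat) : Q :=
  if k is k'.+1 then
    if insub k' is Some i then F (i := i) (state u k', u i) else state u k'
  else q0.

Definition DqF (i : 'I_m.+1) (q : Q) (u : U i) :
    'rV[R]_(dim Q) -> 'rV[R]_(dim Q) :=
  codiff (fun q' : Q => F (i := i) (q', u)) q.

Definition DuF (i : 'I_m.+1) (q : Q) (u : U i) :
    'rV[R]_(dim Q) -> 'rV[R]_(dim (U i)) :=
  codiff (fun u' : U i => F (i := i) (q, u')) u.

Context {E : metricType R}.
Variable UU : forall i, set (U i).

(* phi j is the mixed constraint function of index lift ord0 j = j.+1, so that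
   j : 'I_m covers the indices 1, ..., n - 1. *)
Variables (phi0 : E -> U ord0 -> R)
  (phi : forall j : 'I_m, E -> prod2 Q (U (lift ord0 j)) -> R)
  (phin : E -> Q -> R).

Definition controls : set (forall i, U i) := [set u | forall i, UU (u i)].

Definition stage (u : forall i, U i) (i : 'I_m.+1) : prod2 Q (U i) :=
  (state u i, u i).

Definition admissible (e : E) : set (forall i, U i) :=
  [set u | [/\ controls u, zero_set phi0 e (u ord0),
    forall j : 'I_m, zero_set (phi (j := j)) e (stage u (lift ord0 j)) &
    zero_set phin e (state u m.+1)]].

Definition penalty (e : E) (u : forall i, U i) : R :=
  phi0 e (u ord0) + phin e (state u m.+1)
  + \sum_(j < m) phi e (stage u (lift ord0 j)).

Definition regular_along (e : E) (u : forall i, U i) : Prop :=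
  [/\ phi_regular phi0 e (u ord0),
      forall j : 'I_m, phi_regular (phi (j := j)) e (stage u (lift ord0 j)) &
      phi_regular phin e (state u m.+1)].

(* a k is relevant for 1 <= k <= n, the costate p k for 1 <= k <= n. *)
Definition strictly_normal (e : E) (u : forall i, U i) : Prop :=
  forall (a p : nat -> 'rV[R]_(dim Q)) (b : forall i, 'rV[R]_(dim (U i))),
    subdiffL (phi0 e) (u ord0) (b ord0) ->
    (forall j : 'I_m, subdiffL (phi (j := j) e) (stage u (lift ord0 j))
                        (row_mx (a j.+1) (b (lift ord0 j)))) ->
    subdiffL (phin e) (state u m.+1) (a m.+1) ->
    - p m.+1 = a m.+1 ->
    (forall i : 'I_m.+1, (0 < i)%N ->
      p i = - a i + DqF (state u i) (u i) (p i.+1)) ->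
    (forall (i : 'I_m.+1) (v : 'rV[R]_(dim (U i))),
      clarke_tangent (UU (i := i)) (u i) v ->
      0 <= pairing (b i - DuF (state u i) (u i) (p i.+1)) v) ->
    (forall k, (0 < k <= m.+1)%N -> a k = 0) /\ (forall i, b i = 0).

End ControlSystem.

(* Main.v *)
(* Suppose no eps and kappa work.  Then there are e_k -> ebar and u_k -> ubar with
   d_{A(e_k)}(u_k) > (k+1) P_k, where P_k = P(e_k, u_k) -> 0.  In fixed charts
   around ubar and its states, minimize over compact balls
     sum of the constraint functions at (y, x)
     + N (sum |x_i - s_i|^2 + sum |y_{i+1} - F_i(y_i, s_i)|^2) + l sum |s_i - u_{k,i}|^2
   with s_i in UU_i.  The weight l is chosen so that a value at most P_k keeps s
   within (k+1) P_k of u_k, where no admissible control lies, while the gradient of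
   the last term still tends to 0.  For N large the minimizer therefore has a
   positive constraint function, and it converges to the reference process.
   Its first-order conditions are the adjoint system with the multipliers
   2N (y_{i+1} - F_i(y_i, s_i)).  By part (ii) of phi-regularity and by the Clarke
   regularity of the sets UU_i they pass to the limit, strict normality makes all
   limiting subgradients vanish, and this contradicts the lower bound on
   subgradients in part (i) of phi-regularity. *)
Require Import Defs.
From mathcomp Require Import all_boot all_order all_algebra.
From mathcomp Require Import ring lra.
From mathcomp Require Import all_classical all_reals all_analysis measurable_realfun.
Import Order.TTheory GRing.Theory Num.Theory.
Import numFieldNormedType.Exports.
Local Open Scope classical_set_scope.
Local Open Scope ring_scope.

Set Implicit Arguments.
Unset Strict Implicit.
Unset Printing Implicit Defensive.

(** Each nonsmooth function gets its own block of variables: the states are independent unknowns,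
    each control occurs twice, and only quadratic terms link the blocks. Varying one block at a time
    then yields a Frechet subgradient equal to minus a gradient, so no sum rule for limiting
    subdifferentials is involved. The weight N comes from compactness alone and is not controlled
    along the sequence, so nothing bounds the multipliers a priori. Their convergence starts at the
    end of the horizon: the last one is minus a subgradient, which converges along a subsequence,
    and the adjoint recursion passes convergence on to earlier times. The growing factor k+1 is what
    leaves room for the weight l: keeping s within radius rho costs a gradient of size tau = P_k /
    rho, and (k+1) P_k as the scale of rho makes tau of order 1/(k+1). The distance is an infimum of
    lengths, so it is compared with coordinates in both directions: segments in a chart bound it
    from above, bump functions from below. Bumps also turn local smooth functions into the global
    test functions that Frechet subgradients ask for. *)

Local Notation dim := Defs.dim.

(** * Calculus in coordinates *)

Section Differentiability.
Context {R : realType}.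
Implicit Types V W : normedModType R.

Lemma sum_cvg (T I : Type) (F : set_system T) {FF : Filter F} W (r : seq I)
    (P : pred I) (f : I -> T -> W) (a : I -> W) :
  (forall i, P i -> f i x @[x --> F] --> a i) ->
  \sum_(i <- r | P i) f i x @[x --> F] --> \sum_(i <- r | P i) a i.
Proof. by move=> fa; apply: cvg_big => //; exact: add_continuous. Qed.

Lemma sum_continuous_at (T : topologicalType) I W (r : seq I) (P : pred I)
    (f : I -> T -> W) x :
  (forall i, P i -> {for x, continuous (f i)}) ->
  {for x, continuous (fun y => \sum_(i <- r | P i) f i y)}.
Proof. by move=> fa; apply: sum_cvg => i /fa. Qed.

Lemma scale_continuous_at (T : topologicalType) W (s : T -> R) (f : T -> W) x :
  {for x, continuous s} -> {for x, continuous f} ->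
  {for x, continuous (fun y => s y *: f y)}.
Proof. exact: cvgZ. Qed.

Lemma mxcoord_continuous_at (T : topologicalType) m n (f : T -> 'M[R]_(m, n)) i j x :
  {for x, continuous f} -> {for x, continuous (fun y => f y i j)}.
Proof.
move=> cf; apply: (@continuous_comp _ _ _ f (fun M : 'M[R]_(m, n) => M i j)) => //.
exact: coord_continuous.
Qed.

Lemma open_eq_continuous (T : topologicalType) W (A : set T) (f g : T -> W) x :
  open A -> A x -> (forall y, A y -> f y = g y) -> {for x, continuous g} ->
  {for x, continuous f}.
Proof.
move=> oA Ax fg; rewrite /prop_for /continuous_at (fg _ Ax) => cg.
apply: cvg_trans cg; apply: near_eq_cvg.
by apply: filterS (open_nbhs_nbhs (conj oA Ax)) => y /fg ->.
Qed.

Lemma near_eq_differentiable V W (f g : V -> W) (x : V) :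
  (\forall y \near x, f y = g y) -> differentiable f x -> differentiable g x.
Proof.
move=> fg df.
have [dfc /eqaddoP dfo] := (diff_locallyP x f).1 df.
have fgx : f x = g x by apply: (nbhs_singleton fg).
have gE : g \o shift x = cst (g x) + 'd f x +o_ 0 id.
  apply/eqaddoP => e e0; have := dfo e e0.
  have fg0 : \forall h \near (0 : V), f (h + x) = g (h + x).
    by move: fg; rewrite (near_shift 0 x) subr0.
  move=> H; near=> h.
  have -> : (g \o shift x - (cst (g x) + 'd f x)) h
      = (f \o shift x - (cst (f x) + 'd f x)) h.
    rewrite /GRing.add/=/GRing.opp/= fgx; congr (_ - _).
    by apply/esym; near: h.
  by near: h.
apply/diff_locallyP.
have E : 'd g x = 'd f x :> (V -> W) by apply: diff_unique.
by rewrite E.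
Unshelve. all: by end_near. Qed.

Lemma linear_mx_continuous m n W (f : {linear 'M[R]_(m, n) -> W}) :
  continuous f.
Proof.
have -> : (f : 'M[R]_(m, n) -> W) =
    fun M => \sum_i \sum_j M i j *: f (delta_mx i j).
  apply/funext => M; rewrite {1}(matrix_sum_delta M) linear_sum.
  apply: eq_bigr => i _; rewrite linear_sum; apply: eq_bigr => j _.
  by rewrite linearZ.
move=> M; apply: sum_continuous_at => i _; apply: sum_continuous_at => j _.
by apply: scale_continuous_at; [exact: coord_continuous|exact: cst_continuous].
Qed.

Lemma linear_mx_differentiable m n W (f : {linear 'M[R]_(m, n) -> W}) x :
  differentiable f x.
Proof. by apply: linear_differentiable; exact: linear_mx_continuous. Qed.

Lemma derive_linear_mx m n W (f : {linear 'M[R]_(m, n) -> W}) x v :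
  'D_v f x = f v.
Proof.
rewrite deriveE; last exact: linear_mx_differentiable.
by rewrite diff_lin //; exact: linear_mx_continuous.
Qed.

Lemma derive_comp V V' W (f : V -> V') (g : V' -> W) x v :
  differentiable f x -> differentiable g (f x) ->
  'D_v (g \o f) x = 'D_('D_v f x) g (f x).
Proof.
move=> df dg; rewrite !deriveE //; last exact: differentiable_comp.
by rewrite diff_comp.
Qed.

Lemma derive_rowE n W (g : 'rV[R]_n -> W) x v : differentiable g x ->
  'D_v g x = \sum_j v 0 j *: 'D_(delta_mx 0 j) g x.
Proof.
move=> dg; rewrite deriveE // {1}(row_sum_delta v) linear_sum.
by apply: eq_bigr => j _; rewrite linearZ deriveE.
Qed.

Lemma derive_realE W (g : R^o -> W) (x v : R^o) : differentiable g x ->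
  'D_v g x = v *: 'D_1 g x.
Proof. by move=> dg; rewrite !deriveE // -linearZ /= /GRing.scale/= mulr1. Qed.

Lemma differentiable_mxP V m n (f : V -> 'M[R]_(m, n)) x :
  (forall i j, differentiable (fun y => f y i j : R^o) x) -> differentiable f x.
Proof.
move=> df.
have -> : f = \sum_i \sum_j (fun y => f y i j *: delta_mx i j).
  apply/funext => y; rewrite fct_sumE {1}(matrix_sum_delta (f y)).
  by apply: eq_bigr => i _; rewrite fct_sumE.
apply: differentiable_sum => i; apply: differentiable_sum => j.
exact: differentiableZl.
Qed.

End Differentiability.

(** * Rules for C^1 functions on normed spaces *)

Section Ck1.
Context {R : realType}.
Implicit Types V W : normedModType R.

Lemma Ck1_subset V W (A B : set V) (f : V -> W) :
  A `<=` B -> Ck 1 B f -> Ck 1 A f.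
Proof.
move=> AB [df cf]; split=> [x /AB|v x /AB]; [exact: df|exact: cf].
Qed.

(** This is how functions given by cases, such as cutoffs extended by zero, are treated: near each
    point they agree with a function already known to be C^1. *)
Lemma Ck1_local V W (A : set V) (f : V -> W) :
  (forall x, A x -> exists (B : set V) (g : V -> W),
    [/\ open_nbhs x B, Ck 1 B g & forall y, B y -> f y = g y]) -> Ck 1 A f.
Proof.
move=> H; split=> [x /H[B [g [[oB Bx] [dg cg] fg]]]|
                   v x /H[B [g [[oB Bx] [dg cg] fg]]]].
  apply: (@near_eq_differentiable _ _ _ g); last exact: dg.
  by apply: filterS (open_nbhs_nbhs (conj oB Bx)) => y /fg.
have E y : B y -> 'D_v f y = 'D_v g y.
  move=> By; apply: near_eq_derive; apply: filterS (open_nbhs_nbhs (conj oB By)).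
  by move=> z; exact: fg.
by apply: (@open_eq_continuous _ _ _ B _ ('D_v g)) => //; exact: cg.
Qed.

(** By the chain rule the direction in which [g] is differentiated moves with the point, while [Ck]
    controls fixed directions only. Expanding ['D_v f y] along the basis of rows reduces to those,
    which is why the middle space consists of rows. *)
Lemma Ck1_comp V W n (A : set V) (B : set 'rV[R]_n) (f : V -> 'rV[R]_n)
    (g : 'rV[R]_n -> W) :
  open A -> (forall x, A x -> B (f x)) -> Ck 1 A f -> Ck 1 B g ->
  Ck 1 A (g \o f).
Proof.
move=> oA AB [df cf] [dg cg]; split=> [x Ax|v x Ax].
  by apply: differentiable_comp; [exact: df|exact/dg/AB].
have E y : A y ->
    'D_v (g \o f) y = \sum_j 'D_v f y 0 j *: 'D_(delta_mx 0 j) g (f y).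
  by move=> Ay; rewrite derive_comp; [|exact: df|exact/dg/AB];
    rewrite derive_rowE; last exact/dg/AB.
apply: (@open_eq_continuous _ _ _ A _ (fun y => \sum_j 'D_v f y 0 j *: 'D_(delta_mx 0 j) g (f y))) => //.
apply: sum_continuous_at => j _; apply: scale_continuous_at.
  by apply: mxcoord_continuous_at; exact: cf.
apply: (@continuous_comp _ _ _ f ('D_(delta_mx 0 j) g)).
  by apply: differentiable_continuous; exact: df.
exact: cg (AB _ Ax).
Qed.

Lemma Ck1_comp_real V W (A : set V) (B : set R^o) (f : V -> R^o)
    (g : R^o -> W) :
  open A -> (forall x, A x -> B (f x)) -> Ck 1 A f -> Ck 1 B g ->
  Ck 1 A (g \o f).
Proof.
move=> oA AB [df cf] [dg cg]; split=> [x Ax|v x Ax].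
  by apply: differentiable_comp; [exact: df|exact/dg/AB].
have E y : A y -> 'D_v (g \o f) y = 'D_v f y *: 'D_1 g (f y).
  by move=> Ay; rewrite derive_comp; [|exact: df|exact/dg/AB];
    rewrite derive_realE; last exact/dg/AB.
apply: (@open_eq_continuous _ _ _ A _ (fun y => 'D_v f y *: 'D_1 g (f y))) => //.
apply: scale_continuous_at; first exact: cf.
apply: (@continuous_comp _ _ _ f ('D_1 g)).
  by apply: differentiable_continuous; exact: df.
exact: cg (AB _ Ax).
Qed.

Lemma Ck1_cst V W (A : set V) (c : W) : Ck 1 A (cst c).
Proof.
split=> [x _|v x _]; first exact: differentiable_cst.
have -> : (fun y => 'D_v (cst c) y) = cst 0.
  by apply/funext => y; rewrite derive_cst.
exact: cst_continuous.
Qed.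

Lemma Ck1_linear m n W (A : set 'M[R]_(m, n)) (f : {linear 'M[R]_(m, n) -> W}) :
  Ck 1 A f.
Proof.
split=> [x _|v x _]; first exact: linear_mx_differentiable.
have -> : (fun y => 'D_v f y) = cst (f v).
  by apply/funext => y; rewrite derive_linear_mx.
exact: cst_continuous.
Qed.

Lemma Ck1_id V (A : set V) : Ck 1 A (id : V -> V).
Proof.
split=> [x _|v x _]; first exact: ex_diff.
have -> : (fun y => 'D_v id y) = cst v.
  by apply/funext => y; rewrite derive_id.
exact: cst_continuous.
Qed.

Lemma Ck1D V W (A : set V) (f g : V -> W) : open A ->
  Ck 1 A f -> Ck 1 A g -> Ck 1 A (fun x => f x + g x).
Proof.
move=> oA [df cf] [dg cg]; split=> [x Ax|v x Ax].
  by apply: differentiableD; [exact: df|exact: dg].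
have E y : A y -> 'D_v (fun x => f x + g x) y = 'D_v f y + 'D_v g y.
  by move=> Ay; rewrite deriveD //; apply: diff_derivable; [exact: df|exact: dg].
apply: (@open_eq_continuous _ _ _ A _ (fun y => 'D_v f y + 'D_v g y)) => //.
by apply: cvgD; [exact: cf|exact: cg].
Qed.

Lemma Ck1N V W (A : set V) (f : V -> W) : open A ->
  Ck 1 A f -> Ck 1 A (fun x => - f x).
Proof.
move=> oA [df cf]; split=> [x Ax|v x Ax].
  by apply: differentiableN; exact: df.
have E y : A y -> 'D_v (fun x => - f x) y = - 'D_v f y.
  by move=> Ay; rewrite deriveN //; apply: diff_derivable; exact: df.
apply: (@open_eq_continuous _ _ _ A _ (fun y => - 'D_v f y)) => //.
by apply: cvgN; exact: cf.
Qed.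

Lemma Ck1B V W (A : set V) (f g : V -> W) : open A ->
  Ck 1 A f -> Ck 1 A g -> Ck 1 A (fun x => f x - g x).
Proof. by move=> oA cf cg; apply: Ck1D => //; exact: Ck1N. Qed.

Lemma Ck1M V (A : set V) (f g : V -> R^o) : open A ->
  Ck 1 A f -> Ck 1 A g -> Ck 1 A (fun x => f x * g x : R^o).
Proof.
move=> oA [df cf] [dg cg]; split=> [x Ax|v x Ax].
  by apply: differentiableM; [exact: df|exact: dg].
have E y : A y -> 'D_v (fun x => f x * g x : R^o) y = f y *: 'D_v g y + g y *: 'D_v f y.
  by move=> Ay; rewrite deriveM //; apply: diff_derivable; [exact: df|exact: dg].
apply: (@open_eq_continuous _ _ _ A _ (fun y => f y *: 'D_v g y + g y *: 'D_v f y)) => //.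
have c1 : {for x, continuous (fun y => f y *: 'D_v g y)}.
  apply: scale_continuous_at; last exact: cg.
  by apply: differentiable_continuous; exact: df.
have c2 : {for x, continuous (fun y => g y *: 'D_v f y)}.
  apply: scale_continuous_at; last exact: cf.
  by apply: differentiable_continuous; exact: dg.
exact: (cvgD c1 c2).
Qed.

Lemma Ck1Z V (A : set V) (c : R) (f : V -> R^o) : open A ->
  Ck 1 A f -> Ck 1 A (fun x => c * f x : R^o).
Proof. move=> oA cf; exact: (Ck1M oA (Ck1_cst A (c : R^o)) cf). Qed.

Lemma Ck1_sum V W n (A : set V) (f : 'I_n -> V -> W) : open A ->
  (forall i, Ck 1 A (f i)) -> Ck 1 A (fun x => \sum_i f i x).
Proof.
move=> oA cf; elim: n f cf => [|n IHn] f cf.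
  under eq_fun do rewrite big_ord0; exact: Ck1_cst.
under eq_fun do rewrite big_ord_recl.
by apply: Ck1D => //; apply: IHn.
Qed.

Lemma Ck1_mxP V m n (A : set V) (f : V -> 'M[R]_(m, n)) : open A ->
  (forall i j, Ck 1 A (fun x => f x i j : R^o)) -> Ck 1 A f.
Proof.
move=> oA cf; split=> [x Ax|v x Ax].
  by apply: differentiable_mxP => i j; exact: (cf i j).1.
have E y : A y -> 'D_v f y = \sum_i \sum_j 'D_v (fun x => f x i j : R^o) y *: delta_mx i j.
  move=> Ay; rewrite derive_mx.
    rewrite [LHS]matrix_sum_delta; apply: eq_bigr => i _; apply: eq_bigr => j _.
    by rewrite mxE.
  by apply/derivable_mxP => i j; apply: diff_derivable; exact: (cf i j).1.
apply: (@open_eq_continuous _ _ _ A _ (fun y => \sum_i \sum_j 'D_v (fun x => f x i j : R^o) y *: delta_mx i j)) => //.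
apply: sum_continuous_at => i _; apply: sum_continuous_at => j _.
apply: scale_continuous_at; last exact: cst_continuous.
exact: ((cf i j).2 v x Ax).
Qed.

Lemma Ck1_mxcoord V m n (A : set V) (f : V -> 'M[R]_(m, n)) i j :
  open A -> Ck 1 A f -> Ck 1 A (fun x => f x i j : R^o).
Proof.
move=> oA [df cf]; split=> [x Ax|v x Ax].
  apply: (@differentiable_comp _ _ _ _ f (fun M : 'M[R]_(m, n) => M i j : R^o)).
    exact: df.
  exact: differentiable_coord.
have E y : A y -> 'D_v (fun x => f x i j : R^o) y = 'D_v f y i j.
  by move=> Ay; rewrite derive_mx ?mxE //; apply: diff_derivable; exact: df.
apply: (@open_eq_continuous _ _ _ A _ (fun y => 'D_v f y i j)) => //.
by apply: mxcoord_continuous_at; exact: cf.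
Qed.

End Ck1.

(** * Gradients, the squared Euclidean norm and a C^1 step function *)

Section Gradient.
Context {R : realType}.

(** The norm of rows is the maximum norm, which is not differentiable; penalties and cutoffs are
    therefore built from the squared Euclidean norm. *)
Definition sq n (v : 'rV[R]_n) : R := (v *m v^T) 0 0.

Definition grad n (g : 'rV[R]_n -> R^o) (z : 'rV[R]_n) : 'rV[R]_n :=
  \row_j 'D_(delta_mx 0 j) g z.

Lemma pairingE n (p v : 'rV[R]_n) : pairing p v = \sum_j p 0 j * v 0 j.
Proof. by rewrite /pairing mxE; apply: eq_bigr => j _; rewrite mxE. Qed.

Lemma pairing_mulmx m n (p : 'rV[R]_n) (A : 'M[R]_(m, n)) (v : 'rV[R]_m) :
  pairing (p *m A^T) v = pairing p (v *m A).
Proof. by rewrite /pairing trmx_mul mulmxA. Qed.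

Lemma pairingNl n (p v : 'rV[R]_n) : pairing (- p) v = - pairing p v.
Proof. by rewrite /pairing mulNmx mxE. Qed.

Lemma pairing_eqP n (p q : 'rV[R]_n) : (forall v, pairing p v = pairing q v) -> p = q.
Proof.
move=> pq; apply/rowP => j; have := pq (delta_mx 0 j).
rewrite !pairingE (bigD1 j)//= [in RHS](bigD1 j)//= !mxE !eqxx !mulr1 !big1 ?addr0//.
  by move=> i ij; rewrite mxE /= (negbTE ij) mulr0.
by move=> i ij; rewrite mxE /= (negbTE ij) mulr0.
Qed.

Lemma pairing_row_mx m n (p v : 'rV[R]_m) (q w : 'rV[R]_n) :
  pairing (row_mx p q) (row_mx v w) = pairing p v + pairing q w.
Proof. by rewrite /pairing tr_row_mx mul_row_col mxE. Qed.

Lemma gradP n (g : 'rV[R]_n -> R^o) z v : differentiable g z ->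
  'D_v g z = pairing (grad g z) v.
Proof.
move=> dg; rewrite derive_rowE // pairingE; apply: eq_bigr => j _.
by rewrite mxE mulrC.
Qed.

Lemma near_eq_grad n (f g : 'rV[R]_n -> R^o) z :
  (\forall y \near z, f y = g y) -> grad f z = grad g z.
Proof. by move=> fg; apply/rowP => j; rewrite !mxE (near_eq_derive _ fg). Qed.

Lemma grad_comp m n (f : 'rV[R]_m -> 'rV[R]_n) (g : 'rV[R]_n -> R^o) z :
  differentiable f z -> differentiable g (f z) ->
  grad (g \o f) z = grad g (f z) *m (jacobian f z)^T.
Proof.
move=> df dg; apply: pairing_eqP => v.
rewrite -gradP; last exact: differentiable_comp.
by rewrite derive_comp // gradP // pairing_mulmx deriveEjacobian.
Qed.

Lemma mul_row_eqP m n (A B : 'M[R]_(m, n)) :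
  (forall v : 'rV_m, v *m A = v *m B) -> A = B.
Proof. by move=> AB; apply/row_matrixP => i; rewrite !rowE AB. Qed.

Lemma jacobian_comp m n p (f : 'rV[R]_m -> 'rV[R]_n) (g : 'rV[R]_n -> 'rV[R]_p) z :
  differentiable f z -> differentiable g (f z) ->
  jacobian (g \o f) z = jacobian f z *m jacobian g (f z).
Proof.
move=> df dg; apply: mul_row_eqP => v.
rewrite -deriveEjacobian; last exact: differentiable_comp.
by rewrite derive_comp // !deriveEjacobian // mulmxA.
Qed.

Lemma near_eq_jacobian m n (f g : 'rV[R]_m -> 'rV[R]_n) z :
  (\forall y \near z, f y = g y) -> differentiable f z ->
  jacobian f z = jacobian g z.
Proof.
move=> fg df; have dg := near_eq_differentiable fg df.
apply: mul_row_eqP => v.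
apply: (etrans (esym (deriveEjacobian v df))).
by apply: (etrans (near_eq_derive v fg)); exact: deriveEjacobian.
Qed.

Lemma jacobian_id n (z : 'rV[R]_n) : jacobian (fun y : 'rV[R]_n => y) z = 1%:M.
Proof.
apply: mul_row_eqP => v; rewrite -deriveEjacobian; last exact: ex_diff.
by rewrite derive_id mulmx1.
Qed.

Lemma sqE n (v : 'rV[R]_n) : sq v = \sum_j v 0 j * v 0 j.
Proof. by rewrite /sq mxE; apply: eq_bigr => j _; rewrite mxE. Qed.

Lemma sq_ge0 n (v : 'rV[R]_n) : 0 <= sq v.
Proof. by rewrite sqE sumr_ge0 // => j _; rewrite -expr2 sqr_ge0. Qed.

Lemma coord_le_norm m n (M : 'M[R]_(m, n)) i j : `|M i j| <= `|M|.
Proof.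
rewrite [leRHS]/Num.Def.normr/= mx_normrE.
exact: (le_bigmax _ (fun k : 'I_m * 'I_n => `|M k.1 k.2|) (i, j)).
Qed.

Lemma norm_le_coord m n (M : 'M[R]_(m, n)) c :
  0 <= c -> (forall i j, `|M i j| <= c) -> `|M| <= c.
Proof.
move=> c0 Mc; rewrite [leLHS]/Num.Def.normr/= mx_normrE.
by apply: bigmax_le => // -[i j] _ /=.
Qed.

Lemma norm_le_sqrt_sq n (v : 'rV[R]_n) : `|v| <= Num.sqrt (sq v).
Proof.
apply: norm_le_coord => [|i j]; first exact: sqrtr_ge0.
rewrite -sqrtr_sqr ler_sqrt ?sq_ge0 // sqE (bigD1 j) //= (ord1 i) expr2.
by rewrite lerDl sumr_ge0 // => k _; rewrite -expr2 sqr_ge0.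
Qed.

Lemma pairing_le_norm n (p v : 'rV[R]_n) : `|pairing p v| <= n%:R * (`|p| * `|v|).
Proof.
rewrite pairingE (le_trans (ler_norm_sum _ _ _)) //.
apply: (@le_trans _ _ (\sum_(j < n) `|p| * `|v|)).
  by apply: ler_sum => j _; rewrite normrM ler_pM // coord_le_norm.
by rewrite sumr_const card_ord mulr_natl.
Qed.

Lemma sq0 n : sq (0 : 'rV[R]_n) = 0.
Proof. by rewrite /sq mul0mx mxE. Qed.

Lemma sq_eq0 n (v : 'rV[R]_n) : sq v = 0 -> v = 0.
Proof.
move=> v0; apply/eqP; rewrite -normr_le0 (le_trans (norm_le_sqrt_sq _)) //.
by rewrite v0 sqrtr0.
Qed.


Lemma Ck1_sq n (A : set 'rV[R]_n) : open A -> Ck 1 A (@sq n : 'rV[R]_n -> R^o).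
Proof.
move=> oA; rewrite (_ : @sq n = fun v => \sum_j v 0 j * v 0 j); last first.
  by apply/funext => v; rewrite sqE.
apply: Ck1_sum => // j.
by apply: (@Ck1M _ _ A (fun v : 'rV[R]_n => v 0 j) (fun v : 'rV[R]_n => v 0 j)) => //;
  apply: Ck1_mxcoord => //; exact: Ck1_id.
Qed.

Lemma derive_sq n (z v : 'rV[R]_n) : 'D_v (@sq n : 'rV[R]_n -> R^o) z = 2 * pairing z v.
Proof.
have dc (j : 'I_n) : derivable (fun y : 'rV[R]_n => y 0 j : R^o) z v.
  by apply: diff_derivable; exact: differentiable_coord.
rewrite (_ : @sq n = \sum_j ((fun v : 'rV[R]_n => v 0 j) * (fun v => v 0 j))); last first.
  by apply/funext => y; rewrite sqE fct_sumE.
rewrite derive_sum; last by move=> j; apply: derivableM.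
rewrite pairingE mulr_sumr; apply: eq_bigr => j _.
rewrite deriveM // -[_ + _]mulr2n -[LHS]mulr_natl; congr (2 * (z 0 j * _)).
have := derive_mx (@derivable_id R _ z v); rewrite derive_id => /rowP/(_ j).
by rewrite mxE.
Qed.

Lemma grad_sq n (z : 'rV[R]_n) : grad (@sq n : 'rV[R]_n -> R^o) z = 2 *: z.
Proof.
apply: pairing_eqP => v; rewrite -gradP; last first.
  exact: (Ck1_sq openT).1.
by apply: (etrans (derive_sq _ _)); rewrite /pairing -scalemxAl [RHS]mxE.
Qed.

(** A C^1 function vanishing on a half-line; C^1 is all that the test functions of the Frechet
    subdifferential ask for. *)
Definition posq (t : R^o) : R^o := Num.max 0 t ^+ 2.

Lemma posq_le0 t : t <= 0 -> posq t = 0.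
Proof. by move=> t0; rewrite /posq max_l // expr0n. Qed.

Lemma posq_ge0 t : 0 <= t -> posq t = t ^+ 2.
Proof. by move=> t0; rewrite /posq max_r. Qed.

Lemma is_derive_posq (t : R^o) : is_derive t (1 : R^o) posq (2 * Num.max 0 t).
Proof.
have [t0|t0|->] := ltgtP t 0.
- apply: (@near_eq_is_derive _ _ _ (cst 0)).
    near=> s; rewrite posq_le0 //; apply/ltW; near: s; exact: lt_nbhsl.
  by rewrite mulr0; exact: is_derive_cst.
- apply: (@near_eq_is_derive _ _ _ (fun s : R^o => s ^+ 2 : R^o)).
    near=> s; rewrite posq_ge0 //; apply/ltW; near: s; exact: lt_nbhsr.
  apply: DeriveDef; first exact: exprn_derivable.
  by apply: (etrans (exp_derive _ _ _)); rewrite expr1 /GRing.scale/= mulr1.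
- rewrite mulr0.
  have H : (fun h : R => h^-1 *: (posq (h *: (1 : R^o) + 0) - posq 0)) @ 0^' --> (0 : R^o).
    rewrite posq_le0 //.
    apply/cvgrPdist_le => e e0; near=> h.
    rewrite sub0r normrN subr0 addr0 /GRing.scale/= mulr1.
    have h0 : h != 0 by near: h; exact: nbhs_dnbhs_neq.
    have [hl|hl] := leP h 0; first by rewrite posq_le0 // mulr0 normr0 ltW.
    rewrite posq_ge0 ?(ltW hl) // expr2 mulrA mulVf // mul1r.
    by near: h; apply: dnbhs0_le.
  apply: DeriveDef; first by apply/cvg_ex; exists 0.
  exact: cvg_lim H.
Unshelve. all: by end_near. Qed.

Lemma Ck1_posq : Ck 1 setT posq.
Proof.
have dp t : differentiable posq t.
  by apply/derivable1_diffP; have [] := is_derive_posq t.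
split=> // v t _.
have -> : (fun y => 'D_v posq y) = (fun y : R^o => v *: (2 * Num.max 0 y)).
  apply/funext => y; rewrite derive_realE //.
  by have [_ ->] := is_derive_posq y.
apply: scale_continuous_at; first exact: cst_continuous.
apply: (@cvgM _ _ _ _ (cst 2) (Num.max 0)); first exact: cvg_cst.
by apply: continuous_max; [exact: cst_continuous|move=> ?; exact: cvg_id].
Qed.

(** A C^1 transition from 0 to 1: the inner [posq] is 0 for nonpositive arguments, and the outer one
    saturates once [posq t] reaches 1. *)
Definition smoothstep (t : R^o) : R^o := 1 - posq (1 - posq t).

Lemma Ck1_smoothstep : Ck 1 setT smoothstep.
Proof.
have c1 : Ck 1 setT (fun t : R^o => 1 - posq t).
  by apply: Ck1B; [exact: openT|exact: Ck1_cst|exact: Ck1_posq].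
apply: Ck1B; [exact: openT|exact: Ck1_cst|].
exact: (Ck1_comp_real openT _ c1 Ck1_posq).
Qed.

Lemma smoothstep_le0 t : t <= 0 -> smoothstep t = 0.
Proof. by move=> t0; rewrite /smoothstep (posq_le0 t0) subr0 posq_ge0 // expr1n subrr. Qed.

Lemma smoothstep_ge1 t : 1 <= t -> smoothstep t = 1.
Proof.
move=> t1; rewrite /smoothstep (posq_ge0 (le_trans ler01 t1)).
by rewrite posq_le0 ?subr0 // subr_le0 exprn_ege1.
Qed.

End Gradient.

(** * Charts and subgradients *)

Section Cutoff.
Context {R : realType} {n : nat}.
Implicit Types (W K : set 'rV[R]_n) (z : 'rV[R]_n).

Lemma closed_ball_rV_compact (z : 'rV[R]_n) (r : R) :
  compact [set y : 'rV[R]_n | `|y - z| <= r].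
Proof.
apply: bounded_closed_compact.
  exists (`|z| + r); split; first exact: num_real.
  move=> M rM y /= yz; apply: (le_trans _ (ltW rM)).
  by rewrite -(subrK z y) (le_trans (ler_normD _ _)) // addrC lerD2l.
have c : continuous (fun y : 'rV[R]_n => `|y - z|).
  move=> y; apply: (@continuous_comp _ _ _ (fun y : 'rV[R]_n => y - z) Num.norm).
    by apply: (@continuousB _ _ _ id (cst z)); [exact: cvg_id|exact: cst_continuous].
  exact: norm_continuous.
have -> : [set y : 'rV[R]_n | `|y - z| <= r] =
    (fun y : 'rV[R]_n => `|y - z|) @^-1` [set t | t <= r] by [].
by apply: closed_comp => [y _|]; [exact: c|exact: closed_le].
Qed.

(** Test functions must be C^1 on the whole manifold, whereas the smooth terms of the problem live
    in one chart. Multiplication by a bump makes them global and leaves them unchanged near [z]. *)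
Lemma local_cutoff W z (g : 'rV[R]_n -> R^o) : open W -> W z -> Ck 1 W g ->
  exists (h : 'rV[R]_n -> R^o) (K : set 'rV[R]_n),
    [/\ Ck 1 setT h, compact K, K `<=` W, (\forall y \near z, h y = g y) &
        forall y, ~ K y -> h y = 0].
Proof.
move=> oW Wz cg.
have [r /= r0 rW] : exists2 r : R, 0 < r & ball z r `<=` W.
  by move/open_nbhs_nbhs: (conj oW Wz) => /nbhs_ballP.
have r20 : 0 < r / 2 by rewrite divr_gt0.
set rho := r / 2 in r20.
pose K := [set y : 'rV[R]_n | `|y - z| <= rho].
(* The argument of [smoothstep] is 2 at [z], hence at least 1 nearby, and at most 0 once
   [sq (y - z)] reaches [rho ^+ 2]. The latter covers the complement of [K], because the maximum
   norm is below the Euclidean one. *)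
pose psi (y : 'rV[R]_n) : R^o := smoothstep (2 - 2 / rho ^+ 2 * sq (y - z)).
have csq : Ck 1 setT (fun y : 'rV[R]_n => 2 - 2 / rho ^+ 2 * sq (y - z) : R^o).
  apply: Ck1B; [exact: openT|exact: Ck1_cst|].
  apply: Ck1Z; first exact: openT.
  apply: (@Ck1_comp _ _ _ _ _ setT (fun y : 'rV[R]_n => y - z)) => //.
  - exact: openT.
  - by apply: Ck1B; [exact: openT|exact: Ck1_id|exact: Ck1_cst].
  - exact: Ck1_sq openT.
have cpsi : Ck 1 setT psi by apply: (Ck1_comp_real openT _ csq Ck1_smoothstep).
have psi0 y : ~ K y -> psi y = 0.
  move/negP; rewrite -ltNge => yK; apply: smoothstep_le0.
  rewrite subr_le0 -mulrA ler_pMr // ler_pdivlMl ?exprn_gt0 // mulr1.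
  apply: (@le_trans _ _ (Num.sqrt (sq (y - z)) ^+ 2)).
    rewrite lerXn2r ?nnegrE ?sqrtr_ge0 ?(ltW r20) //.
    exact: le_trans (ltW yK) (norm_le_sqrt_sq _).
  by rewrite sqr_sqrtr ?sq_ge0.
have psi1 : \forall y \near z, psi y = 1.
  have : {for z, continuous (fun y : 'rV[R]_n => 2 - 2 / rho ^+ 2 * sq (y - z) : R^o)}.
    by apply: differentiable_continuous; exact: csq.1.
  move=> /cvgrPdist_lt /(_ 1 ltr01); apply: filterS => y.
  rewrite subrr sq0 mulr0 subr0 => /= /(le_lt_trans (ler_norm _)) H.
  by apply: smoothstep_ge1; move: H; lra.
clear csq; clearbody psi.
have KW : K `<=` W.
  move=> y Ky; apply: rW; rewrite -ball_normE /= distrC.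
  by rewrite (le_lt_trans Ky) // /rho; lra.
exists (fun y => if `[< W y >] then psi y * g y else 0), K; split; last 1 first.
- by move=> y Ky; case: ifP => // _; rewrite psi0 ?mul0r.
- apply: Ck1_local => y _; have [Wy|Wy] := pselect (W y).
    exists W, (fun y => psi y * g y); split; first by split.
      exact: (Ck1M oW (Ck1_subset (@subsetT _ W) cpsi) cg).
    by move=> t Wt; rewrite asboolT.
  (* Off [W] a whole neighbourhood misses [K], and there both branches vanish. *)
  exists (~` K), (cst 0); split; last first.
  + by move=> t Kt; case: ifP => // _; rewrite psi0 ?mul0r.
  + exact: Ck1_cst.
  + split; last by move/KW.
    rewrite openC; apply: compact_closed; first exact: norm_hausdorff.
    exact: closed_ball_rV_compact.
- exact: closed_ball_rV_compact.
- exact: KW.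
- have : \forall y \near z, W y by apply: open_nbhs_nbhs.
  by apply: filterS2 psi1 => y -> Wy; rewrite asboolT // mul1r.
Qed.

End Cutoff.

(** * Charts, transition maps and global test functions *)

Section Charts.
Context {R : realType} {X : ratlas R}.
Hypothesis hX : riemannian X.
Implicit Types (x y : X).

Lemma chart_codm x y : dom x y -> codm x (chart x y).
Proof. by move=> xy; exists y. Qed.

Lemma chart_self x : codm x (chart x x).
Proof. by apply: chart_codm; exact: riem_dom_self. Qed.

Lemma chinv_self x : chinv x (chart x x) = x.
Proof. by rewrite riem_chartK //; exact: riem_dom_self. Qed.

Lemma chinvK x z : codm x z -> chart x (chinv x z) = z.
Proof. by case=> y xy <-; rewrite riem_chartK. Qed.

Lemma dom_chinv x z : codm x z -> dom x (chinv x z).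
Proof. by case=> y xy <-; rewrite riem_chartK. Qed.

Lemma near_dom x y : dom x y -> \forall t \near y, dom x t.
Proof. by move=> xy; apply: open_nbhs_nbhs; split=> //; exact: riem_dom_open. Qed.

Lemma near_codm x z : codm x z -> \forall t \near z, codm x t.
Proof. by move=> xz; apply: open_nbhs_nbhs; split=> //; exact: riem_codm_open. Qed.

Lemma near_chinv x z (P : set X) : codm x z -> (\forall t \near chinv x z, P t) ->
  \forall w \near z, P (chinv x w).
Proof. by move=> xz; exact: (riem_chinv_continuous hX xz). Qed.

Lemma near_chart x y (P : set 'rV[R]_(dim X)) : dom x y ->
  (\forall w \near chart x y, P w) -> \forall t \near y, P (chart x t).
Proof. by move=> xy; exact: (riem_chart_continuous hX xy). Qed.

Lemma overlapE x y :
  chart x @` (dom x `&` dom y) = codm x `&` chinv x @^-1` dom y.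
Proof.
apply/seteqP; split=> z /=.
  move=> [t [xt yt] <-]; split; first exact: chart_codm.
  by rewrite riem_chartK.
by move=> [xz yz]; exists (chinv x z); [split=> //; exact: dom_chinv|exact: chinvK].
Qed.

Lemma open_overlap x y : open (chart x @` (dom x `&` dom y)).
Proof.
rewrite overlapE openE => z [xz yz]; apply: filterI; first exact: near_codm.
by apply: near_chinv xz _; exact: near_dom.
Qed.

Lemma transE x y z : dom x z -> trans x y (chart x z) = chart y z.
Proof. by move=> xz; rewrite /trans /= riem_chartK. Qed.

Lemma trans_differentiable x y z : dom x z -> dom y z ->
  differentiable (trans x y) (chart x z).
Proof. by move=> xz yz; apply: (riem_trans_smooth hX x y 1).1; exists z. Qed.

Lemma jacobian_transV x y z : dom x z -> dom y z ->
  jacobian (trans x y) (chart x z) *m jacobian (trans y x) (chart y z) = 1%:M.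
Proof.
move=> xz yz; have dxy := trans_differentiable xz yz.
have dyx := trans_differentiable yz xz.
have dyx' : differentiable (trans y x) (trans x y (chart x z)) by rewrite transE.
have := jacobian_comp dxy dyx'; rewrite transE // => <-.
apply: etrans (jacobian_id (chart x z)).
apply/esym/near_eq_jacobian; last exact: ex_diff.
have : \forall t \near chart x z, (chart x @` (dom x `&` dom y)) t.
  by apply: open_nbhs_nbhs; split; [exact: open_overlap|exists z].
by apply: filterS => _ [t [xt yt] <-]; rewrite /= transE // transE.
Qed.

Lemma pairing_cot_tan x y p v : dom x y ->
  pairing (cot_coord x y p) (tan_coord x y v) = pairing p v.
Proof.
move=> xy; rewrite /cot_coord /tan_coord pairing_mulmx -mulmxA.
rewrite jacobian_transV ?mulmx1 //; exact: riem_dom_self.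
Qed.

(** The delicate points are those outside [dom x] that are limits of points of the chart. The image
    of [K] is compact, hence closed in a Hausdorff space, and the extension vanishes on its open
    complement. *)
Lemma C1_fun_extend x (h : 'rV[R]_(dim X) -> R^o) K :
  Ck 1 setT h -> compact K -> K `<=` codm x -> (forall z, ~ K z -> h z = 0) ->
  C1_fun (fun y : X => if `[< dom x y >] then h (chart x y) else 0).
Proof.
move=> ch cK Kx h0 y; apply: Ck1_local => z yz.
have [xz|xz] := pselect (dom x (chinv y z)).
  exists (chart y @` (dom y `&` dom x)), (h \o trans y x); split.
  - split; first exact: open_overlap.
    by rewrite overlapE.
  - apply: (@Ck1_comp _ _ _ _ _ setT) => //; first exact: open_overlap.
    exact: (riem_trans_smooth hX y x 1).
  - by move=> _ [t [yt xt] <-]; rewrite /= transE // riem_chartK // asboolT.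
have cC : closed (chinv x @` K).
  apply: compact_closed; first exact: riem_hausdorff.
  apply: continuous_compact => //.
  apply: continuous_in_subspaceT => t /set_mem /Kx; exact: riem_chinv_continuous.
have oC : open (~` (chinv x @` K)) by rewrite openC.
have NC : (~` (chinv x @` K)) (chinv y z).
  by move=> [t Kt E]; apply: xz; rewrite -E; apply: dom_chinv; exact: Kx.
exists (codm y `&` chinv y @^-1` (~` (chinv x @` K))), (cst 0); split.
- split=> //; rewrite openE => t [yt NCt]; apply: filterI; first exact: near_codm.
  by apply: near_chinv yt _; apply: open_nbhs_nbhs.
- exact: Ck1_cst.
- move=> t [yt NCt]; rewrite /=; case: ifPn => // /asboolP xt; apply: h0 => Kt.
  by apply: NCt; exists (chart x (chinv y t)) => //; rewrite riem_chartK.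
Qed.

(** [dfun] differentiates in the preferred chart of the point [chinv x z], which changes with [z];
    [cot_coord] brings the covector back to the fixed chart at [x]. The two transition Jacobians are
    inverse to each other, so the plain gradient remains. *)
Lemma cot_coord_dfun x z (h : X -> R) (g : 'rV[R]_(dim X) -> R^o) :
  codm x z -> differentiable g z -> (\forall w \near z, h (chinv x w) = g w) ->
  cot_coord x (chinv x z) (dfun h (chinv x z)) = grad g z.
Proof.
move=> xz dg hg; set y := chinv x z.
have xy : dom x y := dom_chinv xz.
have yy : dom y y := riem_dom_self hX y.
have zE : chart x y = z := chinvK xz.
have dt := trans_differentiable yy xy.
have -> : dfun h y = grad (g \o trans y x) (chart y y).
  apply: (@near_eq_grad _ _ (h \o chinv y)).
  have H1 : \forall t \near chart y y, codm y t.
    by apply: near_codm; exact: chart_self.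
  have H2 : \forall t \near chart y y, dom x (chinv y t).
    by apply: near_chinv; [exact: chart_self|rewrite chinv_self; exact: near_dom].
  have H3 : \forall t \near chart y y, h (chinv x (trans y x t)) = g (trans y x t).
    have ct := differentiable_continuous dt.
    rewrite /prop_for /continuous_at transE // zE in ct.
    exact: ct _ hg.
  near=> t; rewrite /= -[RHS](near H3 t) //; congr h.
  by rewrite /trans /= riem_chartK //; near: t.
rewrite grad_comp //; last by rewrite transE // zE.
rewrite transE // zE /cot_coord -mulmxA -trmx_mul.
by rewrite jacobian_transV // trmx1 mulmx1.
Unshelve. all: by end_near. Qed.

Lemma C1_fun_of_local x (W : set 'rV[R]_(dim X)) (g : 'rV[R]_(dim X) -> R^o) z :
  open W -> W `<=` codm x -> W z -> Ck 1 W g ->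
  exists2 h : X -> R, C1_fun h & \forall w \near z, h (chinv x w) = g w.
Proof.
move=> oW Wx Wz cg; have [h [K [ch cK KW hg h0]]] := local_cutoff oW Wz cg.
exists (fun y : X => if `[< dom x y >] then h (chart x y) else 0).
  by apply: C1_fun_extend ch cK _ h0; exact: subset_trans Wx.
have : \forall w \near z, W w by apply: open_nbhs_nbhs.
apply: filterS2 hg => w <- /Wx xw.
by rewrite asboolT ?chinvK //; exact: dom_chinv.
Qed.

(** Fermat's rule: at a local minimum of [f + g] in coordinates, [- g] made global is a test
    function for [f]. All first-order conditions of the penalized problem come from here and from
    the version for two factors. *)
Lemma frechet_subdiff_of_min x (f : X -> \bar R) (W : set 'rV[R]_(dim X))
    (g : 'rV[R]_(dim X) -> R^o) z :
  open W -> W `<=` codm x -> W z -> Ck 1 W g -> f (chinv x z) \is a fin_num ->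
  (\forall w \near z, f (chinv x z) + (g z)%:E <= f (chinv x w) + (g w)%:E)%E ->
  exists2 p, frechet_subdiff f (chinv x z) p &
    cot_coord x (chinv x z) p = - grad g z.
Proof.
move=> oW Wx Wz cg ffin fmin.
have cNg : Ck 1 W (fun w => - g w) by exact: Ck1N.
have [h ch hg] := C1_fun_of_local oW Wx Wz cNg.
have xz := Wx _ Wz.
exists (dfun h (chinv x z)).
  split=> //; exists h; split=> //.
  have hz : h (chinv x z) = - g z := nbhs_singleton hg.
  have zE : chart x (chinv x z) = z := chinvK xz.
  have xy0 := dom_chinv xz.
  have H1 : \forall y \near chinv x z,
      (f (chinv x z) + (g z)%:E <= f (chinv x (chart x y)) + (g (chart x y))%:E)%E.
    apply: (near_chart (P := fun w =>
      (f (chinv x z) + (g z)%:E <= f (chinv x w) + (g w)%:E)%E) xy0).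
    by rewrite zE.
  have H2 : \forall y \near chinv x z, h (chinv x (chart x y)) = - g (chart x y).
    by apply: (near_chart (P := fun w => h (chinv x w) = - g w) xy0); rewrite zE.
  have := near_dom xy0.
  apply: filterS3 H1 H2 => y /= {}H1 {}H2 xy.
  rewrite hz; rewrite (riem_chartK hX xy) in H1 H2; rewrite H2.
  by rewrite !EFinN !oppeK.
rewrite (@cot_coord_dfun _ _ _ (fun w => - g w)) //; last exact: cNg.1.
apply/rowP => j; rewrite !mxE deriveN //; apply: diff_derivable; exact: cg.1.
Qed.

End Charts.

(** * Derivatives of rows assembled from blocks *)

Section Rows.
Context {R : realType} {V : normedModType R}.

Lemma row_mx_entry m n1 n2 (T : Type) (A : 'M[T]_(m, n1)) (B : 'M[T]_(m, n2)) i j :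
  row_mx A B i j = match fintype.split j with inl k => A i k | inr k => B i k end.
Proof. by rewrite mxE. Qed.

Lemma differentiable_row_mx n1 n2 (f : V -> 'rV[R]_n1) (g : V -> 'rV[R]_n2) x :
  differentiable f x -> differentiable g x ->
  differentiable (fun y => row_mx (f y) (g y)) x.
Proof.
move=> df dg; apply: differentiable_mxP => i j.
under eq_fun do rewrite row_mx_entry.
case: (fintype.split j) => k.
  apply: (@differentiable_comp _ _ _ _ f (fun M : 'rV[R]_n1 => M i k : R^o)) => //.
  exact: differentiable_coord.
apply: (@differentiable_comp _ _ _ _ g (fun M : 'rV[R]_n2 => M i k : R^o)) => //.
exact: differentiable_coord.
Qed.

Lemma derive_row_mx n1 n2 (f : V -> 'rV[R]_n1) (g : V -> 'rV[R]_n2) x v :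
  differentiable f x -> differentiable g x ->
  'D_v (fun y => row_mx (f y) (g y)) x = row_mx ('D_v f x) ('D_v g x).
Proof.
move=> df dg; rewrite derive_mx; last first.
  by apply: diff_derivable; exact: differentiable_row_mx.
apply/matrixP => i j; rewrite mxE row_mx_entry.
under eq_fun do rewrite row_mx_entry.
by case: (fintype.split j) => k; rewrite derive_mx ?mxE //; exact: diff_derivable.
Qed.

Lemma Ck1_row_mx n1 n2 A (f : V -> 'rV[R]_n1) (g : V -> 'rV[R]_n2) : open A ->
  Ck 1 A f -> Ck 1 A g -> Ck 1 A (fun y => row_mx (f y) (g y)).
Proof.
move=> oA cf cg; apply: Ck1_mxP => // i j.
under eq_fun do rewrite row_mx_entry.
by case: (fintype.split j) => k; exact: Ck1_mxcoord.
Qed.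

Lemma differentiable_mxrow n (d : 'I_n -> nat) (f : forall i, V -> 'rV[R]_(d i)) x :
  (forall i, differentiable (f i) x) ->
  differentiable (fun y => \mxrow_i f i y) x.
Proof.
move=> df; apply: differentiable_mxP => i j.
under eq_fun do rewrite mxE.
apply: (@differentiable_comp _ _ _ _ (f (tagnat.sig1 j))
  (fun M : 'rV[R]_(d (tagnat.sig1 j)) => M i (tagnat.sig2 j) : R^o)) => //.
exact: differentiable_coord.
Qed.

Lemma derive_mxrow n (d : 'I_n -> nat) (f : forall i, V -> 'rV[R]_(d i)) x v :
  (forall i, differentiable (f i) x) ->
  'D_v (fun y => \mxrow_i f i y) x = \mxrow_i 'D_v (f i) x.
Proof.
move=> df; rewrite derive_mx; last first.
  by apply: diff_derivable; exact: differentiable_mxrow.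
apply/matrixP => i j; rewrite !mxE.
under eq_fun do rewrite mxE.
by rewrite derive_mx ?mxE //; exact: diff_derivable.
Qed.

Lemma Ck1_mxrow n (d : 'I_n -> nat) A (f : forall i, V -> 'rV[R]_(d i)) : open A ->
  (forall i, Ck 1 A (f i)) -> Ck 1 A (fun y => \mxrow_i f i y).
Proof.
move=> oA cf; apply: Ck1_mxP => // i j.
under eq_fun do rewrite mxE.
exact: Ck1_mxcoord.
Qed.

End Rows.

Lemma cvg_prod_map (S T S' T' : topologicalType) (f : S -> S') (g : T -> T')
    (s : S) (t : T) (a : S') (b : T') :
  f @ s --> a -> g @ t --> b -> (fun p => (f p.1, g p.2)) @ (s, t) --> (a, b).
Proof.
move=> fa gb A [[P Q] /= [Pa Qb] PQ].
exists (f @^-1` P, g @^-1` Q) => /=; first by split; [exact: fa|exact: gb].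
by move=> [u v] /= [Pu Qv]; apply: (PQ (_, _)).
Qed.

(** * Subgradients on a product of two manifolds *)

Section Prod2.
Context {R : realType} {X Y : ratlas R}.
Hypotheses (hX : riemannian X) (hY : riemannian Y).

(** An open box containing the chart range of the product; its openness is read off from the
    factors. *)
Let O (x : prod2 X Y) : set 'rV[R]_(dim X + dim Y) :=
  [set z | codm x.1 (lsubmx z) /\ codm x.2 (rsubmx z)].

Let open_O x : open (O x).
Proof.
have -> : O x = lsubmx @^-1` codm x.1 `&` rsubmx @^-1` codm x.2 by [].
apply: openI; apply: open_comp.
- by move=> z _; exact: linear_mx_continuous.
- exact: riem_codm_open.
- by move=> z _; exact: linear_mx_continuous.
- exact: riem_codm_open.
Qed.

Let codm_O x : @codm R (prod2 X Y) x `<=` O x.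
Proof.
move=> _ [y [d1 d2] <-]; rewrite /O /= row_mxKl row_mxKr.
by split; exact: chart_codm.
Qed.

Lemma C1_fun_prod2 (h1 : X -> R) (h2 : Y -> R) : C1_fun h1 -> C1_fun h2 ->
  @C1_fun R (prod2 X Y) (fun p => h1 p.1 + h2 p.2).
Proof.
move=> c1 c2 x; apply: (Ck1_subset (codm_O (x := x))).
apply: (@Ck1D _ _ _ _ (fun z => h1 (chinv x.1 (lsubmx z)) : R^o)
  (fun z => h2 (chinv x.2 (rsubmx z)) : R^o)); first exact: open_O.
  apply: (@Ck1_comp _ _ _ _ _ (codm x.1) lsubmx (h1 \o chinv x.1)) (c1 x.1).
  - exact: open_O.
  - by move=> z [].
  - exact: Ck1_linear.
apply: (@Ck1_comp _ _ _ _ _ (codm x.2) rsubmx (h2 \o chinv x.2)) (c2 x.2).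
- exact: open_O.
- by move=> z [].
- exact: Ck1_linear.
Qed.

Lemma dfun_prod2 (h1 : X -> R) (h2 : Y -> R) (x : X) (y : Y) :
  C1_fun h1 -> C1_fun h2 ->
  @dfun R (prod2 X Y) (fun p => h1 p.1 + h2 p.2) (x, y) =
    row_mx (dfun h1 x) (dfun h2 y).
Proof.
move=> c1 c2; apply: pairing_eqP => v.
set z : 'rV[R]_(dim X + dim Y) := row_mx (chart x x) (chart y y).
have d1 : differentiable (h1 \o chinv x : _ -> R^o) (lsubmx z).
  by rewrite row_mxKl; apply: (c1 x).1; exact: chart_self.
have d2 : differentiable (h2 \o chinv y : _ -> R^o) (rsubmx z).
  by rewrite row_mxKr; apply: (c2 y).1; exact: chart_self.
have dl : differentiable (lsubmx : 'rV[R]_(dim X + dim Y) -> 'rV_(dim X)) z.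
  exact: linear_mx_differentiable.
have dr : differentiable (rsubmx : 'rV[R]_(dim X + dim Y) -> 'rV_(dim Y)) z.
  exact: linear_mx_differentiable.
have d1' := differentiable_comp dl d1.
have d2' := differentiable_comp dr d2.
transitivity ('D_v (((h1 \o chinv x) \o lsubmx) + ((h2 \o chinv y) \o rsubmx)
    : 'rV[R]_(dim X + dim Y) -> R^o) z).
  by apply/esym/gradP/differentiableD.
rewrite deriveD; [|exact: diff_derivable|exact: diff_derivable].
rewrite (derive_comp v dl d1) (derive_comp v dr d2).
rewrite (derive_linear_mx lsubmx) (derive_linear_mx rsubmx).
rewrite (gradP _ d1) (gradP _ d2) -[in RHS](hsubmxK v) pairing_row_mx.
by rewrite {1 2}/z row_mxKl row_mxKr.
Qed.

Lemma cot_coord_prod2 (x1 y1 : X) (x2 y2 : Y) (p : 'rV[R]_(dim X)) (q : 'rV[R]_(dim Y)) :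
  dom x1 y1 -> dom x2 y2 ->
  @cot_coord R (prod2 X Y) (x1, x2) (y1, y2) (row_mx p q) =
    row_mx (cot_coord x1 y1 p) (cot_coord x2 y2 q).
Proof.
move=> xy1 xy2; apply: pairing_eqP => v.
rewrite /cot_coord pairing_mulmx.
set z : 'rV[R]_(dim X + dim Y) := row_mx (chart x1 y1) (chart x2 y2).
have dl : differentiable (lsubmx : 'rV[R]_(dim X + dim Y) -> 'rV_(dim X)) z.
  exact: linear_mx_differentiable.
have dr : differentiable (rsubmx : 'rV[R]_(dim X + dim Y) -> 'rV_(dim Y)) z.
  exact: linear_mx_differentiable.
have d1 : differentiable (trans x1 y1) (lsubmx z).
  by rewrite row_mxKl; apply: trans_differentiable => //; exact: riem_dom_self.
have d2 : differentiable (trans x2 y2) (rsubmx z).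
  by rewrite row_mxKr; apply: trans_differentiable => //; exact: riem_dom_self.
have d1' := differentiable_comp dl d1.
have d2' := differentiable_comp dr d2.
have -> : v *m jacobian (@trans R (prod2 X Y) (x1, x2) (y1, y2)) z =
    row_mx (lsubmx v *m jacobian (trans x1 y1) (chart x1 y1))
           (rsubmx v *m jacobian (trans x2 y2) (chart x2 y2)).
  apply: (etrans (esym (deriveEjacobian v (differentiable_row_mx d1' d2')))).
  rewrite derive_row_mx // (derive_comp v dl d1) (derive_comp v dr d2).
  rewrite (derive_linear_mx lsubmx) (derive_linear_mx rsubmx).
  rewrite (deriveEjacobian _ d1) (deriveEjacobian _ d2).
  by rewrite {1 2}/z row_mxKl row_mxKr.
by rewrite pairing_row_mx -[in RHS](hsubmxK v) pairing_row_mx !pairing_mulmx.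
Qed.

(** A separable smooth term [g1 + g2] is the case that occurs: the dynamics sees the copy [s] of the
    control and the constraint function the copy [x], so no quadratic term contains the state
    together with [x]. *)
Lemma frechet_subdiff_of_min2 (x : X) (y : Y) (f : prod2 X Y -> R)
    (W1 : set 'rV[R]_(dim X)) (W2 : set 'rV[R]_(dim Y))
    (g1 : 'rV[R]_(dim X) -> R^o) (g2 : 'rV[R]_(dim Y) -> R^o) z1 z2 :
  open W1 -> W1 `<=` codm x -> W1 z1 -> Ck 1 W1 g1 ->
  open W2 -> W2 `<=` codm y -> W2 z2 -> Ck 1 W2 g2 ->
  (\forall w \near (z1, z2), f (chinv x z1, chinv y z2) + g1 z1 + g2 z2
     <= f (chinv x w.1, chinv y w.2) + g1 w.1 + g2 w.2) ->
  exists p1 p2, [/\ @frechet_subdiff R (prod2 X Y) (EFin \o f)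
                      (chinv x z1, chinv y z2) (row_mx p1 p2),
    cot_coord x (chinv x z1) p1 = - grad g1 z1 &
    cot_coord y (chinv y z2) p2 = - grad g2 z2].
Proof.
move=> oW1 W1x Wz1 cg1 oW2 W2y Wz2 cg2 fmin.
have cNg1 : Ck 1 W1 (fun w => - g1 w) by exact: Ck1N.
have cNg2 : Ck 1 W2 (fun w => - g2 w) by exact: Ck1N.
have [h1 ch1 hg1] := C1_fun_of_local hX oW1 W1x Wz1 cNg1.
have [h2 ch2 hg2] := C1_fun_of_local hY oW2 W2y Wz2 cNg2.
have xz := W1x _ Wz1; have yz := W2y _ Wz2.
have xy1 := dom_chinv hX xz; have xy2 := dom_chinv hY yz.
exists (dfun h1 (chinv x z1)), (dfun h2 (chinv y z2)); split.
- split=> //; exists (fun p => h1 p.1 + h2 p.2); split.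
  + exact: C1_fun_prod2.
  + by rewrite dfun_prod2.
  + have e1 : h1 (chinv x z1) = - g1 z1 := nbhs_singleton hg1.
    have e2 : h2 (chinv y z2) = - g2 z2 := nbhs_singleton hg2.
    have cc : (fun p : X * Y => (chart x p.1, chart y p.2)) @
        (chinv x z1, chinv y z2) --> (z1, z2).
      apply: cvg_prod_map.
        have H := riem_chart_continuous hX xy1.
        by rewrite /prop_for /continuous_at chinvK in H.
      have H := riem_chart_continuous hY xy2.
      by rewrite /prop_for /continuous_at chinvK in H.
    have H1 : \forall w \near (z1, z2), h1 (chinv x w.1) = - g1 w.1.
      exact: (cvg_fst (F := nbhs z1) (G := nbhs z2) hg1).
    have H2 : \forall w \near (z1, z2), h2 (chinv y w.2) = - g2 w.2.
      exact: (cvg_snd (F := nbhs z1) (G := nbhs z2) hg2).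
    have D1 : \forall p \near (chinv x z1, chinv y z2), dom x p.1.
      exact: (cvg_fst (F := nbhs (chinv x z1)) (G := nbhs (chinv y z2)) (near_dom hX xy1)).
    have D2 : \forall p \near (chinv x z1, chinv y z2), dom y p.2.
      exact: (cvg_snd (F := nbhs (chinv x z1)) (G := nbhs (chinv y z2)) (near_dom hY xy2)).
    near=> p.
    have E1 : chinv x (chart x p.1) = p.1 by rewrite riem_chartK //; near: p.
    have E2 : chinv y (chart y p.2) = p.2 by rewrite riem_chartK //; near: p.
    have : f (chinv x z1, chinv y z2) + g1 z1 + g2 z2 <=
        f (chinv x (chart x p.1), chinv y (chart y p.2)) + g1 (chart x p.1) + g2 (chart y p.2).
      by near: p; exact: (cc _ fmin).
    have F1 : h1 (chinv x (chart x p.1)) = - g1 (chart x p.1).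
      by near: p; exact: (cc _ H1).
    have F2 : h2 (chinv y (chart y p.2)) = - g2 (chart y p.2).
      by near: p; exact: (cc _ H2).
    rewrite E1 in F1 *; rewrite E2 in F2 *.
    rewrite /= -!EFinD lee_fin F1 F2 e1 e2 -surjective_pairing; lra.
- rewrite (@cot_coord_dfun _ _ hX _ _ _ (fun w => - g1 w)) //; last exact: cNg1.1.
  by apply/rowP => j; rewrite !mxE deriveN //; apply: diff_derivable; exact: cg1.1.
- rewrite (@cot_coord_dfun _ _ hY _ _ _ (fun w => - g2 w)) //; last exact: cNg2.1.
  by apply/rowP => j; rewrite !mxE deriveN //; apply: diff_derivable; exact: cg2.1.
Unshelve. all: by end_near. Qed.

End Prod2.

(** * Curves, distance and conorms *)

Section Integral.
Context {R : realType}.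
Notation mu := (@lebesgue_measure R).

(** The integral of a nonnegative function is a supremum over the simple functions below it, so
    monotonicity holds without measurability, and lengths can be compared through pointwise bounds
    on speeds. *)
Lemma le_integral_ge0 (D : set R) (f g : R -> \bar R) :
  (forall t, D t -> 0 <= f t)%E -> (forall t, D t -> f t <= g t)%E ->
  (\int[mu]_(t in D) f t <= \int[mu]_(t in D) g t)%E.
Proof.
move=> f0 fg; have g0 t : D t -> (0 <= g t)%E by move=> Dt; rewrite (le_trans (f0 t Dt)) ?fg.
rewrite !ge0_integralE //; apply: le_ereal_sup => _ [h hf <-]; exists h => // t.
apply: (le_trans (hf t)); rewrite /patch; case: ifPn => // /set_mem; exact: fg.
Qed.

End Integral.

(** * The metric tensor in coordinates *)

Section GramForm.
Context {R : realType} {X : ratlas R}.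
Hypothesis hX : riemannian X.

Definition qform (x : X) (z v : 'rV[R]_(dim X)) : R := (v *m gram x z *m v^T) 0 0.

Lemma qform_ge0 x z v : codm x z -> 0 <= qform x z v.
Proof.
move=> xz; have [->|v0] := eqVneq v 0; first by rewrite /qform mul0mx mul0mx mxE.
exact: ltW (riem_gram_pos hX xz v0).
Qed.

Lemma qformZ x z (c : R) v : qform x z (c *: v) = c ^+ 2 * qform x z v.
Proof.
by rewrite /qform -!scalemxAl linearZ /= -scalemxAr !mxE /= mulrA expr2.
Qed.

Lemma qform_continuous x z v : codm x z ->
  {for (z, v), continuous (fun p => qform x p.1 p.2)}.
Proof.
move=> xz.
have E : (fun p : 'rV[R]_(dim X) * 'rV[R]_(dim X) => qform x p.1 p.2) =
    fun p => \sum_j \sum_i (p.2 0 i * gram x p.1 i j) *: (p.2 0 j : R^o).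
  apply/funext => p; rewrite /qform mxE; apply: eq_bigr => j _.
  by rewrite mxE mulr_suml; apply: eq_bigr => i _; rewrite mxE.
rewrite E; apply: sum_continuous_at => j _; apply: sum_continuous_at => i _.
have c2 k : {for (z, v), continuous (fun p : 'rV[R]_(dim X) * 'rV[R]_(dim X) => p.2 0 k)}.
  by apply: mxcoord_continuous_at; exact: cvg_snd.
have cg : {for (z, v), continuous (fun p : 'rV[R]_(dim X) * 'rV[R]_(dim X) => gram x p.1 i j)}.
  apply: mxcoord_continuous_at.
  apply: (@continuous_comp _ _ _ fst (gram x)); first exact: cvg_fst.
  have cgx : {for z, continuous (gram x)} := riem_gram_smooth hX x 0 z xz.
  exact: cgx.
apply: scale_continuous_at; last exact: c2.
by apply: (@continuousM _ _ (fun p : 'rV[R]_(dim X) * 'rV[R]_(dim X) => p.2 0 i)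
  (fun p => gram x p.1 i j)); [exact: c2|exact: cg].
Qed.

(** By homogeneity it is enough to bound the form on the product of [K] with the unit sphere, where
    it attains a positive minimum and a maximum. *)
Lemma qform_bounds x K : compact K -> K `<=` codm x ->
  exists c C : R, [/\ 0 < c, 0 < C & forall z v, K z ->
    c * `|v| <= Num.sqrt (qform x z v) <= C * `|v|].
Proof.
move=> cK Kx.
pose S := [set v : 'rV[R]_(dim X) | `|v| = 1].
have cS : compact S.
  apply: bounded_closed_compact.
    by exists 1; split=> // M M1 y /= ->; exact: ltW.
  have -> : S = (fun y : 'rV[R]_(dim X) => `|y|) @^-1` [set 1] by [].
  by apply: closed_comp => [y _|]; [exact: norm_continuous|exact: closed_eq].
have cKS := compact_setX cK cS.
(* If this product is empty, then [K] is empty or 0 is the only row, and any constants do. *)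
have [[[z0 v0] [Kz0 Sv0]]|KS0] := pselect (K `*` S !=set0); last first.
  exists 1, 1; split=> // z v Kz; suff -> : v = 0.
    by rewrite /qform mul0mx mul0mx mxE sqrtr0 normr0 mulr0 lexx.
  apply/eqP/negP => /negP v0; apply: KS0; exists (z, `|v|^-1 *: v); split=> //=.
  by rewrite /S /= normrZ normfV normr_id mulVf // normr_eq0.
have KS0 : K `*` S !=set0 by exists (z0, v0).
have cq : {within K `*` S, continuous (fun p => qform x p.1 p.2)}.
  apply: continuous_in_subspaceT => -[z v] /set_mem [/= Kz _].
  by apply: qform_continuous; exact: Kx.
have [[z1 v1] /set_mem [/= Kz1 Sv1] min1] := compact_EVT_min KS0 cKS cq.
have [[z2 v2] /set_mem [/= Kz2 Sv2] max2] := compact_EVT_max KS0 cKS cq.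
have Sn0 v : S v -> v != 0.
  by move=> Sv; rewrite -normr_gt0 Sv ltr01.
have q1 : 0 < qform x z1 v1 := riem_gram_pos hX (Kx _ Kz1) (Sn0 _ Sv1).
have q2 : 0 < qform x z2 v2 := riem_gram_pos hX (Kx _ Kz2) (Sn0 _ Sv2).
exists (Num.sqrt (qform x z1 v1)), (Num.sqrt (qform x z2 v2)).
split; rewrite ?sqrtr_gt0 // => z v Kz.
have [->|vn0] := eqVneq v 0.
  by rewrite /qform !mul0mx !mxE sqrtr0 normr0 !mulr0 lexx.
have nv : 0 < `|v| by rewrite normr_gt0.
have vE : v = `|v| *: (`|v|^-1 *: v) by rewrite scalerA mulfV ?scale1r // gt_eqF.
have Su : S (`|v|^-1 *: v) by rewrite /S /= normrZ normfV normr_id mulVf // gt_eqF.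
rewrite {2 3}vE qformZ sqrtrM ?sqr_ge0 // sqrtr_sqr normr_id ![_ * `|v|]mulrC.
have H1 := min1 (z, _) (mem_set (conj Kz Su)).
have H2 := max2 (z, _) (mem_set (conj Kz Su)).
by rewrite !ler_pM2l // !ler_wsqrtr.
Qed.

Lemma compact_chart_ball (x : X) : exists2 r : R, 0 < r &
  [set z | `|z - chart x x| <= r] `<=` codm x.
Proof.
have /nbhs_ballP[r /= r0 rx] := near_codm hX (chart_self hX x).
exists (r / 2); first by rewrite divr_gt0.
move=> z /= zr; apply: rx; rewrite -ball_normE /= distrC.
by rewrite (le_lt_trans zr) // ltr_pdivrMr // mulr2n mulrDr mulr1 ltrDl.
Qed.

(** [speed] measures the velocity in the preferred chart of the moving point [g t]; the
    transformation law of the metric expresses it in one fixed chart. *)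
Lemma speedE (g : R -> X) x t :
  (\forall s \near t, dom x (g s)) ->
  differentiable (chart x \o g : R^o -> 'rV[R]_(dim X)) t ->
  speed g t = Num.sqrt (qform x (chart x (g t))
                          ('D_1 (chart x \o g : R^o -> 'rV[R]_(dim X)) t)).
Proof.
move=> ng dg; rewrite /speed /tnorm; congr Num.sqrt.
have xt : dom x (g t) := nbhs_singleton ng.
have tt : dom (g t) (g t) := riem_dom_self hX _.
have dt := trans_differentiable hX xt tt.
have -> : 'D_1 (chart (g t) \o g : R^o -> 'rV[R]_(dim X)) t =
    'D_1 (chart x \o g : R^o -> 'rV[R]_(dim X)) t *m
      jacobian (trans x (g t)) (chart x (g t)).
  have <- := deriveEjacobian ('D_1 (chart x \o g : R^o -> 'rV[R]_(dim X)) t) dt.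
  rewrite -(derive_comp (1 : R^o) dg dt); apply: near_eq_derive.
  by apply: filterS ng => s xs; rewrite /= transE.
rewrite /qform (riem_gram_trans hX xt tt).
by rewrite trmx_mul !mulmxA.
Qed.

End GramForm.

(** * Upper bounds for the distance *)

Section ShortCurves.
Context {R : realType}.
Implicit Types X Y : ratlas R.

(** Locally the distance is at most a multiple of the coordinate distance. The bound is on the speed
    at every time and not on the length, because speeds in a product combine pointwise, so that the
    property passes to products. *)
Definition short_curves X (x : X) : Prop :=
  exists r C : R, [/\ 0 < r, 0 < C & forall z1 z2 : 'rV[R]_(dim X),
    `|z1 - chart x x| <= r -> `|z2 - chart x x| <= r ->
    exists g : R -> X, [/\ C1_curve g, g 0 = chinv x z1, g 1 = chinv x z2 &
      forall t, 0 <= t <= 1 -> speed g t <= C * `|z1 - z2|]].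

Lemma rdist_le_speed X (g : R -> X) c : 0 <= c ->
  C1_curve g -> (forall t, 0 <= t <= 1 -> speed g t <= c) ->
  (rdist (g 0%R) (g 1%R) <= c%:E)%E.
Proof.
move=> c0 cg sc; apply: (@le_trans _ _ (curve_length g)).
  by apply: ereal_inf_lbound; exists g.
apply: (@le_trans _ _ (\int[lebesgue_measure]_(t in `[0%R, 1%R]) c%:E)%E).
  apply: le_integral_ge0 => t /=; rewrite in_itv /= => t01.
    by rewrite lee_fin sqrtr_ge0.
  by rewrite lee_fin sc.
by rewrite integral_cst //= lebesgue_measure_itv /= lte_fin ltr01 sube0 mule1.
Qed.

(** The joining curve is the straight segment of coordinates: it stays in the ball by convexity, and
    the metric is bounded there by compactness. *)
Lemma riemannian_short_curves X (x : X) : riemannian X -> short_curves x.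
Proof.
move=> hX; have [r r0 rx] := compact_chart_ball hX x.
have [c [C [c0 C0 cC]]] := qform_bounds hX (@closed_ball_rV_compact _ _ (chart x x) r) rx.
exists r, C; split=> // z1 z2 z1r z2r.
pose l (t : R^o) : 'rV[R]_(dim X) := z1 + t *: (z2 - z1).
have lr t : 0 <= t <= 1 -> `|l t - chart x x| <= r.
  move=> /andP[t0 t1].
  have -> : l t - chart x x = (1 - t) *: (z1 - chart x x) + t *: (z2 - chart x x).
    rewrite /l !scalerBr !scalerBl !scale1r; apply/rowP => j; rewrite !mxE; ring.
  rewrite (le_trans (ler_normD _ _)) // !normrZ (ger0_norm t0) ger0_norm ?subr_ge0 //.
  have : (1 - t) * `|z1 - chart x x| + t * `|z2 - chart x x| <= (1 - t) * r + t * r.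
    by rewrite lerD // ler_wpM2l // subr_ge0.
  by move/le_trans; apply; rewrite -mulrDl subrK mul1r.
have cl : Ck 1 setT l.
  apply: Ck1D; [exact: openT|exact: Ck1_cst|].
  apply: Ck1_mxP; first exact: openT.
  move=> i j; under eq_fun do rewrite mxE.
  by apply: Ck1M; [exact: openT|exact: Ck1_id|exact: Ck1_cst].
have dl t : differentiable l t by exact: cl.1.
have Dl t : 'D_1 l t = z2 - z1.
  rewrite /l deriveD; [|exact: derivable_cst|]; last first.
    by apply: diff_derivable; exact: differentiableZl.
  rewrite derive_cst add0r deriveE; last exact: differentiableZl.
  by rewrite diff_val scale1r.
have lx t : 0 <= t <= 1 -> codm x (l t) by move=> t01; apply: rx; exact: lr.
have near_l (t : R^o) : 0 <= t <= 1 -> \forall s \near t, codm x (l s).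
  move=> t01; have ct : {for t, continuous l} := differentiable_continuous (dl t).
  exact: (ct _ (near_codm hX (lx t t01))).
exists (chinv x \o l); split.
- move=> t t01.
  exists (l @^-1` (chart x @` (dom x `&` dom (chinv x (l t))))); split.
  + split.
      apply: open_comp => [s _|]; last exact: open_overlap.
      exact: differentiable_continuous.
    exists (chinv x (l t)); last by rewrite chinvK //; exact: lx.
    by split; [apply: dom_chinv => //; exact: lx|exact: riem_dom_self].
  + by move=> s [y [xy ty] yl]; rewrite /= -yl riem_chartK.
  + have -> : chart ((chinv x \o l) t) \o (chinv x \o l) =
        trans x (chinv x (l t)) \o l by [].
    apply: (@Ck1_comp _ _ _ _ _ (chart x @` (dom x `&` dom (chinv x (l t))))).
    * apply: open_comp => [s _|]; last exact: open_overlap.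
      exact: differentiable_continuous.
    * by [].
    * exact: Ck1_subset (@subsetT _ _) cl.
    * exact: (riem_trans_smooth hX _ _ 1).
- by rewrite /= /l scale0r addr0.
- by rewrite /= /l scale1r addrC subrK.
move=> t t01.
have nE : \forall s \near t, l s = (chart x \o (chinv x \o l)) s.
  by apply: filterS (near_l t t01) => s ls; rewrite /= chinvK.
have ng : \forall s \near (t : R^o), dom x ((chinv x \o l) s).
  by apply: filterS (near_l t t01) => s ls; exact: (dom_chinv hX ls).
have dg := near_eq_differentiable nE (dl t).
rewrite (speedE hX ng dg) /= chinvK //; last exact: lx.
have -> : 'D_1 (chart x \o (chinv x \o l) : R^o -> 'rV[R]_(dim X)) t = z2 - z1.
  by rewrite -(near_eq_derive _ nE).
by have /andP[_] := cC (l t) (z2 - z1) (lr t t01); rewrite distrC.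
Qed.

Lemma short_curves_rdist X (x : X) : short_curves x ->
  exists r C : R, [/\ 0 < r, 0 < C & forall z1 z2 : 'rV[R]_(dim X),
    `|z1 - chart x x| <= r -> `|z2 - chart x x| <= r ->
    (rdist (chinv x z1) (chinv x z2) <= (C * `|z1 - z2|)%:E)%E].
Proof.
move=> [r [C [r0 C0 H]]]; exists r, C; split=> // z1 z2 z1r z2r.
have [g [cg <- <- sg]] := H _ _ z1r z2r.
by apply: rdist_le_speed => //; rewrite mulr_ge0 // ltW.
Qed.

Lemma qform_prod2 X Y (x : prod2 X Y) (z v : 'rV[R]_(dim X + dim Y)) :
  (v *m gram x z *m v^T) 0 0 =
    qform x.1 (lsubmx z) (lsubmx v) + qform x.2 (rsubmx z) (rsubmx v).
Proof.
rewrite /qform -{1 2}(hsubmxK v) /= mul_row_block !mulmx0 addr0 add0r.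
by rewrite tr_row_mx mul_row_col mxE.
Qed.

Lemma qform_prodn n (U : 'I_n -> ratlas R) (x : prodn U) (z v : 'rV[R]_(\sum_i dim (U i))) :
  (v *m gram x z *m v^T) 0 0 =
    \sum_i qform (x i) (submxrow z i) (submxrow v i).
Proof.
rewrite /qform -{1 2}(submxrowK v) /= mul_mxrow_mxdiag tr_mxrow mul_mxrow_mxcol.
by rewrite summxE.
Qed.

Lemma C1_curve_differentiable X (g : R -> X) t : C1_curve g -> 0 <= t <= 1 ->
  differentiable (chart (g t) \o g : R^o -> 'rV[R]_(dim X)) t.
Proof. by move=> cg /cg [W [[oW Wt] _ [dg _]]]; exact: dg. Qed.

Lemma speed_prod2 X Y (g1 : R -> X) (g2 : R -> Y) t :
  riemannian X -> riemannian Y ->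
  C1_curve g1 -> C1_curve g2 -> 0 <= t <= 1 ->
  @speed R (prod2 X Y) (fun s => (g1 s, g2 s)) t
    = Num.sqrt (speed g1 t ^+ 2 + speed g2 t ^+ 2).
Proof.
move=> hX hY c1 c2 t01; rewrite {1}/speed /tnorm qform_prod2 /=.
have d1 := C1_curve_differentiable c1 t01.
have d2 := C1_curve_differentiable c2 t01.
have -> : 'D_1 (@chart R (prod2 X Y) (g1 t, g2 t) \o (fun s => (g1 s, g2 s))
    : R^o -> 'rV[R]_(dim X + dim Y)) t =
    row_mx ('D_1 (chart (g1 t) \o g1 : R^o -> _) t)
           ('D_1 (chart (g2 t) \o g2 : R^o -> _) t).
  exact: (derive_row_mx (1 : R^o) d1 d2).
rewrite !row_mxKl !row_mxKr.
by rewrite !sqr_sqrtr //; apply: qform_ge0 => //; exact: chart_self.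
Qed.

Lemma C1_curve_prod2 X Y (g1 : R -> X) (g2 : R -> Y) :
  C1_curve g1 -> C1_curve g2 -> @C1_curve R (prod2 X Y) (fun s => (g1 s, g2 s)).
Proof.
move=> c1 c2 t t01; have [W1 [[oW1 W1t] D1 k1]] := c1 t t01.
have [W2 [[oW2 W2t] D2 k2]] := c2 t t01.
exists (W1 `&` W2); split.
- by split=> //; exact: openI.
- by move=> s [s1 s2]; split; [exact: D1|exact: D2].
- apply: Ck1_row_mx; first exact: openI.
    exact: Ck1_subset (@subIsetl _ _ _) k1.
  exact: Ck1_subset (@subIsetr _ _ _) k2.
Qed.

Lemma speed_prodn n (U : 'I_n -> ratlas R) (g : R -> prodn U) t :
  (forall i, riemannian (U i)) ->
  (forall i, C1_curve (fun s => g s i)) -> 0 <= t <= 1 ->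
  speed g t = Num.sqrt (\sum_i speed (fun s => g s i) t ^+ 2).
Proof.
move=> hU c t01; rewrite {1}/speed /tnorm qform_prodn /=; congr Num.sqrt.
have d i := C1_curve_differentiable (c i) t01.
have -> : 'D_1 (chart (g t) \o g : R^o -> 'rV[R]_(\sum_i dim (U i))) t =
    \mxrow_i 'D_1 (chart (g t i) \o (fun s => g s i) : R^o -> _) t.
  exact: (derive_mxrow (1 : R^o) d).
apply: eq_bigr => i _; rewrite !mxrowK.
by rewrite sqr_sqrtr //; apply: qform_ge0 => //; exact: chart_self.
Qed.

Lemma C1_curve_prodn n (U : 'I_n -> ratlas R) (g : R -> prodn U) :
  (forall i, C1_curve (fun s => g s i)) -> C1_curve g.
Proof.
move=> c t t01.
have /choice [W HW] i : exists W : set R^o, [/\ open_nbhs t W,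
    (forall s, W s -> dom (g t i) (g s i)) &
    Ck 1 W (chart (g t i) \o (fun s => g s i) : R^o -> _)] by exact: c.
have oW : open [set s | forall i, W i s].
  rewrite openE => s Ws.
  have : \forall s' \near s, forall i, W i s'.
    apply: (@filter_forall _ _ W (nbhs s) _) => i.
    by have [[oWi _] _ _] := HW i; apply: open_nbhs_nbhs; split.
  exact.
exists [set s | forall i, W i s]; split.
- by split=> // i; have [[]] := HW i.
- by move=> s Ws i; have [_ D _] := HW i; exact: D.
- apply: Ck1_mxrow => // i; have [_ _ k] := HW i.
  by apply: Ck1_subset k => s; exact.
Qed.

Lemma C1_curve_proj n (U : 'I_n -> ratlas R) (g : R -> prodn U) i :
  C1_curve g -> C1_curve (fun s => g s i).
Proof.
move=> c t t01; have [W [[oW Wt] D k]] := c t t01.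
exists W; split=> //; first by move=> s /D; exact.
apply: Ck1_mxP => // a b.
have -> : (fun s => (chart (g t i) \o (fun s => g s i)) s a b : R^o) =
    (fun s => (chart (g t) \o g) s a (tagnat.Rank i b)).
  apply/funext => s.
  have := mxrowK (fun i => chart (g t i) (g s i)) i.
  move/(congr1 (fun M : 'rV[R]_(dim (U i)) => M a b)).
  by rewrite [X in X = _ -> _]mxE /= => <-.
exact: Ck1_mxcoord.
Qed.

(** A component of a curve is never faster than the curve. This turns closeness in the product
    distance into closeness of each single control. *)
Lemma rdist_proj n (U : 'I_n -> ratlas R) (x y : prodn U) i :
  (forall i, riemannian (U i)) -> (rdist (x i) (y i) <= rdist x y)%E.
Proof.
move=> hU; apply: le_ereal_inf_tmp => _ [g [cg <- <-] <-].
apply: (@le_trans _ _ (curve_length (fun s => g s i))).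
  by apply: ereal_inf_lbound; exists (fun s => g s i) => //; split=> //; exact: C1_curve_proj.
apply: le_integral_ge0 => t /=; rewrite in_itv /= => t01; rewrite lee_fin ?sqrtr_ge0 //.
rewrite speed_prodn //; last by move=> j; exact: C1_curve_proj.
apply: (@le_trans _ _ (Num.sqrt (speed (fun s => g s i) t ^+ 2))).
  by rewrite sqrtr_sqr ler_norm.
by rewrite ler_wsqrtr // (bigD1 i) //= lerDl sumr_ge0 // => j _; rewrite sqr_ge0.
Qed.

Lemma sqrt_sum_sqr_le n (a : 'I_n -> R) : (forall i, 0 <= a i) ->
  Num.sqrt (\sum_i a i ^+ 2) <= \sum_i a i.
Proof.
move=> a0; have s0 : 0 <= \sum_i a i by exact: sumr_ge0.
rewrite -[leRHS](ger0_norm s0) -sqrtr_sqr ler_wsqrtr // expr2 mulr_suml.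
apply: ler_sum => i _; rewrite expr2 ler_wpM2l //.
by rewrite (bigD1 i) //= lerDl sumr_ge0.
Qed.

Lemma short_curves_prod2 X Y (x : X) (y : Y) : riemannian X -> riemannian Y ->
  short_curves x -> short_curves y -> @short_curves (prod2 X Y) (x, y).
Proof.
move=> hX hY [r1 [C1 [r10 C10 H1]]] [r2 [C2 [r20 C20 H2]]].
exists (Num.min r1 r2), (C1 + C2); split.
- by rewrite lt_min r10.
- by rewrite addr_gt0.
have nl (z : 'rV[R]_(dim X + dim Y)) : `|lsubmx z| <= `|z|.
  by apply: norm_le_coord => // i j; rewrite mxE coord_le_norm.
have nr (z : 'rV[R]_(dim X + dim Y)) : `|rsubmx z| <= `|z|.
  by apply: norm_le_coord => // i j; rewrite mxE coord_le_norm.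
have L (z : 'rV[R]_(dim X + dim Y)) : `|z - row_mx (chart x x) (chart y y)| <= Num.min r1 r2 ->
    `|lsubmx z - chart x x| <= r1 /\ `|rsubmx z - chart y y| <= r2.
  rewrite le_min => /andP[z1 z2]; split.
    by apply: le_trans z1; apply: le_trans (nl _); rewrite linearB /= row_mxKl.
  by apply: le_trans z2; apply: le_trans (nr _); rewrite linearB /= row_mxKr.
move=> z1 z2 /L [z1l z1r] /L [z2l z2r].
have [g1 [cg1 a1 b1 s1]] := H1 _ _ z1l z2l.
have [g2 [cg2 a2 b2 s2]] := H2 _ _ z1r z2r.
exists (fun s => (g1 s, g2 s)); split.
- exact: C1_curve_prod2.
- by rewrite a1 a2.
- by rewrite b1 b2.
move=> t t01; rewrite speed_prod2 //.
apply: (@le_trans _ _ (speed g1 t + speed g2 t)).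
  rewrite -[leRHS]ger0_norm ?addr_ge0 ?sqrtr_ge0 // -sqrtr_sqr ler_wsqrtr //.
  by rewrite sqrrD -addrA lerD2l lerDr mulrn_wge0 // mulr_ge0 // sqrtr_ge0.
rewrite mulrDl lerD //.
  apply: le_trans (s1 t t01) _; rewrite ler_wpM2l ?(ltW C10) //.
  by have := nl (z1 - z2); rewrite linearB.
apply: le_trans (s2 t t01) _; rewrite ler_wpM2l ?(ltW C20) //.
by have := nr (z1 - z2); rewrite linearB.
Qed.

Lemma submxrow_norm n (d : 'I_n -> nat) (z : 'rV[R]_(\sum_i d i)) i :
  `|submxrow z i| <= `|z|.
Proof. by apply: norm_le_coord => // a b; rewrite mxE coord_le_norm. Qed.

Lemma short_curves_prodn n (U : 'I_n -> ratlas R) (x : prodn U) :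
  (forall i, riemannian (U i)) ->
  (forall i, short_curves (x i)) -> short_curves x.
Proof.
move=> hU /choice [r /choice [C H]].
have r0 : 0 < \big[Num.min/1]_i r i.
  by apply/bigmin_gtP; split=> // i _; have [] := H i.
have C0 : 0 <= \sum_i C i by apply: sumr_ge0 => i _; have [_ /ltW] := H i.
exists (\big[Num.min/1]_i r i), (\sum_i C i + 1); split=> //.
  by rewrite ltr_wpDl.
have L (z : 'rV[R]_(\sum_i dim (U i))) i : `|z - \mxrow_i chart (x i) (x i)| <= \big[Num.min/1]_i r i ->
    `|submxrow z i - chart (x i) (x i)| <= r i.
  move=> zr; apply: (@le_trans _ _ (\big[Num.min/1]_i r i)); last exact: bigmin_le_cond.
  apply: le_trans zr; apply: le_trans (submxrow_norm _ i).
  by rewrite submxrowB mxrowK.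
move=> z1 z2 z1r z2r.
have Hex i : exists g : R -> U i, [/\ C1_curve g,
    g 0 = chinv (x i) (submxrow z1 i), g 1 = chinv (x i) (submxrow z2 i) &
    forall t, 0 <= t <= 1 -> speed g t <= C i * `|z1 - z2|].
  have [_ Ci0 /(_ _ _ (L _ i z1r) (L _ i z2r)) [g [cg a b s]]] := H i.
  exists g; split=> // t t01; apply: le_trans (s t t01) _.
  by rewrite ler_wpM2l ?(ltW Ci0) // -submxrowB submxrow_norm.
pose g i := sval (cid (Hex i)); have Hg i := svalP (cid (Hex i)).
exists (fun s i => g i s); split.
- by apply: C1_curve_prodn => i; have [] := Hg i.
- by apply: functional_extensionality_dep => i /=; have [] := Hg i.
- by apply: functional_extensionality_dep => i /=; have [] := Hg i.
move=> t t01; rewrite speed_prodn //; last by move=> i; have [] := Hg i.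
apply: (le_trans (sqrt_sum_sqr_le _)); first by move=> i; exact: sqrtr_ge0.
apply: (@le_trans _ _ (\sum_i C i * `|z1 - z2|)).
  by apply: ler_sum => i _; have [_ _ _] := Hg i; exact.
by rewrite -mulr_suml ler_wpM2r // lerDl.
Qed.

End ShortCurves.

(** * Conorms near a point *)

Section CotangentBound.
Context {R : realType}.
Implicit Types X Y : ratlas R.

(** A bound on conorms near [x] by coordinates in the one chart at [x], stated before the supremum
    over [v] is taken; in this form the product case splits into the two factors. *)
Definition cotangent_bound X (x : X) : Prop :=
  exists2 C : R, 0 <= C & \forall y \near x, forall p v : 'rV[R]_(dim X),
    tnorm y v <= 1 -> `|pairing p v| <= C * `|cot_coord x y p|.

Lemma riemannian_cotangent_bound X (x : X) : riemannian X -> cotangent_bound x.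
Proof.
move=> hX; have [r r0 rx] := compact_chart_ball hX x.
have [c [C [c0 C0 cC]]] :=
  qform_bounds hX (@closed_ball_rV_compact _ _ (chart x x) r) rx.
exists ((dim X)%:R / c); first by rewrite divr_ge0 // ltW.
have xx := riem_dom_self hX x.
have nr : \forall y \near x, `|chart x y - chart x x| <= r.
  apply: (near_chart hX (P := fun w => `|w - chart x x| <= r) xx).
  apply/nbhs_ballP; exists r => // z; rewrite -ball_normE /= distrC.
  exact: ltW.
near=> y => p v v1.
have xy : dom x y by near: y; exact: near_dom.
have yy := riem_dom_self hX y.
rewrite -(pairing_cot_tan hX p v xy); set w := tan_coord x y v.
apply: (le_trans (pairing_le_norm _ _)).
rewrite -mulrA ler_wpM2l // [X in X <= _]mulrC ler_wpM2r //.
rewrite -[leRHS]mulr1 ler_pdivlMl //.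
have ry : `|chart x y - chart x x| <= r by near: y.
have /andP[H _] := cC _ w ry.
apply: (le_trans H); apply: le_trans v1; rewrite /tnorm (riem_gram_trans hX yy xy).
by rewrite /qform /w /tan_coord trmx_mul !mulmxA.
Unshelve. all: by end_near. Qed.

Lemma conorm_le X (x : X) : cotangent_bound x ->
  exists2 C : R, 0 <= C & \forall y \near x, forall p : 'rV[R]_(dim X),
    conorm y p <= C * `|cot_coord x y p|.
Proof.
move=> [C C0 HC]; exists C => //; apply: filterS HC => y HC p.
apply: ge_sup.
  (* The supremum is over a nonempty set, since [v = 0] is always allowed. *)
  exists `|pairing p 0|; exists 0 => //.
  by rewrite /= /tnorm mul0mx mul0mx mxE sqrtr0.
by move=> _ [v v1 <-]; exact: HC.
Qed.

Lemma cotangent_bound_prod2 X Y (x : X) (y : Y) : riemannian X -> riemannian Y ->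
  cotangent_bound x -> cotangent_bound y -> @cotangent_bound (prod2 X Y) (x, y).
Proof.
move=> hX hY [C1 C10 H1] [C2 C20 H2]; exists (C1 + C2); first exact: addr_ge0.
have N1 : \forall p \near (x, y), dom x p.1 /\ forall q v : 'rV[R]_(dim X),
    tnorm p.1 v <= 1 -> `|pairing q v| <= C1 * `|cot_coord x p.1 q|.
  have := @filterI _ _ (nbhs_filter x) _ _ (near_dom hX (riem_dom_self hX x)) H1.
  exact: (cvg_fst (F := nbhs x) (G := nbhs y)).
have N2 : \forall p \near (x, y), dom y p.2 /\ forall q v : 'rV[R]_(dim Y),
    tnorm p.2 v <= 1 -> `|pairing q v| <= C2 * `|cot_coord y p.2 q|.
  have := @filterI _ _ (nbhs_filter y) _ _ (near_dom hY (riem_dom_self hY y)) H2.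
  exact: (cvg_snd (F := nbhs x) (G := nbhs y)).
apply: filterS2 N1 N2 => -[x' y'] [/= d1 B1] [/= d2 B2] p v.
rewrite /tnorm qform_prod2 /= row_mxKl row_mxKr => v1.
have q1 := qform_ge0 hX (lsubmx v) (chart_self hX x').
have q2 := qform_ge0 hY (rsubmx v) (chart_self hY y').
have v1l : tnorm x' (lsubmx v) <= 1.
  by apply: le_trans v1; rewrite ler_wsqrtr // lerDl.
have v1r : tnorm y' (rsubmx v) <= 1.
  by apply: le_trans v1; rewrite ler_wsqrtr // lerDr.
rewrite -(hsubmxK p) -{1}(hsubmxK v) pairing_row_mx (le_trans (ler_normD _ _)) //.
rewrite cot_coord_prod2 // mulrDl lerD //.
  apply: le_trans (B1 _ _ v1l) _; rewrite ler_wpM2l //.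
  by apply: norm_le_coord => // i j; rewrite -(row_mxEl _ (cot_coord y y' (rsubmx p))) coord_le_norm.
apply: le_trans (B2 _ _ v1r) _; rewrite ler_wpM2l //.
by apply: norm_le_coord => // i j; rewrite -(row_mxEr (cot_coord x x' (lsubmx p))) coord_le_norm.
Qed.

End CotangentBound.

(** * Lower bounds for the distance *)

Section DistanceTopology.
Context {R : realType}.
Implicit Types X Y : ratlas R.

(** Along a curve such a function changes at most at a rate proportional to the speed: over the
    support the metric dominates the coordinate velocity, and elsewhere the function is locally
    zero. *)
Lemma compact_support_slope X (x : X) (h : 'rV[R]_(dim X) -> R^o) K
    (H := fun y : X => if `[< dom x y >] then h (chart x y) else 0) :
  riemannian X -> Ck 1 setT h -> compact K -> K `<=` codm x ->
  (forall z, ~ K z -> h z = 0) ->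
  exists2 A : R, 0 < A & forall (g : R -> X) (t : R^o), C1_curve g -> 0 <= t <= 1 ->
    [/\ differentiable (H \o g : R^o -> R^o) t,
        {for t, continuous ('D_1 (H \o g : R^o -> R^o) : R^o -> R^o)} &
        `|'D_1 (H \o g : R^o -> R^o) t| <= A * speed g t].
Proof.
move=> hX ch cK Kx h0.
have CH : C1_fun H by exact: C1_fun_extend ch cK Kx h0.
have [c [C [c0 C0 cC]]] := qform_bounds hX cK Kx.
pose D z := \sum_j `|'D_(delta_mx 0 j) h z|.
have [M M0 HM] : exists2 M : R, 0 <= M & forall z, K z -> D z <= M.
  have [K0|K0] := pselect (K !=set0); last first.
    by exists 0 => // z Kz; case: K0; exists z.
  have cD : {within K, continuous D}.
    apply: continuous_in_subspaceT => z _; apply: sum_continuous_at => j _.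
    apply: (@continuous_comp _ _ _ ('D_(delta_mx 0 j) h) Num.norm).
      exact: ch.2.
    exact: norm_continuous.
  have [z0 /set_mem Kz0 m0] := compact_EVT_max K0 cK cD.
  exists (D z0); first by apply: sumr_ge0.
  by move=> z Kz; apply: m0; exact: mem_set.
(* [M] bounds the sum of the absolute partial derivatives on [K], [c] is the lower constant of the
   metric there, and the 1 keeps the quotient positive. *)
exists ((M + 1) / c); first by rewrite divr_gt0 // ltr_wpDl.
move=> g t cg t01; have [W [[oW Wt] gW kW]] := cg t t01.
have kH : Ck 1 W (H \o g : R^o -> R^o).
  apply: Ck1_local => s Ws; exists W, ((H \o chinv (g t)) \o (chart (g t) \o g)).
  split; first by split.
  - apply: (@Ck1_comp _ _ _ _ _ (codm (g t)) (chart (g t) \o g) (H \o chinv (g t))).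
    + exact: oW.
    + by move=> u /gW; exact: chart_codm.
    + exact: kW.
    + exact: CH.
  - by move=> u /gW Wu; rewrite /= riem_chartK.
split; [exact: kH.1|exact: kH.2|].
have dg : differentiable (chart (g t) \o g : R^o -> 'rV[R]_(dim X)) t by exact: kW.1.
have tt := riem_dom_self hX (g t).
have nW : \forall s \near (t : R^o), W s by apply: open_nbhs_nbhs.
have cgt (P : set X) : (\forall y \near g t, P y) -> \forall s \near (t : R^o), P (g s).
  move=> nP; have nP' : \forall w \near chart (g t) (g t), P (chinv (g t) w).
    by apply: near_chinv; [exact: hX|exact: chart_self|rewrite chinv_self].
  have := (differentiable_continuous dg) _ nP'.
  by apply: filterS2 nW => s /gW ds; rewrite /= riem_chartK.
have [[z Kz zE]|NK] := pselect ((chinv x @` K) (g t)); last first.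
  have cC' : closed (chinv x @` K).
    apply: compact_closed; first exact: riem_hausdorff.
    apply: continuous_compact => //.
    apply: continuous_in_subspaceT => w /set_mem /Kx; exact: riem_chinv_continuous.
  have nH : \forall s \near (t : R^o), (H \o g : R^o -> R^o) s = cst 0 s.
    have : \forall y \near g t, ~ (chinv x @` K) y.
      by apply: open_nbhs_nbhs; split=> //; rewrite openC.
    move/cgt; apply: filterS => s Ns; rewrite /H /=; case: ifPn => // /asboolP xs.
    by apply: h0 => Ks; apply: Ns; exists (chart x (g s)) => //; rewrite riem_chartK.
  rewrite (near_eq_derive _ nH) derive_cst normr0 mulr_ge0 ?sqrtr_ge0 //.
  by rewrite divr_ge0 ?ltW // ltr_wpDl.
have xz := Kx _ Kz.
have xt : dom x (g t) by rewrite -zE; exact: dom_chinv.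
have zE' : chart x (g t) = z by rewrite -zE chinvK.
have nx := cgt _ (near_dom hX xt).
have dx : differentiable (chart x \o g : R^o -> 'rV[R]_(dim X)) t.
  have dt := trans_differentiable hX tt xt.
  apply: (@near_eq_differentiable _ _ _ (trans (g t) x \o (chart (g t) \o g))).
    by apply: filterS nW => s /gW ds; rewrite /= transE.
  exact: differentiable_comp.
rewrite (speedE hX nx dx) zE'.
set w := 'D_1 (chart x \o g : R^o -> 'rV[R]_(dim X)) t.
have dh : differentiable h (chart x (g t)) by exact: ch.1.
have -> : 'D_1 (H \o g : R^o -> R^o) t = 'D_w h z.
  rewrite -zE' -(derive_comp (1 : R^o) dx dh); apply: near_eq_derive.
  by apply: filterS nx => s xs; rewrite /H /= asboolT.
have /andP[cw _] := cC z w Kz.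
rewrite derive_rowE; last exact: ch.1.
apply: (@le_trans _ _ (`|w| * M)).
  rewrite (le_trans (ler_norm_sum _ _ _)) //.
  apply: (@le_trans _ _ (\sum_j `|w| * `|'D_(delta_mx 0 j) h z|)).
    by apply: ler_sum => j _; rewrite normrZ ler_wpM2r // coord_le_norm.
  by rewrite -mulr_sumr ler_wpM2l //; exact: HM.
rewrite mulrC -mulrA ler_pM // ?lerDl //.
by rewrite ler_pdivlMl.
Qed.

(** The fundamental theorem is applied to [f] scaled by [A^-1], whose derivative is continuous; [s]
    enters through a pointwise comparison only. *)
Lemma le_integral_slope (A : R) (f : R^o -> R^o) (s : R -> R) : 0 < A ->
  (forall t : R^o, 0 <= t <= 1 -> [/\ differentiable f t,
     {for t, continuous ('D_1 f : R^o -> R^o)} & `|'D_1 f t| <= A * s t]) ->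
  ((A^-1 * (f 1 - f 0))%:E <= \int[lebesgue_measure]_(t in `[0%R, 1%R]) (s t)%:E)%E.
Proof.
move=> A0 Hf.
pose F (t : R) : R := A^-1 * f t; pose F' (t : R) : R := A^-1 * 'D_1 f t.
have cD : {within `[0, 1], continuous F'}.
  apply: continuous_in_subspaceT => t /set_mem /=; rewrite in_itv /= => t01.
  have [_ c _] := Hf t t01.
  by apply: (@continuousM _ _ (cst A^-1) ('D_1 f : R -> R)) c; exact: cst_continuous.
have cf (t : R) : 0 <= t <= 1 -> {for t, continuous F}.
  move=> t01; have [d _ _] := Hf t t01.
  apply: (@continuousM _ _ (cst A^-1) (f : R -> R)); first exact: cst_continuous.
  exact: differentiable_continuous d.
have d0 : derivable_oo_LRcontinuous F 0 1.
  split.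
  - move=> t; rewrite in_itv /= => /andP[t0 t1].
    have [|d _ _] := Hf t; first by rewrite !ltW.
    have dd : derivable f t (1 : R^o) by exact: diff_derivable.
    exact: (@derivableZ _ R^o R^o f A^-1 t 1 dd).
  - by apply: cvg_at_right_filter; apply: cf; rewrite lexx ler01.
  - by apply: cvg_at_left_filter; apply: cf; rewrite lexx ler01.
have -> : A^-1 * (f 1 - f 0) = F 1 - F 0 by rewrite mulrBr.
rewrite EFinB -(continuous_FTC2 ltr01 cD d0); last first.
  move=> t; rewrite in_itv /= => /andP[t0 t1].
  have [|d _ _] := Hf t; first by rewrite !ltW.
  have dd : derivable f t (1 : R^o) by exact: diff_derivable.
  by rewrite derive1E; exact: (@deriveZ _ R^o R^o f A^-1 t 1 dd).
apply: (le_trans (lee_abs _)).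
apply: le_trans.
  apply: le_abse_integral => //; apply/measurable_EFinP.
  exact: subspace_continuous_measurable_fun.
apply: le_integral_ge0 => t /=; first by [].
rewrite in_itv /= => t01; rewrite lee_fin.
have [_ _] := Hf t t01.
by rewrite /F' normrM gtr0_norm ?invr_gt0 // ler_pdivrMl.
Qed.

(** Riemannian balls shrink into every neighbourhood. Take a bump that is 1 at [x] and 0 outside
    [P]: it rises by 1 along any curve from outside [P] to [x], so the length of the curve is at
    least [A^-1]. *)
Lemma rdist_nbhs X (x : X) (P : set X) : riemannian X -> (\forall y \near x, P y) ->
  exists2 d : R, 0 < d & forall y, (rdist y x < d%:E)%E -> P y.
Proof.
move=> hX nP.
have nP' : \forall w \near chart x x, P (chinv x w).
  by apply: near_chinv; [exact: hX|exact: chart_self|rewrite chinv_self].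
have nc := near_codm hX (chart_self hX x).
have [W [oW Wz] WP] : exists2 W : set 'rV[R]_(dim X), open_nbhs (chart x x) W &
    W `<=` [set w | codm x w /\ P (chinv x w)].
  have := @filterI _ _ (nbhs_filter _) _ _ nc nP'; by rewrite nbhsE => -[W oW WP]; exists W.
have [h [K [ch cK KW hg h0]]] := local_cutoff oW Wz (Ck1_cst W (1 : R^o)).
have Kx : K `<=` codm x by move=> z /KW /WP [].
have [A A0 HA] := compact_support_slope hX ch cK Kx h0.
set H := (fun y : X => if `[< dom x y >] then h (chart x y) else 0) in HA.
have Hx : H x = 1.
  by rewrite /H asboolT; [exact: (nbhs_singleton hg)|exact: riem_dom_self].
exists A^-1; first by rewrite invr_gt0.
move=> y; apply: contraPP => NPy; apply/negP; rewrite -leNgt.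
have Hy : H y = 0.
  rewrite /H; case: ifPn => // /asboolP xy; apply: h0 => /KW /WP [_].
  by rewrite riem_chartK.
apply: le_ereal_inf_tmp => _ [g [cg g0 g1] <-].
have := @le_integral_slope A (H \o g) (speed g) A0.
rewrite /= g0 g1 Hx Hy subr0 mulr1; apply=> t t01.
exact: HA.
Qed.

End DistanceTopology.

(** * The penalized problem in coordinates *)

Section Penalty.
Context {R : realType}.

(** Continuity of the data is available at points of [K] only, so closedness of [D] is asked
    relative to [K]. *)
Lemma compact_relclosed (T : topologicalType) (K D : set T) : compact K ->
  (forall t, K t -> ~ D t -> \forall s \near t, ~ D s) -> compact (K `&` D).
Proof.
move=> cK HD F FF FKD.
have FK : F K by apply: filterS FKD => t [].
have [t [Kt Ft]] := cK F FF FK.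
exists t; split=> //; split=> //; apply: contrapT => NDt.
by have [s [[_ Ds] NDs]] := Ft _ _ FKD (HD t Kt NDt).
Qed.

Lemma near_neq (T : topologicalType) (f : T -> R) t c : {for t, continuous f} ->
  f t <> c -> \forall s \near t, f s <> c.
Proof.
move=> cf ftc; have : open_nbhs (f t) [set u | u != c].
  by split; [exact: open_neq|apply/eqP].
move/open_nbhs_nbhs => H; have {}H : \forall s \near t, f s != c := cf _ H.
by apply: filterS H => s /eqP.
Qed.

(* For a large penalty weight N the minimizer of f + N g + h over K cannot lie in
   the zero set of f, since g has a positive minimum on the part of it where
   h <= f t0. *)
Lemma penalized_minimum (T : topologicalType) (K : set T) (f g h : T -> R) t0 :
  compact K -> (forall t, K t -> {for t, continuous f}) ->
  (forall t, K t -> {for t, continuous g}) ->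
  (forall t, K t -> {for t, continuous h}) ->
  (forall t, 0 <= f t) -> (forall t, 0 <= g t) -> (forall t, 0 <= h t) ->
  K t0 -> g t0 = 0 -> h t0 = 0 ->
  (forall t, K t -> h t <= f t0 -> g t = 0 -> f t <> 0) ->
  exists N : R, exists2 t, K t & [/\ 1 <= N, 0 < f t, h t + N * g t <= f t0 &
    forall s, K s -> f t + N * g t + h t <= f s + N * g s + h s].
Proof.
move=> cK cf cg ch f0 g0 h0 Kt0 gt0 ht0 Hfg.
pose D := [set t | f t = 0 /\ h t <= f t0].
have cKD : compact (K `&` D).
  apply: compact_relclosed => // t Kt /not_andP[ft|/negP ht].
    have := near_neq (cf t Kt) ft.
    by apply: filterS => s fs [].
  rewrite -ltNge in ht.
  have : open_nbhs (h t) [set u | f t0 < u] by split=> //; exact: open_gt.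
  move/open_nbhs_nbhs => H.
  have {}H : \forall s \near t, f t0 < h s := ch t Kt _ H.
  by apply: filterS H => s hs [_]; rewrite leNgt hs.
have [m m0 Hm] : exists2 m : R, 0 < m & forall t, (K `&` D) t -> m <= g t.
  have [KD0|KD0] := pselect (K `&` D !=set0); last first.
    by exists 1 => // t KDt; case: KD0; exists t.
  have [|t /set_mem[Kt [ft ht]] mt] := compact_EVT_min (f := g) KD0 cKD.
    by apply: continuous_in_subspaceT => t /set_mem[/cg].
  exists (g t); last by move=> s KDs; apply: mt; exact: mem_set.
  rewrite lt_neqAle g0 andbT eq_sym; apply/eqP => gt.
  exact: Hfg Kt ht gt ft.
(* Then [N * m = m + f t0], so a minimizer in the zero set of [f] would have a value above [f t0],
   which is the value at [t0]. *)
pose N := 1 + f t0 / m.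
have N1 : 1 <= N by rewrite lerDl divr_ge0 // ltW.
have N0 : 0 < N by rewrite (lt_le_trans ltr01).
have cJ t : K t -> {for t, continuous (fun t => f t + N * g t + h t)}.
  move=> Kt; have c1 : {for t, continuous (fun t => N * g t)}.
    by apply: (@continuousM _ _ (cst N) g) (cg t Kt); exact: cst_continuous.
  exact: (@continuousD _ _ _ (fun t => f t + N * g t) h t
    (@continuousD _ _ _ f _ t (cf t Kt) c1) (ch t Kt)).
have K0 : K !=set0 by exists t0.
have [|t /set_mem Kt mt] := compact_EVT_min (f := fun t => f t + N * g t + h t) K0 cK.
  by apply: continuous_in_subspaceT => t /set_mem Kt; exact: cJ.
have H1 := mt _ (mem_set Kt0).
rewrite /= gt0 ht0 mulr0 !addr0 in H1.
exists N, t => //; split=> //; last by move=> s Ks; apply: mt; exact: mem_set.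
  rewrite lt_neqAle f0 andbT eq_sym; apply/eqP => ft.
  have ht : h t <= f t0.
    by apply: le_trans H1; rewrite lerDr addr_ge0 ?f0 // mulr_ge0 // ltW.
  have mg := Hm t (conj Kt (conj ft ht)).
  have : N * m <= f t0.
    apply: le_trans H1; rewrite ft add0r -[leLHS]addr0 lerD //.
    by rewrite ler_wpM2l // ltW.
  by rewrite /N mulrDl mul1r mulfVK ?gt_eqF // leNgt ltrDr m0.
by apply: le_trans H1; rewrite -addrA [h t + _]addrC lerDr.
Qed.

Lemma sum_update1 n (F F' : 'I_n -> R) i0 : (forall i, i != i0 -> F i = F' i) ->
  \sum_i F i = \sum_i F' i + (F i0 - F' i0).
Proof.
move=> E; rewrite (bigD1 i0) //= [\sum_i F' i](bigD1 i0) //= (eq_bigr F') //; ring.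
Qed.

(** For a moved state: the transition into it and the transition out of it both change. *)
Lemma sum_update2 n (F F' : 'I_n -> R) i0 i1 : i0 != i1 ->
  (forall i, i != i0 -> i != i1 -> F i = F' i) ->
  \sum_i F i = \sum_i F' i + (F i0 - F' i0) + (F i1 - F' i1).
Proof.
move=> i01 E; rewrite (bigD1 i0) //= [\sum_i F' i](bigD1 i0) //=.
rewrite (bigD1 i1) 1?eq_sym //= [\sum_(i | i != i0) F' i](bigD1 i1) 1?eq_sym //=.
rewrite (eq_bigr F'); first by ring.
by move=> i /andP[ia ib]; exact: E.
Qed.

End Penalty.

(** * The discrete problem and its minimizer *)

Section DiscreteProblem.
Context {R : realType} {m p : nat} {d : 'I_m.+1 -> nat}.
Variables (G : forall i, 'rV[R]_p -> 'rV[R]_(d i) -> 'rV[R]_p).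
Variables (f0 : 'rV[R]_(d ord0) -> R)
  (f : forall j : 'I_m, 'rV[R]_p -> 'rV[R]_(d (lift ord0 j)) -> R)
  (fn : 'rV[R]_p -> R).
Variables (KY : nat -> set 'rV[R]_p) (KX KS : forall i, set 'rV[R]_(d i)).
Variable u : forall i, 'rV[R]_(d i).
Arguments G : clear implicits.
Arguments f : clear implicits.
Arguments KX : clear implicits.
Arguments KS : clear implicits.
Arguments u : clear implicits.

Notation states := (nat -> 'rV[R]_p).
Notation controls := (forall i, 'rV[R]_(d i)).

Definition cost (y : states) (x : controls) : R :=
  f0 (x ord0) + fn (y m.+1) + \sum_(j < m) f j (y j.+1) (x (lift ord0 j)).

(* The control is duplicated: x enters the constraint functions, s the dynamics
   and the control constraint, so that all nonsmooth terms decouple. *)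
Definition defect (y : states) (x s : controls) : R :=
  \sum_(i < m.+1) sq (x i - s i) + \sum_(i < m.+1) sq (y i.+1 - G i (y i) (s i)).

Definition deviation (s : controls) : R := \sum_i sq (s i - u i).

Definition feasible (y : states) (x s : controls) : Prop :=
  [/\ forall k, KY k (y k), forall i, KX i (x i) & forall i, KS i (s i)].

Definition penalized (N l : R) (y : states) (x s : controls) : R :=
  cost y x + N * defect y x s + l * deviation s.

Lemma defect_ge0 y x s : 0 <= defect y x s.
Proof. by rewrite addr_ge0 // sumr_ge0 // => i _; exact: sq_ge0. Qed.

Lemma deviation_ge0 s : 0 <= deviation s.
Proof. by rewrite sumr_ge0 // => i _; exact: sq_ge0. Qed.

Lemma defect_eq0 y x s : defect y x s = 0 ->
  x = s /\ forall i : 'I_m.+1, y i.+1 = G i (y i) (s i).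
Proof.
move=> /eqP; rewrite paddr_eq0; [|by apply: sumr_ge0 => i _; exact: sq_ge0
                                 |by apply: sumr_ge0 => i _; exact: sq_ge0].
rewrite !psumr_eq0; [|by move=> i _; exact: sq_ge0|by move=> i _; exact: sq_ge0].
move=> /andP[/allP H1 /allP H2]; split.
  apply: functional_extensionality_dep => i.
  have /eqP /sq_eq0 /eqP := H1 i (mem_index_enum i).
  by rewrite subr_eq0 => /eqP.
move=> i; have /eqP /sq_eq0 /eqP := H2 i (mem_index_enum i).
by rewrite subr_eq0 => /eqP.
Qed.

Section Existence.
Hypotheses (cY : forall k, compact (KY k)) (cX : forall i, compact (KX i))
  (cS : forall i, compact (KS i)) (SX : forall i, KS i `<=` KX i).
Hypotheses
  (c0 : forall w, KX ord0 w -> {for w, continuous f0})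
  (cf : forall (j : 'I_m) z w, KY j.+1 z -> KX (lift ord0 j) w ->
     {for (z, w), continuous (fun q => f j q.1 q.2)})
  (cn : forall z, KY m.+1 z -> {for z, continuous fn})
  (cG : forall (i : 'I_m.+1) z w, KY i z -> KX i w ->
     {for (z, w), continuous (fun q => G i q.1 q.2)}).
Hypotheses (f0_ge0 : forall w, 0 <= f0 w) (f_ge0 : forall j z w, 0 <= f j z w)
  (fn_ge0 : forall z, 0 <= fn z).

Lemma cost_ge0 y x : 0 <= cost y x.
Proof. by rewrite !addr_ge0 // sumr_ge0. Qed.

(** [penalized_minimum] for [cost], [defect] and [l * deviation], with the exact trajectory of [u]
    as base point. Zero defect means an exact trajectory with [x = s], so the last hypothesis says
    that no such trajectory near [u] has zero cost. *)
Lemma penalized_minimizer l (yu : states) : 0 < l ->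
  (forall k, KY k (yu k)) -> (forall i, KS i (u i)) ->
  (forall i : 'I_m.+1, yu i.+1 = G i (yu i) (u i)) ->
  (forall y s, feasible y s s -> l * deviation s <= cost yu u ->
     (forall i : 'I_m.+1, y i.+1 = G i (y i) (s i)) -> cost y s <> 0) ->
  exists (N : R) (y : states) (x s : controls),
    [/\ 1 <= N, feasible y x s, 0 < cost y x,
        l * deviation s + N * defect y x s <= cost yu u &
        forall y' x' s', feasible y' x' s' ->
          penalized N l y x s <= penalized N l y' x' s'].
Proof.
move=> l0 Kyu Ku yuG Hno.
pose TY := prod_topology (fun _ : nat => 'rV[R]_p).
pose TX := prod_topology (fun i : 'I_m.+1 => 'rV[R]_(d i)).
pose T := ((TY * TX) * TX)%type.
pose K : set T := [set t | feasible t.1.1 t.1.2 t.2].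
have cK : compact K.
  have -> : K = [set y : TY | forall k, KY k (y k)] `*`
      [set x : TX | forall i, KX i (x i)] `*` [set s : TX | forall i, KS i (s i)].
    by apply/seteqP; split=> -[[y x] s] /= [] // [].
  (* The states are indexed by all of [nat], so this includes an infinite product of compact
     sets. *)
  by apply: compact_setX; [apply: compact_setX|]; apply: tychonoff.
have py k (t : T) : {for t, continuous (fun t : T => t.1.1 k)}.
  apply: (@continuous_comp _ _ _ (fun t : T => t.1.1) (fun y : TY => y k)).
    apply: (@continuous_comp _ _ _ (fun t : T => t.1) fst); exact: cvg_fst.
  exact: (@proj_continuous _ (fun _ : nat => 'rV[R]_p) k).
have px i (t : T) : {for t, continuous (fun t : T => t.1.2 i)}.
  apply: (@continuous_comp _ _ _ (fun t : T => t.1.2) (fun y : TX => y i)).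
    apply: (@continuous_comp _ _ _ (fun t : T => t.1) snd); [exact: cvg_fst|exact: cvg_snd].
  exact: (@proj_continuous _ (fun i : 'I_m.+1 => 'rV[R]_(d i)) i).
have ps i (t : T) : {for t, continuous (fun t : T => t.2 i)}.
  apply: (@continuous_comp _ _ _ (fun t : T => t.2) (fun y : TX => y i)).
    exact: cvg_snd.
  exact: (@proj_continuous _ (fun i : 'I_m.+1 => 'rV[R]_(d i)) i).
have csq n (a : T -> 'rV[R]_n) t : {for t, continuous a} ->
    {for t, continuous (fun t => sq (a t))}.
  move=> ca; apply: (@continuous_comp _ _ _ a (@sq R n)) => //.
  by apply: differentiable_continuous; exact: (Ck1_sq openT).1.
have csum n (F : 'I_n -> T -> R) t : (forall i, {for t, continuous (F i)}) ->
    {for t, continuous (fun t => \sum_i F i t)}.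
  by move=> cF; apply: (@sum_continuous_at R T _ R^o) => i _; exact: cF.
have cpair (A B C : topologicalType) (a : T -> A) (b : T -> B) (h : A * B -> C) t :
    {for t, continuous a} -> {for t, continuous b} ->
    {for (a t, b t), continuous h} -> {for t, continuous (fun t => h (a t, b t))}.
  move=> ca cb ch; apply: (@continuous_comp _ _ _ (fun t => (a t, b t)) h) => //.
  exact: cvg_pair.
have ccost t : K t -> {for t, continuous (fun t : T => cost t.1.1 t.1.2)}.
  move=> [Ky Kx Ks]; apply: (@cvgD _ R^o).
    apply: (@cvgD _ R^o).
      apply: (@continuous_comp _ _ _ (fun t : T => t.1.2 ord0) f0); first exact: px.
      exact: c0.
    apply: (@continuous_comp _ _ _ (fun t : T => t.1.1 m.+1) fn); first exact: py.
    exact: cn.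
  apply: csum => j.
  apply: (cpair _ _ _ (fun t : T => t.1.1 j.+1) (fun t : T => t.1.2 (lift ord0 j))
    (fun q => f j q.1 q.2)); [exact: py|exact: px|exact: cf].
have cdef t : K t -> {for t, continuous (fun t : T => defect t.1.1 t.1.2 t.2)}.
  move=> [Ky Kx Ks]; apply: (@cvgD _ R^o); apply: csum => i; apply: csq.
    by apply: cvgB; [exact: px|exact: ps].
  apply: cvgB; first exact: py.
  apply: (cpair _ _ _ (fun t : T => t.1.1 i) (fun t : T => t.2 i)
    (fun q => G i q.1 q.2)); [exact: py|exact: ps|].
  by apply: cG => //; exact: SX.
have cdev t : K t -> {for t, continuous (fun t : T => l * deviation t.2)}.
  move=> _; apply: (@cvgM R); first exact: cvg_cst.
  apply: csum => i; apply: csq; apply: cvgB; [exact: ps|exact: cvg_cst].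
have Kt0 : K ((yu, u), u) by split=> // i; exact: SX.
have def0 : defect yu u u = 0.
  by rewrite /defect !big1 ?addr0 // => i _; rewrite ?yuG subrr sq0.
have dev0 : l * deviation u = 0.
  by rewrite /deviation big1 ?mulr0 // => i _; rewrite subrr sq0.
have Hno' t : K t -> l * deviation t.2 <= cost yu u -> defect t.1.1 t.1.2 t.2 = 0 ->
    cost t.1.1 t.1.2 <> 0.
  move: t => [[y x] s] Kt /= dev /defect_eq0 [xs yG]; rewrite xs; apply: Hno => //.
  by move: Kt => [] /=; rewrite xs.
have [N [[[y x] s] Kt [N1 ft hg mt]]] :=
  penalized_minimum cK ccost cdef cdev (fun t => cost_ge0 _ _)
    (fun t => defect_ge0 _ _ _) (fun t => mulr_ge0 (ltW l0) (deviation_ge0 _))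
    Kt0 def0 dev0 Hno'.
exists N, y, x, s; split=> //.
by move=> y' x' s' K'; exact: (mt ((y', x'), s') K').
Qed.

End Existence.

(** * Optimality in single blocks of variables *)

Section Stationarity.
Variables (N l : R) (y : states) (x s : controls).
Hypothesis yxs : feasible y x s.
Hypothesis min_yxs : forall y' x' s', feasible y' x' s' ->
  penalized N l y x s <= penalized N l y' x' s'.

Let upd (k : nat) (z : 'rV[R]_p) : states := fun k' => if k' == k then z else y k'.

Let updE k z : upd k z k = z. Proof. by rewrite /upd eqxx. Qed.

Let updN k z k' : k' != k -> upd k z k' = y k'.
Proof. by rewrite /upd => /negbTE ->. Qed.

(** Only the copy [s i] moves, and the constraint functions do not see it; all remaining terms are
    smooth. *)
Lemma minimizer_control (i : 'I_m.+1) w : KS i w ->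
  N * sq (x i - s i) + N * sq (y i.+1 - G i (y i) (s i)) + l * sq (s i - u i) <=
  N * sq (x i - w) + N * sq (y i.+1 - G i (y i) w) + l * sq (w - u i).
Proof.
move=> Kw; have [Ky Kx Ks] := yxs.
have /min_yxs : feasible y x (eqtype.dfwith s w).
  by split=> // j; case: eqtype.dfwithP.
have o j : j != i -> eqtype.dfwith s w j = s j by move=> ji; rewrite eqtype.dfwith_out // eq_sym.
rewrite /penalized /defect /deviation.
rewrite (@sum_update1 _ _ (fun j => sq (x j - eqtype.dfwith s w j)) (fun j => sq (x j - s j)) i);
  last by move=> j /o ->.
rewrite (@sum_update1 _ _ (fun j : 'I_m.+1 => sq (y j.+1 - G j (y j) (eqtype.dfwith s w j)))
  (fun j : 'I_m.+1 => sq (y j.+1 - G j (y j) (s j))) i); last by move=> j /o ->.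
rewrite (@sum_update1 _ _ (fun j => sq (eqtype.dfwith s w j - u j)) (fun j => sq (s j - u j)) i);
  last by move=> j /o ->.
rewrite eqtype.dfwith_in; lra.
Qed.

Lemma minimizer_initial w : KX ord0 w ->
  f0 (x ord0) + N * sq (x ord0 - s ord0) <= f0 w + N * sq (w - s ord0).
Proof.
move=> Kw; have [Ky Kx Ks] := yxs.
have /min_yxs : feasible y (eqtype.dfwith x w) s.
  by split=> // j; case: eqtype.dfwithP.
have o j : j != ord0 -> eqtype.dfwith x w j = x j by move=> ji; rewrite eqtype.dfwith_out // eq_sym.
rewrite /penalized /defect /cost.
rewrite (@sum_update1 _ _ (fun j => sq (eqtype.dfwith x w j - s j)) (fun j => sq (x j - s j)) ord0);
  last by move=> j /o ->.
rewrite eqtype.dfwith_in.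
have -> : \sum_(j < m) f j (y j.+1) (eqtype.dfwith x w (lift ord0 j)) =
    \sum_(j < m) f j (y j.+1) (x (lift ord0 j)).
  by apply: eq_bigr => j _; rewrite o.
lra.
Qed.

Lemma minimizer_terminal z : KY m.+1 z ->
  fn (y m.+1) + N * sq (y m.+1 - G ord_max (y m) (s ord_max)) <=
  fn z + N * sq (z - G ord_max (y m) (s ord_max)).
Proof.
move=> Kz; have [Ky Kx Ks] := yxs.
have /min_yxs : feasible (upd m.+1 z) x s.
  by split=> // k; rewrite /upd; case: eqP => // ->.
rewrite /penalized /defect /cost.
rewrite (@sum_update1 _ _ (fun j : 'I_m.+1 => sq (upd m.+1 z j.+1 - G j (upd m.+1 z j) (s j)))
  (fun j : 'I_m.+1 => sq (y j.+1 - G j (y j) (s j))) ord_max); last first.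
  move=> j jm; rewrite (updN _ (k' := j.+1)) ?eqSS // (updN _ (k' := j)) //.
  by rewrite ltn_eqF // ltnS -ltnS.
rewrite updE updN /=; last by rewrite ltn_eqF.
have -> : \sum_(j < m) f j (upd m.+1 z j.+1) (x (lift ord0 j)) =
    \sum_(j < m) f j (y j.+1) (x (lift ord0 j)).
  by apply: eq_bigr => j _; rewrite updN // eqSS ltn_eqF.
lra.
Qed.

(** [f j] depends on state and control jointly, so both move at once. The state [y j.+1] is the
    target of the transition [i0] and the source of [i1], whence the two dynamic terms. *)
Lemma minimizer_intermediate (j : 'I_m) z w
    (i0 := widen_ord (leqnSn m) j) (i1 := lift ord0 j) :
  KY j.+1 z -> KX i1 w ->
  f j (y j.+1) (x i1) + N * sq (x i1 - s i1)
    + (N * sq (y j.+1 - G i0 (y j) (s i0)) + N * sq (y j.+2 - G i1 (y j.+1) (s i1)))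
  <= f j z w + N * sq (w - s i1)
    + (N * sq (z - G i0 (y j) (s i0)) + N * sq (y j.+2 - G i1 z (s i1))).
Proof.
move=> Kz Kw; have [Ky Kx Ks] := yxs.
have /min_yxs : feasible (upd j.+1 z) (eqtype.dfwith x w) s.
  split=> // k; first by rewrite /upd; case: eqP => // ->.
  by case: eqtype.dfwithP.
have o i : i != i1 -> eqtype.dfwith x w i = x i by move=> ji; rewrite eqtype.dfwith_out // eq_sym.
have i01 : i0 != i1 by rewrite -val_eqE /= /bump leq0n add1n ltn_eqF.
rewrite /penalized /defect /cost.
rewrite (@sum_update1 _ _ (fun i => sq (eqtype.dfwith x w i - s i)) (fun j => sq (x j - s j)) i1);
  last by move=> i /o ->.
rewrite (@sum_update2 _ _ (fun i : 'I_m.+1 => sq (upd j.+1 z i.+1 - G i (upd j.+1 z i) (s i)))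
  (fun j : 'I_m.+1 => sq (y j.+1 - G j (y j) (s j))) i0 i1); last 2 first.
- exact: i01.
- move=> i; rewrite -!val_eqE /= /bump leq0n add1n => ia ib.
  by rewrite !updN.
rewrite (@sum_update1 _ _ (fun k : 'I_m => f k (upd j.+1 z k.+1) (eqtype.dfwith x w (lift ord0 k)))
  (fun k : 'I_m => f k (y k.+1) (x (lift ord0 k))) j); last first.
  move=> k kj; have ki : lift ord0 k != i1 by rewrite (inj_eq lift_inj).
  by rewrite (o _ ki) updN // eqSS.
rewrite updN /=; last by rewrite eqSS gtn_eqF.
rewrite [upd _ _ (bump 0 j)]updE eqtype.dfwith_in.
rewrite o; last by rewrite neq_lift.
rewrite [upd j.+1 z j]updN ?ltn_eqF // [upd j.+1 z (bump 0 j).+1]updN ?gtn_eqF //.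
rewrite /bump leq0n add1n /=; lra.
Qed.

End Stationarity.

End DiscreteProblem.

(** * Limits of subgradients *)

Section Jacobians.
Context {R : realType}.

Lemma jacobian_continuous m n (W : set 'rV[R]_m) (f : 'rV[R]_m -> 'rV[R]_n) x :
  open W -> W x -> Ck 1 W f -> {for x, continuous (jacobian f)}.
Proof.
move=> oW Wx [df cf].
apply: (@open_eq_continuous R _ _ W _
  (fun y => \sum_i \sum_j ('D_(delta_mx 0 i) f y) 0 j *: delta_mx i j)) => //.
  move=> y Wy; rewrite [LHS]matrix_sum_delta; apply: eq_bigr => i _.
  apply: eq_bigr => j _; rewrite (deriveEjacobian _ (df _ Wy)).
  by rewrite -rowE [row i _ 0 j]mxE.
apply: sum_continuous_at => i _; apply: sum_continuous_at => j _.
apply: scale_continuous_at; last exact: cst_continuous.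
by apply: mxcoord_continuous_at; exact: cf.
Qed.

Lemma differentiable_row_mxl m n (z : 'rV[R]_m) (w : 'rV[R]_n) :
  differentiable (fun z => row_mx z w) z.
Proof. by apply: differentiable_row_mx; [exact: ex_diff|exact: differentiable_cst]. Qed.

Lemma differentiable_row_mxr m n (z : 'rV[R]_m) (w : 'rV[R]_n) :
  differentiable (fun w => row_mx z w) w.
Proof. by apply: differentiable_row_mx; [exact: differentiable_cst|exact: ex_diff]. Qed.

(** Vectors are rows, so the partial derivative in the first block of variables is the upper block
    of rows of the Jacobian. *)
Lemma jacobian_partiall m n p (G : 'rV[R]_(m + n) -> 'rV[R]_p) z w :
  differentiable G (row_mx z w) ->
  jacobian (fun z => G (row_mx z w)) z = usubmx (jacobian G (row_mx z w)).
Proof.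
move=> dG; have dr := differentiable_row_mxl z w.
apply: mul_row_eqP => v.
apply: (etrans (esym (deriveEjacobian v (differentiable_comp dr dG)))).
rewrite (derive_comp v dr dG) (deriveEjacobian _ dG).
rewrite derive_row_mx; [|exact: ex_diff|exact: differentiable_cst].
by rewrite derive_cst derive_id -{1}(vsubmxK (jacobian G _)) mul_row_col mul0mx addr0.
Qed.

Lemma jacobian_partialr m n p (G : 'rV[R]_(m + n) -> 'rV[R]_p) z w :
  differentiable G (row_mx z w) ->
  jacobian (fun w => G (row_mx z w)) w = dsubmx (jacobian G (row_mx z w)).
Proof.
move=> dG; have dr := differentiable_row_mxr z w.
apply: mul_row_eqP => v.
apply: (etrans (esym (deriveEjacobian v (differentiable_comp dr dG)))).
rewrite (derive_comp v dr dG) (deriveEjacobian _ dG).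
rewrite derive_row_mx; [|exact: differentiable_cst|exact: ex_diff].
by rewrite derive_cst derive_id -{1}(vsubmxK (jacobian G _)) mul_row_col mul0mx add0r.
Qed.

Lemma gradD n (f g : 'rV[R]_n -> R^o) z : differentiable f z -> differentiable g z ->
  grad (fun z => f z + g z) z = grad f z + grad g z.
Proof.
move=> df dg; apply/rowP => j; rewrite !mxE.
by apply: (deriveD (f := f) (g := g)); exact: diff_derivable.
Qed.

Lemma gradZ n c (f : 'rV[R]_n -> R^o) z : differentiable f z ->
  grad (fun z => c * f z) z = c *: grad f z.
Proof.
move=> df; apply/rowP => j; rewrite !mxE.
by apply: (deriveZ (f := f)); exact: diff_derivable.
Qed.

Lemma differentiable_sq n (z : 'rV[R]_n) : differentiable (@sq R n : _ -> R^o) z.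
Proof. exact: (Ck1_sq openT).1. Qed.

Lemma grad_sq_comp m n (f : 'rV[R]_m -> 'rV[R]_n) z : differentiable f z ->
  grad (fun z => sq (f z)) z = 2 *: (f z *m (jacobian f z)^T).
Proof.
move=> df; rewrite (grad_comp df (differentiable_sq _)) grad_sq.
by rewrite -scalemxAl.
Qed.

Lemma grad_sq_subr n (c z : 'rV[R]_n) : grad (fun z => sq (z - c)) z = 2 *: (z - c).
Proof.
have d1 : differentiable (fun z : 'rV[R]_n => z - c) z.
  by apply: differentiableB; [exact: ex_diff|exact: differentiable_cst].
rewrite grad_sq_comp //; congr (_ *: _); rewrite -[RHS]mulmx1 -[in RHS](trmx1 R n).
congr (_ *m _^T); apply: mul_row_eqP => v.
apply: (etrans (esym (deriveEjacobian v d1))).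
rewrite mulmx1 (deriveB (f := id) (g := cst c)).
- by rewrite derive_id derive_cst subr0.
- exact: derivable_id.
- exact: derivable_cst.
Qed.

Lemma grad_sq_subl m n (c : 'rV[R]_n) (f : 'rV[R]_m -> 'rV[R]_n) z : differentiable f z ->
  grad (fun z => sq (c - f z)) z = - (2 *: ((c - f z) *m (jacobian f z)^T)).
Proof.
move=> df.
have d1 : differentiable (fun z => c - f z) z.
  by apply: differentiableB => //; exact: differentiable_cst.
rewrite grad_sq_comp // -scalerN -mulmxN -linearN /=; congr (_ *: (_ *m _^T)).
apply: mul_row_eqP => v; apply: (etrans (esym (deriveEjacobian v d1))).
rewrite mulmxN (deriveB (f := cst c) (g := f)).
- by rewrite derive_cst sub0r deriveEjacobian.
- exact: derivable_cst.
- exact: diff_derivable.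
Qed.

End Jacobians.

Section Subsequences.

(** Iterated extraction: since [C] is hereditary, a further refinement preserves the properties
    already gained. *)
Lemma common_subsequence (C : nat -> (nat -> nat) -> Prop) :
  (forall j s s', C j s -> {homo s' : a b / (a < b)%N} -> C j (s \o s')) ->
  (forall j s, {homo s : a b / (a < b)%N} ->
     exists2 s', {homo s' : a b / (a < b)%N} & C j (s \o s')) ->
  forall n, exists2 s, {homo s : a b / (a < b)%N} & forall j, (j < n)%N -> C j s.
Proof.
move=> her ext; elim=> [|n [s hs Cs]]; first by exists id.
have [s' hs' Cs'] := ext n s hs.
exists (s \o s'); first by move=> a b /hs' /hs.
move=> j; rewrite ltnS leq_eqVlt => /orP[/eqP ->//|jn].
by apply: her => //; exact: Cs.
Qed.

Lemma homo_ltn_cvg (s : nat -> nat) : {homo s : a b / (a < b)%N} -> s @ \oo --> \oo.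
Proof.
move=> hs; have sn n : (n <= s n)%N.
  by elim: n => // n IH; apply: leq_ltn_trans IH _; exact: hs.
move=> A [n _ An]; exists n => // k nk; apply: An.
exact: leq_trans nk (sn k).
Qed.

Lemma cvg_subseq (T : topologicalType) (u : nat -> T) (l : T) (s : nat -> nat) :
  {homo s : a b / (a < b)%N} -> u @ \oo --> l -> (u \o s) @ \oo --> l.
Proof. by move=> /homo_ltn_cvg hs ul; apply: cvg_comp ul. Qed.

End Subsequences.

(** * Consequences of the Lipschitz and regularity assumptions near a point *)

Section Constraints.
Context {R : realType}.
Implicit Types X : ratlas R.

Lemma rdist_ge0 X (x y : X) : (0 <= rdist x y)%E.
Proof.
apply: le_ereal_inf_tmp => _ [g _ <-]; apply: integral_ge0 => t _.
by rewrite lee_fin sqrtr_ge0.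
Qed.

(** The chart facts about [X] are assumed one by one, and not as [riemannian X], so that the lemma
    can be applied to [prod2] from facts about its factors. *)
Lemma coord_lipschitz (E : metricType R) X (phi : E -> X -> R) (x : X) :
  loc_lipschitz phi -> short_curves x -> chinv x (chart x x) = x ->
  {for chart x x, continuous (chinv x)} ->
  exists r L : R, [/\ 0 < r, 0 <= L & forall e (z1 z2 : 'rV[R]_(dim X)),
    `|z1 - chart x x| <= r -> `|z2 - chart x x| <= r ->
    `|phi e (chinv x z1) - phi e (chinv x z2)| <= L * `|z1 - z2|].
Proof.
move=> /(_ x) [W nW [L HL]] /short_curves_rdist [r [C [r0 C0 HC]]] xK cx.
have nW' : nbhs (chinv x (chart x x)) W by rewrite xK.
have /nbhs_ballP[r' /= r'0 Hr'] : \forall z \near chart x x, W (chinv x z) := cx _ nW'.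
exists (Num.min r (r' / 2)), (`|L| * C); split.
- by rewrite lt_min r0 divr_gt0.
- by rewrite mulr_ge0 // ltW.
move=> e z1 z2; rewrite !le_min => /andP[z1r z1r'] /andP[z2r z2r'].
have inW (z : 'rV[R]_(dim X)) : `|z - chart x x| <= r' / 2 -> W (chinv x z).
  move=> zr; apply: Hr'; rewrite -ball_normE /= distrC.
  by apply: le_lt_trans zr _; lra.
have := HL e _ _ (inW _ z1r') (inW _ z2r').
have := HC _ _ z1r z2r; have := rdist_ge0 (chinv x z1) (chinv x z2).
(* Infinite values contradict the two bounds just stated. *)
case: (rdist _ _) => [D| |] //=.
rewrite -[(L%:E * D%:E)%E]EFinM !lee_fin => D0 DC H.
apply: (le_trans H); apply: (@le_trans _ _ (`|L| * D)).
  by rewrite ler_wpM2r // ler_norm.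
by rewrite -mulrA ler_wpM2l.
Qed.

Lemma cot_coord_self X (x : X) p : riemannian X -> cot_coord x x p = p.
Proof.
move=> hX; have xx := riem_dom_self hX x.
rewrite /cot_coord; suff -> : jacobian (trans x x) (chart x x) = 1%:M.
  by rewrite trmx1 mulmx1.
rewrite -(jacobian_id (chart x x)); apply: near_eq_jacobian.
  by apply: filterS (near_codm hX (chart_self hX x)) => z xz; rewrite /trans /= chinvK.
exact: trans_differentiable.
Qed.

Lemma limiting_of_frechet X (f : X -> \bar R) (x : X) p :
  (forall q, cot_coord x x q = q) ->
  frechet_subdiff f x p -> limiting_subdiff f x p.
Proof.
move=> H fp; exists (fun _ => x), (fun _ => p); split=> //.
- exact: cvg_cst.
- split; first exact: cvg_cst.
  by under eq_fun do rewrite H; exact: cvg_cst.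
Qed.

Lemma phi_regular_subseq (E : metricType R) X (phi : E -> X -> R) e0 (x0 : X)
    (ek : nat -> E) (xk : nat -> X) (pk : nat -> 'rV[R]_(dim X)) :
  (forall x q : _, @cot_coord R X x x q = q) ->
  phi_regular phi e0 x0 -> ek @ \oo --> e0 -> xk @ \oo --> x0 ->
  (forall k, frechet_subdiff (EFin \o phi (ek k)) (xk k) (pk k)) ->
  exists (s : nat -> nat) p, [/\ {homo s : a b / (a < b)%N}, subdiffL (phi e0) x0 p &
    (fun k => cot_coord x0 (xk (s k)) (pk (s k))) @ \oo --> p].
Proof.
move=> H [_ reg] ecv xcv fr.
have [|s [p [hs sp [_ cp]]]] := reg _ _ pk ecv xcv; last by exists s, p.
by move=> k; apply: limiting_of_frechet.
Qed.

(** Part (i) of the regularity read backwards: conorms are controlled by coordinates, so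
    subgradients tending to 0 fall below [Delta], and the function cannot be positive there. *)
Lemma phi_regular_slope (E : metricType R) X (phi : E -> X -> R) e0 (x0 : X)
    (ek : nat -> E) (zk : nat -> 'rV[R]_(dim X)) (pk : nat -> 'rV[R]_(dim X)) :
  (forall x q : _, @cot_coord R X x x q = q) ->
  phi_regular phi e0 x0 -> short_curves x0 -> cotangent_bound x0 ->
  chinv x0 (chart x0 x0) = x0 -> {for chart x0 x0, continuous (chinv x0)} ->
  ek @ \oo --> e0 -> zk @ \oo --> chart x0 x0 ->
  (forall k, frechet_subdiff (EFin \o phi (ek k)) (chinv x0 (zk k)) (pk k)) ->
  (fun k => cot_coord x0 (chinv x0 (zk k)) (pk k)) @ \oo --> (0 : 'rV[R]_(dim X)) ->
  \forall k \near \oo, ~ 0 < phi (ek k) (chinv x0 (zk k)).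
Proof.
move=> H [[eps [Delta [eps0 Delta0 reg]]] _] /short_curves_rdist [r [C [r0 C0 HC]]].
move=> /conorm_le [B B0 HB] xK cx ecv zcv fr cp.
have xcv : (chinv x0 \o zk) @ \oo --> x0 by rewrite -{2}xK; exact: cvg_comp zcv cx.
have nB : \forall k \near \oo, forall p, conorm (chinv x0 (zk k)) p <=
   B * `|cot_coord x0 (chinv x0 (zk k)) p| := xcv _ HB.
(* Half of [eps] is spent on the distance in [X], estimated through [C], and the other half on the
   distance in [E]. *)
have nz : \forall k \near \oo, `|zk k - chart x0 x0| < Num.min r (eps / 2 / C).
  move/cvgrPdist_lt : zcv => /(_ (Num.min r (eps / 2 / C))).
  rewrite lt_min r0 !divr_gt0 // => /(_ isT).
  by apply: filterS => k; rewrite distrC.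
have ne : \forall k \near \oo, mdist (ek k) e0 < eps / 2.
  have e20 : 0 < eps / 2 by rewrite divr_gt0.
  have : \forall k \near \oo, ball e0 (eps / 2) (ek k) := ecv _ (nbhsx_ballx e0 _ e20).
  by apply: filterS => k; rewrite ballEmdist /= metric_sym.
have nc : \forall k \near \oo, B * `|cot_coord x0 (chinv x0 (zk k)) (pk k)| < Delta.
  have : 0 < Delta / (B + 1) by rewrite divr_gt0 // ltr_wpDl.
  move/cvgrPdist_lt : cp => /[apply]; apply: filterS => k; rewrite sub0r normrN => cpk.
  apply: (@le_lt_trans _ _ ((B + 1) * `|cot_coord x0 (chinv x0 (zk k)) (pk k)|)).
    by rewrite ler_wpM2r // lerDl.
  by rewrite mulrC -ltr_pdivlMr // ltr_wpDl.
near=> k => phi0.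
have : Delta <= conorm (chinv x0 (zk k)) (pk k).
  apply: (reg (ek k)) => //; last exact: limiting_of_frechet.
  have zr : `|zk k - chart x0 x0| < Num.min r (eps / 2 / C) by near: k.
  move: zr; rewrite lt_min => /andP[/ltW zr zr'].
  have := HC (zk k) (chart x0 x0) zr.
  rewrite subrr normr0 xK => /(_ (ltW r0)) d.
  apply: (@le_lt_trans _ _ (mdist (ek k) e0 + C * `|zk k - chart x0 x0|)%:E).
    by rewrite EFinD leeD2l.
  rewrite lte_fin [eps]splitr ltrD //; first by near: k.
  by rewrite mulrC -ltr_pdivlMr.
apply/negP; rewrite -ltNge.
apply: (@le_lt_trans _ _ (B * `|cot_coord x0 (chinv x0 (zk k)) (pk k)|)).
  by near: k; apply: filterS nB => k; exact.
by near: k.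
Unshelve. all: by end_near. Qed.

Lemma cvg_mxcoord (m n : nat) (u : nat -> 'M[R]_(m, n)) (l : 'M[R]_(m, n)) i j :
  u @ \oo --> l -> (fun k => u k i j) @ \oo --> l i j.
Proof.
move=> ul; have cl : {for l, continuous (fun M : 'M[R]_(m, n) => M i j)}.
  exact: coord_continuous.
exact: (cvg_comp _ _ ul cl).
Qed.

(** Clarke regularity supplies tangent vectors [vk] at the nearby points with limit [v]. Each pairs
    nonpositively with the normal at its point; pairings do not depend on the chart, so the
    inequality survives in the limit. *)
Lemma clarke_normal_limit X (S : set X) (x0 : X) (zk : nat -> 'rV[R]_(dim X))
    (pk : nat -> 'rV[R]_(dim X)) p v :
  riemannian X -> clarke_regular S -> S x0 ->
  (forall k, codm x0 (zk k)) -> zk @ \oo --> chart x0 x0 ->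
  (forall k, frechet_subdiff (chi S) (chinv x0 (zk k)) (pk k)) ->
  (fun k => cot_coord x0 (chinv x0 (zk k)) (pk k)) @ \oo --> p ->
  clarke_tangent S x0 v -> pairing p v <= 0.
Proof.
move=> hX reg Sx0 xz zcv fr cp Tv.
have xK := chinv_self hX x0.
have cx := riem_chinv_continuous hX (chart_self hX x0).
have xcv : (chinv x0 \o zk) @ \oo --> x0 by rewrite -{2}xK; exact: cvg_comp zcv cx.
have Sk k : S (chinv x0 (zk k)).
  have [+ _] := fr k; rewrite /chi; case: ifPn => // /asboolP //.
have [vk [Tvk [_ cv]]] := reg x0 v (chinv x0 \o zk) Sx0 Tv Sk xcv.
have cpv : (fun k => pairing (cot_coord x0 (chinv x0 (zk k)) (pk k))
    (tan_coord x0 (chinv x0 (zk k)) (vk k))) @ \oo --> pairing p v.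
  under eq_fun do rewrite pairingE.
  rewrite pairingE; apply: (@sum_cvg R _ _ _ _ R^o) => j _; apply: (@cvgM R).
    have H : (fun k => cot_coord x0 (chinv x0 (zk k)) (pk k) 0 j) @ \oo --> p 0 j.
      exact: (@cvg_mxcoord 1 (dim X) _ _ 0 j cp).
    exact: H.
  exact: (@cvg_mxcoord 1 (dim X) _ _ 0 j cv).
apply: (cvgr_to_le cpv); near=> k.
rewrite pairing_cot_tan //; last by exact: dom_chinv.
apply: Tvk; apply: limiting_of_frechet (fr k) => q; exact: cot_coord_self.
Unshelve. all: by end_near. Qed.

End Constraints.

(** * The control problem *)

Lemma lipschitz_continuous_at {R : realType} (V : normedModType R) (f : V -> R) (c z : V) r L :
  (forall z1 z2, `|z1 - c| <= r -> `|z2 - c| <= r -> `|f z1 - f z2| <= L * `|z1 - z2|) ->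
  `|z - c| < r -> {for z, continuous f}.
Proof.
move=> HL zr; apply/cvgrPdist_lt => e e0.
have L0 : 0 < `|L| + 1 by rewrite ltr_wpDl.
near=> w.
have wz : `|z - w| < r - `|z - c|.
  by near: w; apply: cvgr_dist_lt; [exact: cvg_id|rewrite subr_gt0].
have wr : `|w - c| <= r.
  have -> : w - c = (z - c) - (z - w) by rewrite opprB [RHS]addrC addrA subrK.
  by rewrite (le_trans (ler_normB _ _)) // -lerBrDl ltW.
apply: (le_lt_trans (HL _ _ (ltW zr) wr)).
apply: (@le_lt_trans _ _ ((`|L| + 1) * `|z - w|)).
  by rewrite ler_wpM2r // ler_wpDr // ler_norm.
rewrite mulrC -ltr_pdivlMr //; near: w; apply: cvgr_dist_lt; first exact: cvg_id.
by rewrite divr_gt0.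
Unshelve. all: by end_near. Qed.

Section SquareCk1.
Context {R : realType}.

Lemma open_ball_rV n (c : 'rV[R]_n) (e : R) : open [set z : 'rV[R]_n | `|z - c| < e].
Proof.
have -> : [set z : 'rV[R]_n | `|z - c| < e] = (fun z : 'rV[R]_n => `|z - c|) @^-1` [set t | t < e].
  by [].
apply: open_comp; last exact: open_lt.
move=> y _; apply: (@continuous_comp _ _ _ (fun y : 'rV[R]_n => y - c) Num.norm).
  by apply: (@continuousB _ _ _ id (cst c)); [exact: cvg_id|exact: cst_continuous].
exact: norm_continuous.
Qed.

Lemma Ck1_sq_comp (V : normedModType R) n (A : set V) (g : V -> 'rV[R]_n) :
  open A -> Ck 1 A g -> Ck 1 A (fun z => sq (g z) : R^o).
Proof.
move=> oA cg; exact: (Ck1_comp oA (fun _ _ => I) cg (Ck1_sq openT)).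
Qed.

Lemma Ck1_sq_subr n (A : set 'rV[R]_n) (c : 'rV[R]_n) : open A ->
  Ck 1 A (fun z => sq (z - c) : R^o).
Proof.
move=> oA; apply: Ck1_sq_comp => //.
by apply: Ck1B => //; [exact: Ck1_id|exact: Ck1_cst].
Qed.

Lemma Ck1_sq_subl (V : normedModType R) n (A : set V) (c : 'rV[R]_n) (g : V -> 'rV[R]_n) :
  open A -> Ck 1 A g -> Ck 1 A (fun z => sq (c - g z) : R^o).
Proof.
move=> oA cg; exact: (Ck1_sq_comp oA (Ck1B oA (Ck1_cst A c) cg)).
Qed.

End SquareCk1.

Section Prod2Charts.
Context {R : realType} {X Y : ratlas R}.
Hypotheses (hX : riemannian X) (hY : riemannian Y).

Lemma chinv_self_prod2 (x : prod2 X Y) : chinv x (chart x x) = x.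
Proof. by case: x => x y /=; rewrite row_mxKl row_mxKr !chinv_self. Qed.

Lemma cot_coord_self_prod2 (x : prod2 X Y) q : cot_coord x x q = q.
Proof.
case: x => x y; rewrite -[q]hsubmxK.
rewrite (cot_coord_prod2 hX hY _ _ (riem_dom_self hX x) (riem_dom_self hY y)).
by rewrite !cot_coord_self.
Qed.

Lemma chinv_continuous_prod2 (x : prod2 X Y) : {for chart x x, continuous (chinv x)}.
Proof.
case: x => x y.
have cl : {for row_mx (chart x x) (chart y y), continuous (chinv x \o @lsubmx R 1 (dim X) (dim Y))}.
  apply: continuous_comp; first exact: linear_mx_continuous.
  by rewrite row_mxKl; apply: riem_chinv_continuous => //; exact: chart_self.
have cr : {for row_mx (chart x x) (chart y y), continuous (chinv y \o @rsubmx R 1 (dim X) (dim Y))}.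
  apply: continuous_comp; first exact: linear_mx_continuous.
  by rewrite row_mxKr; apply: riem_chinv_continuous => //; exact: chart_self.
exact: cvg_pair cl cr.
Qed.

End Prod2Charts.

Section RightRadius.
Context {R : realType}.

(** Turns local conditions into conditions on small radii, so that a common radius for finitely many
    of them comes from intersecting filter sets. *)
Lemma near_right_ball (V : normedModType R) (z0 : V) (P : V -> Prop) :
  (\forall z \near z0, P z) -> \forall r \near (0 : R)^'+, forall z, `|z - z0| <= r -> P z.
Proof.
move=> /nbhs_ballP[r /= r0 Hr]; near=> s => z zs; apply: Hr.
rewrite -ball_normE /= distrC; apply: le_lt_trans zs _.
by near: s; exact: nbhs_right_lt.
Unshelve. all: by end_near. Qed.

Lemma near_right_le (r : R) : 0 < r -> \forall s \near (0 : R)^'+, s <= r.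
Proof. by move=> r0; exact: nbhs_right_le. Qed.

Lemma row_mx_norm_le m n (z : 'rV[R]_m) (w : 'rV[R]_n) c :
  `|z| <= c -> `|w| <= c -> `|row_mx z w| <= c.
Proof.
move=> zc wc; apply: norm_le_coord; first exact: le_trans zc.
move=> i j; rewrite row_mx_entry; case: fintype.split => k.
  exact: le_trans (coord_le_norm _ _ _) zc.
exact: le_trans (coord_le_norm _ _ _) wc.
Qed.

Lemma mxrow_norm_le n (d : 'I_n -> nat) (z : forall i, 'rV[R]_(d i)) c : 0 <= c ->
  (forall i, `|z i| <= c) -> `|\mxrow_i z i| <= c.
Proof.
move=> c0 zc; apply: norm_le_coord => // i j; rewrite mxE.
exact: le_trans (coord_le_norm _ _ _) (zc _).
Qed.

End RightRadius.

Section Limits.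
Context {R : realType}.

Lemma cvg_of_norm_le (V : normedModType R) (u v : nat -> V) (d : nat -> R) (a : V) :
  (\forall n \near \oo, `|u n - v n| <= d n) -> d @ \oo --> (0 : R) ->
  v @ \oo --> a -> u @ \oo --> a.
Proof.
move=> ud /cvgrPdist_lt d0 /cvgrPdist_lt va; apply/cvgrPdist_lt => e e0.
have e20 : 0 < e / 2 by rewrite divr_gt0.
have H1 := d0 _ e20; have H2 := va _ e20.
near=> n; have dn : `|0 - d n| < e / 2 by near: n; exact: H1.
have vn : `|a - v n| < e / 2 by near: n; exact: H2.
have un : `|u n - v n| <= d n by near: n; exact: ud.
have -> : a - u n = (a - v n) - (u n - v n) by rewrite opprB addrA subrK.
apply: le_lt_trans (ler_normB _ _) _; rewrite [e]splitr ltrD //.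
apply: le_lt_trans un _; apply: le_lt_trans dn.
by rewrite sub0r normrN ler_norm.
Unshelve. all: by end_near. Qed.

Lemma cvg_mulmx m n p (u : nat -> 'M[R]_(m, n)) (v : nat -> 'M[R]_(n, p))
    (a : 'M[R]_(m, n)) (b : 'M[R]_(n, p)) :
  u @ \oo --> a -> v @ \oo --> b -> (fun k => u k *m v k) @ \oo --> a *m b.
Proof.
move=> ua vb.
have -> : (fun k => u k *m v k) =
    (fun k => \sum_i \sum_j (\sum_l u k i l * v k l j) *: delta_mx i j).
  apply/funext => k; rewrite [LHS]matrix_sum_delta; apply: eq_bigr => i _.
  by apply: eq_bigr => j _; rewrite mxE.
have -> : a *m b = \sum_i \sum_j (\sum_l a i l * b l j) *: delta_mx i j.
  rewrite [LHS]matrix_sum_delta; apply: eq_bigr => i _.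
  by apply: eq_bigr => j _; rewrite mxE.
apply: sum_cvg => i _; apply: sum_cvg => j _; apply: (@cvgZ _ _ nat).
  apply: (@sum_cvg R _ _ _ _ R^o) => l _; apply: (@cvgM R); exact: cvg_mxcoord.
exact: cvg_cst.
Qed.

Lemma cvg_linear_mx m n (V : normedModType R) (f : {linear 'M[R]_(m, n) -> V})
    (u : nat -> 'M[R]_(m, n)) (a : 'M[R]_(m, n)) : u @ \oo --> a -> (fun k => f (u k)) @ \oo --> f a.
Proof. by move=> ua; apply: (cvg_comp u f ua); exact: linear_mx_continuous. Qed.

End Limits.

(** * The control problem in charts around the reference process *)

Section ControlProblem.
Context {R : realType} {m : nat} {Q : ratlas R} {U : 'I_m.+1 -> ratlas R}.
Hypotheses (hQ : riemannian Q) (hU : forall i, riemannian (U i)).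
Variables (UU : forall i, set (U i)) (F : forall i, prod2 Q (U i) -> Q).
Arguments UU : clear implicits.
Arguments F : clear implicits.
Hypotheses (UU_closed : forall i, closed (UU i)) (F_C1 : forall i, C1_map (F i)).
Variables (q0 : Q) (E : metricType R).
Variables (phi0 : E -> U ord0 -> R)
  (phi : forall j : 'I_m, E -> prod2 Q (U (lift ord0 j)) -> R)
  (phin : E -> Q -> R).
Arguments phi : clear implicits.
Hypotheses (phi0_ge0 : forall e u, 0 <= phi0 e u)
  (phi_ge0 : forall j e x, 0 <= phi j e x)
  (phin_ge0 : forall e q, 0 <= phin e q).
Hypotheses (phi0_lip : loc_lipschitz phi0)
  (phi_lip : forall j, loc_lipschitz (phi j)) (phin_lip : loc_lipschitz phin).
Variables (ubar : forall i, U i).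
Arguments ubar : clear implicits.

(* q_k and ubar_i have coordinates zb k and wb i; yv, uv decode coordinates, and
   G i is F_i in the charts around the reference process. *)
Let q (k : nat) : Q := state F q0 ubar k.
Let zb (k : nat) : 'rV[R]_(dim Q) := chart (q k) (q k).
Let wb (i : 'I_m.+1) : 'rV[R]_(dim (U i)) := chart (ubar i) (ubar i).
Let yv (k : nat) : 'rV[R]_(dim Q) -> Q := chinv (q k).
Let uv (i : 'I_m.+1) : 'rV[R]_(dim (U i)) -> U i := chinv (ubar i).
Let Gh (i : 'I_m.+1) : 'rV[R]_(dim Q + dim (U i)) -> 'rV[R]_(dim Q) :=
  chart (F i (q i, ubar i)) \o F i \o @chinv R (prod2 Q (U i)) (q i, ubar i).
Arguments Gh : clear implicits.
Arguments wb : clear implicits.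
Arguments uv : clear implicits.
Let G (i : 'I_m.+1) (z : 'rV[R]_(dim Q)) (w : 'rV[R]_(dim (U i))) : 'rV[R]_(dim Q) :=
  Gh i (row_mx z w).

Arguments G : clear implicits.

Lemma stateS u (i : 'I_m.+1) : state F q0 u i.+1 = F i (state F q0 u i, u i).
Proof. by rewrite /= valK. Qed.

Let GE i z w : G i z w = chart (q i.+1) (F i (yv i z, uv i w)).
Proof. by rewrite /G /Gh /= row_mxKl row_mxKr /q stateS. Qed.

Let Gb i : G i (zb i) (wb i) = zb i.+1.
Proof. by rewrite GE /yv /uv /zb /wb !chinv_self // -stateS. Qed.

(** One radius and one set of constants for all stages. [W i] is an open set on which [F i] is C^1
    in charts; the final state starts no transition, so its chart range is covered by the separate
    field [rr_codm]. *)
Record regular_radius (r L C : R) (W : forall i : 'I_m.+1, set 'rV[R]_(dim Q + dim (U i))) :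
  Prop := {
  rr_gt0 : 0 < r ;
  rr_L : 0 <= L ;
  rr_C : 0 < C ;
  rr_W : forall (i : 'I_m.+1) z w, `|z - zb i| <= r -> `|w - wb i| <= r -> W i (row_mx z w) ;
  rr_open : forall i, open (W i) ;
  rr_C1 : forall i, Ck 1 (W i) (Gh i) ;
  rr_dom : forall (i : 'I_m.+1) z w, W i (row_mx z w) ->
    [/\ codm (q i) z, codm (ubar i) w & dom (q i.+1) (F i (yv i z, uv i w))] ;
  rr_codm : forall z, `|z - zb m.+1| <= r -> codm (q m.+1) z ;
  rr_phi0 : forall e w1 w2, `|w1 - wb ord0| <= r -> `|w2 - wb ord0| <= r ->
    `|phi0 e (uv ord0 w1) - phi0 e (uv ord0 w2)| <= L * `|w1 - w2| ;
  rr_phin : forall e z1 z2, `|z1 - zb m.+1| <= r -> `|z2 - zb m.+1| <= r ->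
    `|phin e (yv m.+1 z1) - phin e (yv m.+1 z2)| <= L * `|z1 - z2| ;
  rr_phi : forall (j : 'I_m) e z1 z2 w1 w2,
    `|z1 - zb j.+1| <= r -> `|z2 - zb j.+1| <= r ->
    `|w1 - wb (lift ord0 j)| <= r -> `|w2 - wb (lift ord0 j)| <= r ->
    `|phi j e (yv j.+1 z1, uv (lift ord0 j) w1) -
      phi j e (yv j.+1 z2, uv (lift ord0 j) w2)| <= L * `|row_mx z1 w1 - row_mx z2 w2| ;
  rr_dist : forall w1 w2 : forall i, 'rV[R]_(dim (U i)),
    (forall i, `|w1 i - wb i| <= r) -> (forall i, `|w2 i - wb i| <= r) ->
    (@rdist R (prodn U) (fun i => uv i (w1 i)) (fun i => uv i (w2 i)) <=
      (C * \sum_i `|w1 i - w2 i|)%:E)%E }.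

Lemma C1_map_charts (i : 'I_m.+1) : exists W : set 'rV[R]_(dim Q + dim (U i)),
  [/\ open W, W (row_mx (zb i) (wb i)), Ck 1 W (Gh i) &
    forall z w, W (row_mx z w) ->
    [/\ codm (q i) z, codm (ubar i) w & dom (q i.+1) (F i (yv i z, uv i w))]].
Proof.
have [W [[oW Wx] Wc Wd kW]] := F_C1 (i := i) (q i, ubar i).
exists W; split=> // z w Wzw.
have D := Wd _ Wzw; rewrite /= row_mxKl row_mxKr in D.
have [[y1 y2] [d1 d2] /eq_row_mx [/= E1 E2]] := Wc _ Wzw.
split; [by rewrite -E1; exact: chart_codm|by rewrite -E2; exact: chart_codm|].
by rewrite /q stateS.
Qed.

Lemma exists_regular_radius : exists r L C W, regular_radius r L C W.
Proof.
pose W i := sval (cid (C1_map_charts i)).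
have HW i := svalP (cid (C1_map_charts i)).
have sU i : short_curves (ubar i) by exact: riemannian_short_curves.
have sQ k : short_curves (q k) by exact: riemannian_short_curves.
have [r0 [L0 [r00 L00 H0]]] := coord_lipschitz phi0_lip (sU ord0)
  (chinv_self (hU ord0) _) (riem_chinv_continuous (hU ord0) (chart_self (hU ord0) _)).
have [rn [Ln [rn0 Ln0 Hn]]] := coord_lipschitz phin_lip (sQ m.+1)
  (chinv_self hQ _) (riem_chinv_continuous hQ (chart_self hQ _)).
have /choice [rj /choice [Lj Hj]] (j : 'I_m) : exists r L : R, [/\ 0 < r, 0 <= L &
    forall e (z1 z2 : 'rV[R]_(dim Q + dim (U (lift ord0 j)))),
    `|z1 - row_mx (zb j.+1) (wb (lift ord0 j))| <= r ->
    `|z2 - row_mx (zb j.+1) (wb (lift ord0 j))| <= r ->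
    `|phi j e (yv j.+1 (lsubmx z1), uv (lift ord0 j) (rsubmx z1)) -
      phi j e (yv j.+1 (lsubmx z2), uv (lift ord0 j) (rsubmx z2))| <= L * `|z1 - z2|].
  have := @coord_lipschitz R E (prod2 Q (U (lift ord0 j))) (phi j)
    (q j.+1, ubar (lift ord0 j)) (phi_lip (j := j))
    (short_curves_prod2 hQ (hU _) (sQ _) (sU _))
    (chinv_self_prod2 hQ (hU _) (q j.+1, ubar (lift ord0 j)))
    (chinv_continuous_prod2 hQ (hU _) (x := (q j.+1, ubar (lift ord0 j)))).
  exact.
have [rd [C [rd0 C0 Hd]]] := short_curves_rdist (short_curves_prodn (x := ubar) hU sU).
have Lj0 : 0 <= \sum_j Lj j by apply: sumr_ge0 => j _; have [] := Hj j.
(* The constants are nonnegative, so their sum serves for every constraint function. *)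
pose L := L0 + Ln + \sum_j Lj j.
have NW : \forall r \near (0 : R)^'+, forall (i : 'I_m.+1) z,
    `|z - row_mx (zb i) (wb i)| <= r -> W i z.
  apply: (@filter_forall _ _ (fun (i : 'I_m.+1) (r : R) => forall z,
    `|z - row_mx (zb i) (wb i)| <= r -> W i z)) => i.
  apply: near_right_ball; apply: open_nbhs_nbhs; have [oW Wb _ _] := HW i.
  by split.
have Nc : \forall r \near (0 : R)^'+, forall z, `|z - zb m.+1| <= r -> codm (q m.+1) z.
  by apply: near_right_ball; apply: near_codm => //; exact: chart_self.
have Nj : \forall r \near (0 : R)^'+, forall j, r <= rj j.
  apply: (@filter_forall _ _ (fun j (r : R) => r <= rj j)) => j.
  by apply: near_right_le; have [] := Hj j.
near (0 : R)^'+ => r.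
exists r, L, C, W; split.
- by near: r; exact: nbhs_right_gt.
- by rewrite !addr_ge0.
- exact: C0.
- move=> i z w zr wr; have : forall (i : 'I_m.+1) z, `|z - row_mx (zb i) (wb i)| <= r -> W i z by near: r.
  by apply; rewrite opp_row_mx add_row_mx; exact: row_mx_norm_le.
- by move=> i; have [] := HW i.
- by move=> i; have [] := HW i.
- by move=> i; have [] := HW i.
- by near: r.
- move=> e w1 w2 w1r w2r; have rr : r <= r0 by near: r; exact: near_right_le.
  apply: le_trans (H0 e _ _ (le_trans w1r rr) (le_trans w2r rr)) _.
  by rewrite ler_wpM2r // /L -addrA lerDl addr_ge0.
- move=> e z1 z2 z1r z2r; have rr : r <= rn by near: r; exact: near_right_le.
  apply: le_trans (Hn e _ _ (le_trans z1r rr) (le_trans z2r rr)) _.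
  by rewrite ler_wpM2r // /L -addrA addrCA lerDl addr_ge0.
- move=> j e z1 z2 w1 w2 z1r z2r w1r w2r.
  have rr : r <= rj j by move: (j); near: r.
  have [_ _ /(_ e (row_mx z1 w1) (row_mx z2 w2))] := Hj j.
  rewrite !row_mxKl !row_mxKr !opp_row_mx !add_row_mx.
  move=> /(_ (row_mx_norm_le (le_trans z1r rr) (le_trans w1r rr))
             (row_mx_norm_le (le_trans z2r rr) (le_trans w2r rr))) H.
  apply: le_trans H _; rewrite ler_wpM2r //.
  rewrite /L (bigD1 j) //= addrCA lerDl !addr_ge0 //.
  by apply: sumr_ge0 => k _; have [] := Hj k.
- move=> w1 w2 w1r w2r; have rr : r <= rd by near: r; exact: near_right_le.
  have r0' : 0 < r by near: r; exact: nbhs_right_gt.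
  have chE : chart (ubar : prodn U) ubar = \mxrow_i wb i by [].
  have := Hd (\mxrow_i w1 i) (\mxrow_i w2 i).
  rewrite chE -!mxrowB.
  move=> /(_ (mxrow_norm_le (ltW rd0) (fun i => le_trans (w1r i) rr))
             (mxrow_norm_le (ltW rd0) (fun i => le_trans (w2r i) rr))) H.
  have -> : (fun i => uv i (w1 i)) = chinv (ubar : prodn U) (\mxrow_i w1 i).
    by apply: functional_extensionality_dep => i /=; rewrite mxrowK.
  have -> : (fun i => uv i (w2 i)) = chinv (ubar : prodn U) (\mxrow_i w2 i).
    by apply: functional_extensionality_dep => i /=; rewrite mxrowK.
  apply: le_trans H _; rewrite lee_fin ler_wpM2l ?(ltW C0) //.
  apply: mxrow_norm_le => [|i]; first exact: sumr_ge0.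
  by rewrite (bigD1 i) //= lerDl sumr_ge0.
Unshelve. all: by end_near. Qed.

(** * Compact balls and first-order conditions *)

Section LocalProblem.
Variables (r L C : R) (W : forall i : 'I_m.+1, set 'rV[R]_(dim Q + dim (U i))).
Arguments W : clear implicits.
Hypothesis rr : regular_radius r L C W.

(** Half the radius: the closed balls used for minimization then lie in the interior of the region
    where the Lipschitz estimates hold, which gives continuity at all their points. *)
Let r2 : R := r / 2.
Let r2_gt0 : 0 < r2. Proof. by rewrite divr_gt0 // (rr_gt0 rr). Qed.
Let r2_lt : r2 < r.
Proof. by rewrite /r2 ltr_pdivrMr // ltr_pMr ?(rr_gt0 rr) // ltr1n. Qed.

(* The initial state is prescribed, hence the radius 0. *)
Let KY (k : nat) : set 'rV[R]_(dim Q) :=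
  [set z | `|z - zb k| <= if k == 0%N then 0 else r2].
Let KX (i : 'I_m.+1) : set 'rV[R]_(dim (U i)) := [set w | `|w - wb i| <= r2].
Arguments KX : clear implicits.
Let KS (i : 'I_m.+1) : set 'rV[R]_(dim (U i)) := KX i `&` [set w | UU i (uv i w)].
Arguments KS : clear implicits.
Let f0 e (w : 'rV[R]_(dim (U ord0))) : R := phi0 e (uv ord0 w).
Let f e (j : 'I_m) (z : 'rV[R]_(dim Q)) (w : 'rV[R]_(dim (U (lift ord0 j)))) : R :=
  phi j e (yv j.+1 z, uv (lift ord0 j) w).
Arguments f : clear implicits.
Let fn e (z : 'rV[R]_(dim Q)) : R := phin e (yv m.+1 z).

Let KY_r2 k z : KY k z -> `|z - zb k| <= r2.
Proof. by move/le_trans; apply; case: ifP => // _; exact: ltW. Qed.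

Let ltr2 (x : R) : x <= r2 -> x < r.
Proof. by move=> xr; exact: le_lt_trans xr r2_lt. Qed.

Let inW (i : 'I_m.+1) z w : `|z - zb i| <= r2 -> `|w - wb i| <= r2 -> W i (row_mx z w).
Proof. by move=> /ltr2/ltW zr /ltr2/ltW wr; exact: (rr_W rr). Qed.

Let codm_uv (i : 'I_m.+1) w : `|w - wb i| <= r2 -> codm (ubar i) w.
Proof.
move=> wr; have : W i (row_mx (zb i) w).
  by apply: inW => //; rewrite subrr normr0 ltW.
by move/(rr_dom rr) => [].
Qed.

Let codm_yv k z : (k <= m.+1)%N -> `|z - zb k| <= r2 -> codm (q k) z.
Proof.
rewrite leq_eqVlt => /orP[/eqP -> zr|km zr]; first exact: (rr_codm rr (ltW (ltr2 zr))).
have : W (Ordinal km) (row_mx z (wb (Ordinal km))).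
  by apply: inW => //; rewrite subrr normr0 ltW.
by move/(rr_dom rr) => [].
Qed.

Let cKY k : compact (KY k). Proof. exact: closed_ball_rV_compact. Qed.

Let cKX i : compact (KX i). Proof. exact: closed_ball_rV_compact. Qed.

Let cKS i : compact (KS i).
Proof.
apply: compact_relclosed => // w wr NU.
have cu := riem_chinv_continuous (hU i) (codm_uv wr).
have : nbhs (uv i w) (~` UU i).
  by apply: open_nbhs_nbhs; split=> //; rewrite openC; exact: UU_closed.
exact: cu.
Qed.

Let SX i : KS i `<=` KX i. Proof. by move=> w []. Qed.

Let cf0 e w : KX ord0 w -> {for w, continuous (f0 e)}.
Proof.
move=> wr; apply: (lipschitz_continuous_at (c := wb ord0) (r := r) (L := L)) => //.
  by move=> z1 z2; exact: (rr_phi0 rr).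
exact: ltr2.
Qed.

Let cfn e z : KY m.+1 z -> {for z, continuous (fn e)}.
Proof.
move=> /KY_r2 zr; apply: (lipschitz_continuous_at (c := zb m.+1) (r := r) (L := L)) => //.
  by move=> z1 z2; exact: (rr_phin rr).
exact: ltr2.
Qed.

Let row_mx_continuous m' n' (z : 'rV[R]_m') (w : 'rV[R]_n') :
  {for (z, w), continuous (fun p => row_mx p.1 p.2)}.
Proof.
apply/cvgrPdist_le => e e0; near=> p; rewrite opp_row_mx add_row_mx.
apply: row_mx_norm_le.
  by near: p; apply: (cvgrPdist_le _ _).1 => //; exact: cvg_fst.
by near: p; apply: (cvgrPdist_le _ _).1 => //; exact: cvg_snd.
Unshelve. all: by end_near. Qed.

Let cf e (j : 'I_m) z w : KY j.+1 z -> KX (lift ord0 j) w ->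
  {for (z, w), continuous (fun p => f e j p.1 p.2)}.
Proof.
move=> /KY_r2 zr wr.
pose h (v : 'rV[R]_(dim Q + dim (U (lift ord0 j)))) := f e j (lsubmx v) (rsubmx v).
have -> : (fun p => f e j p.1 p.2) = h \o (fun p => row_mx p.1 p.2).
  by apply/funext => p; rewrite /h /= row_mxKl row_mxKr.
apply: continuous_comp; first exact: row_mx_continuous.
apply: (lipschitz_continuous_at (c := row_mx (zb j.+1) (wb (lift ord0 j)))
    (r := r) (L := L)) => /=.
  move=> v1 v2; rewrite -(hsubmxK v1) -(hsubmxK v2) => H1 H2.
  have nl (v : 'rV[R]_(dim Q + dim (U (lift ord0 j)))) : `|lsubmx v| <= `|v|.
    by apply: norm_le_coord => // a b; rewrite mxE coord_le_norm.
  have nr (v : 'rV[R]_(dim Q + dim (U (lift ord0 j)))) : `|rsubmx v| <= `|v|.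
    by apply: norm_le_coord => // a b; rewrite mxE coord_le_norm.
  rewrite !opp_row_mx !add_row_mx in H1 H2.
  rewrite /h !row_mxKl !row_mxKr; apply: (rr_phi rr).
  - by apply: le_trans H1; apply: le_trans (nl _); rewrite row_mxKl.
  - by apply: le_trans H2; apply: le_trans (nl _); rewrite row_mxKl.
  - by apply: le_trans H1; apply: le_trans (nr _); rewrite row_mxKr.
  - by apply: le_trans H2; apply: le_trans (nr _); rewrite row_mxKr.
by rewrite opp_row_mx add_row_mx ltr2 //; exact: row_mx_norm_le.
Qed.

Let dGh (i : 'I_m.+1) z w : `|z - zb i| <= r2 -> `|w - wb i| <= r2 ->
  differentiable (Gh i) (row_mx z w).
Proof. by move=> zr wr; apply: (rr_C1 rr i).1; exact: inW. Qed.

Let cG' (i : 'I_m.+1) z w : `|z - zb i| <= r2 -> `|w - wb i| <= r2 ->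
  {for (z, w), continuous (fun p => G i p.1 p.2)}.
Proof.
move=> zr wr; apply: (@continuous_comp _ _ _ (fun p => row_mx p.1 p.2) (Gh i)).
  exact: row_mx_continuous.
by apply: differentiable_continuous; exact: dGh.
Qed.

Let cG (i : 'I_m.+1) z w : KY i z -> KX i w ->
  {for (z, w), continuous (fun p => G i p.1 p.2)}.
Proof. by move=> /KY_r2; exact: cG'. Qed.

(* Along the minimizers, multiplier N y s i converges to the costate p_{i+1}. *)
Definition multiplier (N : R) (y : nat -> 'rV[R]_(dim Q))
    (s : forall i, 'rV[R]_(dim (U i))) (i : 'I_m.+1) : 'rV[R]_(dim Q) :=
  (2 * N) *: (y i.+1 - G i (y i) (s i)).

(** Optimality in the copy [x i] makes this the control part of a subgradient of the constraint
    function; its limits play the role of [b_i] in strict normality. *)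
Definition control_subgrad (N : R) (x s : forall i, 'rV[R]_(dim (U i))) i :
    'rV[R]_(dim (U i)) := - ((2 * N) *: (x i - s i)).

Definition stage_jacobian (y : nat -> 'rV[R]_(dim Q))
    (s : forall i, 'rV[R]_(dim (U i))) (i : 'I_m.+1) :
    'M[R]_(dim Q + dim (U i), dim Q) := jacobian (Gh i) (row_mx (y i) (s i)).

(** The costate equation [p_i = - a_i + D_qF_i^* p_{i+1}] solved for [a_i] with [i = j + 1]; the
    multiplier with index [i] stands for [p_{i+1}]. *)
Definition state_subgrad N y s (j : 'I_m) : 'rV[R]_(dim Q) :=
  - multiplier N y s (widen_ord (leqnSn m) j)
  + multiplier N y s (lift ord0 j) *m (usubmx (stage_jacobian y s (lift ord0 j)))^T.

Record stationary e (u : forall i, 'rV[R]_(dim (U i))) (N l : R)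
    (y : nat -> 'rV[R]_(dim Q)) (x s : forall i, 'rV[R]_(dim (U i))) : Prop := {
  st_initial : exists2 b, frechet_subdiff (EFin \o phi0 e) (uv ord0 (x ord0)) b &
    cot_coord (ubar ord0) (uv ord0 (x ord0)) b = control_subgrad N x s ord0 ;
  st_intermediate : forall j : 'I_m, exists a b,
    [/\ @frechet_subdiff R (prod2 Q (U (lift ord0 j))) (EFin \o phi j e)
         (yv j.+1 (y j.+1), uv (lift ord0 j) (x (lift ord0 j))) (row_mx a b),
      cot_coord (q j.+1) (yv j.+1 (y j.+1)) a = state_subgrad N y s j &
      cot_coord (ubar (lift ord0 j)) (uv (lift ord0 j) (x (lift ord0 j))) b =
        control_subgrad N x s (lift ord0 j)] ;
  st_terminal : exists2 a, frechet_subdiff (EFin \o phin e) (yv m.+1 (y m.+1)) a &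
    cot_coord (q m.+1) (yv m.+1 (y m.+1)) a = - multiplier N y s ord_max ;
  st_normal : forall i, exists2 p, frechet_subdiff (chi (UU i)) (uv i (s i)) p &
    cot_coord (ubar i) (uv i (s i)) p =
      - (control_subgrad N x s i
         - multiplier N y s i *m (dsubmx (stage_jacobian y s i))^T
         + (2 * l) *: (s i - u i)) }.

(** The strict inequalities keep the minimizer off the boundaries of the balls, so that each block
    can be varied freely, while the control constraint stays present through [chi]. The prescribed
    initial state is never varied. *)
Lemma minimizer_stationary e u N l y x s :
  @feasible R m _ _ KY KX KS y x s ->
  (forall y' x' s', @feasible R m _ _ KY KX KS y' x' s' ->
    penalized G (f0 e) (f e) (fn e) u N l y x s <=
    penalized G (f0 e) (f e) (fn e) u N l y' x' s') ->
  (forall k, (k <= m.+1)%N -> `|y k - zb k| < r2) ->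
  (forall i, `|x i - wb i| < r2) -> (forall i, `|s i - wb i| < r2) ->
  stationary e u N l y x s.
Proof.
move=> fyxs min ylt xlt slt.
have oX (i : 'I_m.+1) := @open_ball_rV R _ (wb i) r2.
have oY k := @open_ball_rV R _ (zb k) r2.
have KYlt k z : (0 < k)%N -> `|z - zb k| < r2 -> KY k z.
  by move=> k0 zr; rewrite /KY /= gtn_eqF // ltW.
have kB (i : 'I_m.+1) : Ck 1 [set w | `|w - wb i| < r2] (fun w => N * sq (w - s i) : R^o).
  by apply: (Ck1Z N (oX i)); exact: (Ck1_sq_subr (s i) (oX i)).
have gB (i : 'I_m.+1) : - grad (fun w => N * sq (w - s i) : R^o) (x i) = control_subgrad N x s i.
  rewrite gradZ; last exact: (Ck1_sq_subr (s i) openT).1.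
  by rewrite grad_sq_subr scalerA mulrC.
have cX (i : 'I_m.+1) : [set w | `|w - wb i| < r2] `<=` codm (ubar i).
  by move=> w wr; apply: codm_uv; exact: ltW.
have cY k : (k <= m.+1)%N -> [set z | `|z - zb k| < r2] `<=` codm (q k).
  by move=> km z zr; apply: codm_yv => //; exact: ltW.
have kGl (i : 'I_m.+1) : Ck 1 [set z | `|z - zb i| < r2] (fun z => G i z (s i)).
  apply: (Ck1_comp (B := W i) (oY i) _ _ (rr_C1 rr i)).
    by move=> z zr; apply: inW; exact: ltW.
  apply: (Ck1_row_mx (oY i)); [exact: Ck1_id|exact: Ck1_cst].
have kGr (i : 'I_m.+1) : Ck 1 [set w | `|w - wb i| < r2] (fun w => G i (y i) w).
  apply: (Ck1_comp (B := W i) (oX i) _ _ (rr_C1 rr i)).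
    move=> w wr; apply: inW; last exact: ltW.
    by apply/ltW/ylt; exact: ltnW.
  apply: (Ck1_row_mx (oX i)); [exact: Ck1_cst|exact: Ck1_id].
have dG (i : 'I_m.+1) : differentiable (Gh i) (row_mx (y i) (s i)).
  by apply: dGh; apply: ltW; [apply: ylt; exact: ltnW|exact: slt].
have nX (i : 'I_m.+1) w : `|w - wb i| < r2 -> \forall v \near w, `|v - wb i| < r2.
  by move=> wr; apply: open_nbhs_nbhs; split; [exact: oX|exact: wr].
have nY k z : `|z - zb k| < r2 -> \forall v \near z, `|v - zb k| < r2.
  by move=> zr; apply: open_nbhs_nbhs; split; [exact: oY|exact: zr].
split.
- have [|b fb cb] := frechet_subdiff_of_min (hU ord0) (x := ubar ord0)
    (f := EFin \o phi0 e) (z := x ord0) (oX ord0) (cX ord0) (xlt ord0) (kB ord0) isT.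
    apply: filterS (nX ord0 _ (xlt ord0)) => w wr; rewrite /= -!EFinD lee_fin.
    by apply: (minimizer_initial fyxs min); exact: ltW.
  by exists b => //; rewrite cb gB.
- move=> j; set i1 := lift ord0 j; set i0 := widen_ord (leqnSn m) j.
  have jm : (j < m.+1)%N := leqW (ltn_ord j).
  have k1 : Ck 1 [set z | `|z - zb j.+1| < r2] (fun z => N * sq (z - G i0 (y j) (s i0)) : R^o).
    by apply: (Ck1Z N (oY j.+1)); exact: (Ck1_sq_subr _ (oY j.+1)).
  have k2 : Ck 1 [set z | `|z - zb j.+1| < r2] (fun z => N * sq (y j.+2 - G i1 z (s i1)) : R^o).
    by apply: (Ck1Z N (oY j.+1)); exact: (Ck1_sq_subl (y j.+2) (oY j.+1) (kGl i1)).
  have k12 := Ck1D (oY j.+1) k1 k2.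
  have [|a [b [fab ca cb]]] := frechet_subdiff_of_min2 hQ (hU i1) (x := q j.+1) (y := ubar i1)
    (f := phi j e) (z1 := y j.+1) (z2 := x i1) (oY j.+1) (cY _ jm) (ylt _ jm) k12
    (oX i1) (cX i1) (xlt i1) (kB i1).
    have N1 : \forall p \near (y j.+1, x i1), `|p.1 - zb j.+1| < r2.
      exact: (cvg_fst (F := nbhs (y j.+1)) (G := nbhs (x i1)) (nY _ _ (ylt _ jm))).
    have N2 : \forall p \near (y j.+1, x i1), `|p.2 - wb i1| < r2.
      exact: (cvg_snd (F := nbhs (y j.+1)) (G := nbhs (x i1)) (nX _ _ (xlt i1))).
    apply: filterS2 N1 N2 => -[z w] /= zr wr.
    have := minimizer_intermediate fyxs min (KYlt _ _ (ltn0Sn j) zr) (ltW wr).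
    rewrite -/i0 -/i1 /f; lra.
  exists a, b; split=> //; last by rewrite cb gB.
  rewrite ca gradD; [|exact: (k1.1 _ (ylt _ jm))|exact: (k2.1 _ (ylt _ jm))].
  have ds : differentiable (fun z => sq (z - G i0 (y j) (s i0)) : R^o) (y j.+1).
    exact: (Ck1_sq_subr _ openT).1.
  have dg : differentiable (fun z => G i1 z (s i1)) (y j.+1) := (kGl i1).1 _ (ylt _ jm).
  have ds2 : differentiable (fun z => sq (y j.+2 - G i1 z (s i1)) : R^o) (y j.+1).
    exact: ((Ck1_sq_subl (y j.+2) (oY j.+1) (kGl i1)).1 _ (ylt _ jm)).
  rewrite (gradZ N ds) (gradZ N ds2) grad_sq_subr (grad_sq_subl _ dg).
  rewrite (jacobian_partiall (dG i1)) /state_subgrad /multiplier.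
  rewrite opprD scalerN opprK !scalerA -scalemxAl.
  by rewrite [N * 2]mulrC.
- have kT : Ck 1 [set z | `|z - zb m.+1| < r2]
      (fun z => N * sq (z - G ord_max (y m) (s ord_max)) : R^o).
    by apply: (Ck1Z N (oY m.+1)); exact: (Ck1_sq_subr _ (oY m.+1)).
  have [|a fa ca] := frechet_subdiff_of_min hQ (x := q m.+1)
    (f := EFin \o phin e) (z := y m.+1) (oY m.+1) (cY _ (leqnn _)) (ylt _ (leqnn _)) kT isT.
    apply: filterS (nY _ _ (ylt _ (leqnn _))) => z zr; rewrite /= -!EFinD lee_fin.
    exact: (minimizer_terminal fyxs min (KYlt _ _ (ltn0Sn m) zr)).
  exists a => //; rewrite ca gradZ; last exact: (Ck1_sq_subr _ openT).1.
  by rewrite grad_sq_subr scalerA mulrC.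
- move=> i.
  have Si : UU i (uv i (s i)) by have [_ _ /(_ i) []] := fyxs.
  have dG2 : differentiable (fun w => G i (y i) w) (s i) := (kGr i).1 _ (slt i).
  have k1 := Ck1Z N (oX i) (Ck1_sq_subl (x i) (oX i) (Ck1_id (V := 'rV[R]_(dim (U i))) _)).
  have k2 := Ck1Z N (oX i) (Ck1_sq_subl (y i.+1) (oX i) (kGr i)).
  have k3 := Ck1Z l (oX i) (Ck1_sq_subr (u i) (oX i)).
  have k12 := Ck1D (oX i) k1 k2.
  have k123 := Ck1D (oX i) k12 k3.
  have chi_s : chi (UU i) (uv i (s i)) = 0%E by rewrite /chi asboolT.
  have [||p fp cp] := frechet_subdiff_of_min (hU i) (x := ubar i)
    (f := chi (UU i)) (z := s i) (oX i) (cX i) (slt i) k123.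
  + by rewrite -/(uv i (s i)) chi_s.
  + apply: filterS (nX i _ (slt i)) => w wr; rewrite -/(uv i (s i)) chi_s add0e /chi.
    (* Outside the control set the right-hand side is infinite. *)
    case: ifPn => [/asboolP Sw|_]; last by rewrite addye // leey.
    rewrite add0e lee_fin.
    by apply: (minimizer_control fyxs min); split=> //; exact: ltW.
  exists p => //; rewrite cp; congr (- _).
  rewrite (gradD (k12.1 _ (slt i)) (k3.1 _ (slt i))) (gradD (k1.1 _ (slt i)) (k2.1 _ (slt i))).
  have d1 : differentiable (fun w => sq (x i - w) : R^o) (s i).
    exact: (Ck1_sq_subl (x i) openT (Ck1_id (V := 'rV[R]_(dim (U i))) _)).1.
  have d2 : differentiable (fun w => sq (y i.+1 - G i (y i) w) : R^o) (s i).
    exact: (Ck1_sq_subl (y i.+1) (oX i) (kGr i)).1 _ (slt i).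
  have d3 : differentiable (fun w => sq (w - u i) : R^o) (s i).
    exact: (Ck1_sq_subr (u i) openT).1.
  rewrite (gradZ N d1) (gradZ N d2) (gradZ l d3) grad_sq_subr.
  rewrite (grad_sq_subl _ (f := fun w => w)); last exact: ex_diff.
  rewrite (grad_sq_subl _ dG2) (jacobian_partialr (dG i)) jacobian_id trmx1 mulmx1.
  rewrite /control_subgrad /multiplier /stage_jacobian.
  by rewrite !scalerN !scalerA -scalemxAl ![_ * 2]mulrC.
Qed.

Let control_of (s : forall i, 'rV[R]_(dim (U i))) (i : 'I_m.+1) : U i := uv i (s i).

Lemma coord_state y s : y 0%N = zb 0%N ->
  (forall k, (k <= m.+1)%N -> `|y k - zb k| <= r2) ->
  (forall i, `|s i - wb i| <= r2) ->
  (forall i : 'I_m.+1, y i.+1 = G i (y i) (s i)) ->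
  forall k, (k <= m.+1)%N -> state F q0 (control_of s) k = yv k (y k).
Proof.
move=> y0 yr sr yG; elim=> [_|k IH km].
  by rewrite y0 /yv /zb chinv_self.
rewrite (stateS _ (Ordinal km)) /= IH; last exact: ltnW.
rewrite (yG (Ordinal km)) GE /yv riem_chartK //.
have := @inW (Ordinal km) (y k) (s (Ordinal km)) (yr _ (ltnW km)) (sr _).
by move/(rr_dom rr) => [].
Qed.

Lemma coord_penalty e y s : y 0%N = zb 0%N ->
  (forall k, (k <= m.+1)%N -> `|y k - zb k| <= r2) ->
  (forall i, `|s i - wb i| <= r2) ->
  (forall i : 'I_m.+1, y i.+1 = G i (y i) (s i)) ->
  penalty F q0 phi0 phi phin e (control_of s) = cost (f0 e) (f e) (fn e) y s.
Proof.
move=> y0 yr sr yG; have st := coord_state y0 yr sr yG.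
rewrite /penalty /cost st //; congr (_ + _); apply: eq_bigr => j _.
by rewrite /stage st //; exact: leqW (ltn_ord j).
Qed.

Lemma penalty_eq0_admissible e u : controls UU u ->
  penalty F q0 phi0 phi phin e u = 0 -> admissible F q0 UU phi0 phi phin e u.
Proof.
move=> Su /eqP; rewrite paddr_eq0 ?addr_ge0 ?sumr_ge0 // paddr_eq0 //.
move=> /andP[/andP[/eqP H0 /eqP Hn]]; rewrite psumr_eq0 // => /allP Hj.
split=> // j; apply/eqP; exact: (Hj j (mem_index_enum j)).
Qed.

Lemma penalty_ge0 e u : 0 <= penalty F q0 phi0 phi phin e u.
Proof. by rewrite !addr_ge0 // sumr_ge0. Qed.

(** The constants satisfy [l * rho ^+ 2 = P] and [l * rho = tau], so the gradient of the deviation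
    is at most [2 * tau]. In the maximum [tau], the first entry makes [rho] at most the square root
    of [P], and the second keeps the distance to an exact trajectory within [K * P]. *)
Lemma exists_penalized_minimizer e (u : forall i, U i) (ut : forall i, 'rV[R]_(dim (U i)))
    (yt : nat -> 'rV[R]_(dim Q)) (K : R)
    (P := penalty F q0 phi0 phi phin e u) :
  controls UU u -> u = control_of ut -> yt 0%N = zb 0%N ->
  (forall k, KY k (yt k)) -> (forall i, `|ut i - wb i| <= r2) ->
  (forall i : 'I_m.+1, yt i.+1 = G i (yt i) (ut i)) ->
  0 < P -> 0 < K ->
  ((K * P)%:E < @dist_set R (prodn U) (admissible F q0 UU phi0 phi phin e) u)%E ->
  exists (N l : R) (y : nat -> 'rV[R]_(dim Q)) (x s : forall i, 'rV[R]_(dim (U i))),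
    [/\ 1 <= N, @feasible R m _ _ KY KX KS y x s, 0 < cost (f0 e) (f e) (fn e) y x,
        N * defect G y x s <= P &
        [/\ forall y' x' s', @feasible R m _ _ KY KX KS y' x' s' ->
              penalized G (f0 e) (f e) (fn e) ut N l y x s <=
              penalized G (f0 e) (f e) (fn e) ut N l y' x' s',
            forall i, `|s i - ut i| <= Num.sqrt P &
            forall i, `|(2 * l) *: (s i - ut i)| <=
              2 * Num.max (Num.sqrt P) (C * m.+1%:R / K)]].
Proof.
move=> Su uE yt0 Kyt utr ytG P0 K0 dK.
have C0 := rr_C rr.
(* l is such that l * deviation <= P forces |s_i - ut_i| <= rho, where
   C (m+1) rho <= K P. *)
set tau := Num.max (Num.sqrt P) (C * m.+1%:R / K).
have tau0 : 0 < tau by rewrite lt_max sqrtr_gt0 P0.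
set rho := P / tau; have rho0 : 0 < rho by rewrite divr_gt0.
set l := tau ^+ 2 / P; have l0 : 0 < l by rewrite divr_gt0 // exprn_gt0.
have lrho : l * rho ^+ 2 = P.
  rewrite /l /rho expr_div_n; field.
  by rewrite !gt_eqF.
have dev_rho (s : forall i, 'rV[R]_(dim (U i))) : l * deviation ut s <= P ->
    forall i, `|s i - ut i| <= rho.
  rewrite -{1}lrho ler_pM2l // => dev i.
  rewrite -(ler_pXn2r (n := 2)) ?nnegrE ?(ltW rho0) //.
  apply: le_trans dev; rewrite /deviation (bigD1 i) //=.
  apply: (@le_trans _ _ (sq (s i - ut i))).
    rewrite -[leRHS]sqr_sqrtr ?sq_ge0 // lerXn2r ?nnegrE ?sqrtr_ge0 //.
    exact: norm_le_sqrt_sq.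
  by rewrite lerDl sumr_ge0 // => j _; exact: sq_ge0.
have KSut i : KS i (ut i).
  by split; [exact: utr|have := Su i; rewrite uE].
have PE : P = cost (f0 e) (f e) (fn e) yt ut.
  by rewrite /P uE; apply: coord_penalty => // k _; exact: KY_r2.
(* An exact trajectory of zero cost would be an admissible control at distance at most [K * P] from
   [u]. *)
have Hno y s : @feasible R m _ _ KY KX KS y s s ->
    l * deviation ut s <= cost (f0 e) (f e) (fn e) yt ut ->
    (forall i : 'I_m.+1, y i.+1 = G i (y i) (s i)) ->
    cost (f0 e) (f e) (fn e) y s <> 0.
  move=> [Ky Kx Ks]; rewrite -PE => dev yG c0.
  have y0 : y 0%N = zb 0%N.
    by have := Ky 0%N; rewrite /KY /= normr_le0 subr_eq0 => /eqP.
  have pen := coord_penalty e y0 (fun k _ => KY_r2 (Ky k)) Kx yG.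
  rewrite c0 in pen.
  have Sa : controls UU (control_of s) by move=> i; have [] := Ks i.
  have adm := penalty_eq0_admissible Sa pen.
  have : (@rdist R (prodn U) u (control_of s) <= (K * P)%:E)%E.
    rewrite uE; apply: le_trans (rr_dist rr _ _) _.
    - by move=> i; apply/ltW/ltr2; exact: utr.
    - by move=> i; apply/ltW/ltr2; exact: Kx.
    rewrite lee_fin; apply: (@le_trans _ _ (C * (m.+1%:R * rho))).
      rewrite ler_wpM2l ?(ltW C0) //.
      apply: (@le_trans _ _ (\sum_(i < m.+1) rho)).
        by apply: ler_sum => i _; rewrite distrC; exact: dev_rho.
      by rewrite sumr_const card_ord mulr_natl.
    have Ct : C * m.+1%:R <= tau * K by rewrite -ler_pdivrMr // le_max lexx orbT.
    rewrite mulrA; apply: (@le_trans _ _ (tau * K * rho)).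
      by rewrite ler_wpM2r // ltW.
    rewrite /rho le_eqVlt; apply/orP; left; apply/eqP; field.
    by rewrite gt_eqF.
  move=> H; have : (@dist_set R (prodn U) (admissible F q0 UU phi0 phi phin e) u <= (K * P)%:E)%E.
    by apply: le_trans H; apply: ereal_inf_lbound; exists (control_of s).
  by rewrite leNgt dK.
have [N [y [x [s [N1 fyxs cpos hg mn]]]]] := penalized_minimizer cKY cKX cKS SX
  (@cf0 e) (@cf e) (@cfn e) (@cG) (fun w => phi0_ge0 e _) (fun j z w => @phi_ge0 j e _) (fun z => phin_ge0 e _) l0 Kyt KSut ytG Hno.
rewrite -PE in hg.
have dl : l * deviation ut s <= P.
  by apply: le_trans hg; rewrite lerDl mulr_ge0 ?defect_ge0 // (le_trans ler01).
exists N, l, y, x, s; split=> //.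
  by apply: le_trans hg; rewrite lerDr mulr_ge0 ?deviation_ge0 // ltW.
split=> // i.
  apply: (le_trans (dev_rho _ dl i)); rewrite /rho ler_pdivrMr //.
  rewrite -{1}(sqr_sqrtr (ltW P0)) expr2 ler_wpM2l ?sqrtr_ge0 //.
  by rewrite le_max lexx.
have -> : `|(2 * l) *: (s i - ut i)| = 2 * (l * `|s i - ut i|).
  rewrite normrZ mulrA; congr (_ * _); apply: gtr0_norm.
  by rewrite mulr_gt0 // ltr0n.
rewrite ler_wpM2l //.
apply: (@le_trans _ _ (l * rho)); first by rewrite ler_wpM2l ?(ltW l0) //; exact: dev_rho.
rewrite /l /rho expr2 le_eqVlt; apply/orP; left; apply/eqP; field.
by rewrite !gt_eqF.
Qed.

Record stationary_sequence (ebar : E) (e : nat -> E) (N l : nat -> R)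
    (u : nat -> forall i, 'rV[R]_(dim (U i))) (y : nat -> nat -> 'rV[R]_(dim Q))
    (x s : nat -> forall i, 'rV[R]_(dim (U i))) : Prop := {
  ss_stationary : forall n, stationary (e n) (u n) (N n) (l n) (y n) (x n) (s n) ;
  ss_cost : forall n, 0 < cost (f0 (e n)) (f (e n)) (fn (e n)) (y n) (x n) ;
  ss_y_ball : forall n k, (k <= m.+1)%N -> `|y n k - zb k| <= r2 ;
  ss_x_ball : forall n i, `|x n i - wb i| <= r2 ;
  ss_s_ball : forall n i, `|s n i - wb i| <= r2 ;
  ss_e : e @ \oo --> ebar ;
  ss_y : forall k, (k <= m.+1)%N -> (fun n => y n k) @ \oo --> zb k ;
  ss_x : forall i, (fun n => x n i) @ \oo --> wb i ;
  ss_s : forall i, (fun n => s n i) @ \oo --> wb i ;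
  ss_l : forall i, (fun n => (2 * l n) *: (s n i - u n i)) @ \oo -->
    (0 : 'rV[R]_(dim (U i))) }.

(** * The sequence of penalized minimizers *)

Section Sequences.
Variables (ebar : E) (ek : nat -> E) (uk : nat -> forall i, U i).
Hypotheses (ek_cvg : ek @ \oo --> ebar)
  (uk_cvg : forall i, (fun n => uk n i) @ \oo --> ubar i)
  (uk_UU : forall n, controls UU (uk n)).

Let ut (n : nat) (i : 'I_m.+1) : 'rV[R]_(dim (U i)) := chart (ubar i) (uk n i).
(** Beyond the final state the default [zb k] keeps [yt n k] in [KY k], which [feasible] demands for
    every [k]. *)
Let yt (n : nat) (k : nat) : 'rV[R]_(dim Q) :=
  if (k <= m.+1)%N then chart (q k) (state F q0 (uk n) k) else zb k.
Let Pk (n : nat) : R := penalty F q0 phi0 phi phin (ek n) (uk n).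

Lemma near_uv i : \forall n \near \oo, uk n i = uv i (ut n i).
Proof.
have H : \forall n \near \oo, dom (ubar i) (uk n i).
  exact: (uk_cvg (near_dom (hU i) (riem_dom_self (hU i) _))).
by apply: filterS H => n d; rewrite /uv /ut riem_chartK.
Qed.

Lemma ut_cvg i : (fun n => ut n i) @ \oo --> wb i.
Proof.
have ci := riem_chart_continuous (hU i) (riem_dom_self (hU i) (ubar i)).
exact: (cvg_comp _ (chart (ubar i)) (@uk_cvg i) ci).
Qed.

Lemma near_cvg_ball (V : normedModType R) (v : nat -> V) (a : V) (d : R) : 0 < d ->
  v @ \oo --> a -> \forall n \near \oo, `|v n - a| < d.
Proof.
by move=> d0 /cvgrPdist_lt /(_ d d0); apply: filterS => n; rewrite distrC.
Qed.

Lemma G_cvg (i : 'I_m.+1) (z : nat -> 'rV[R]_(dim Q)) (w : nat -> 'rV[R]_(dim (U i))) :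
  z @ \oo --> zb i -> w @ \oo --> wb i -> (fun n => G i (z n) (w n)) @ \oo --> zb i.+1.
Proof.
move=> zc wc; rewrite -Gb.
have : {for (zb i, wb i), continuous (fun p => G i p.1 p.2)}.
  by apply: cG'; rewrite subrr normr0 ltW.
move=> cGi; exact: (cvg_comp (fun n => (z n, w n)) _ (cvg_pair zc wc) cGi).
Qed.

(** Both claims need one induction: coordinates represent a state only once it lies in the chart
    domain, and the next state lies there once the coordinates of the present state and control are
    close to their limits. *)
Lemma state_cvg k : (k <= m.+1)%N ->
  (\forall n \near \oo, dom (q k) (state F q0 (uk n) k)) /\
  (fun n => yt n k) @ \oo --> zb k.
Proof.
elim: k => [_|k IH km].
  split; last first.
    have -> : (fun n => yt n 0%N) = cst (zb 0%N) by apply/funext.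
    exact: cvg_cst.
  by apply: nearW => n; exact: riem_dom_self.
have [dk ck] := IH (ltnW km); pose i := Ordinal km.
have ci := @ut_cvg i.
have Nz := near_cvg_ball r2_gt0 ck; have Nw := near_cvg_ball r2_gt0 ci.
have N : \forall n \near \oo, dom (q k.+1) (state F q0 (uk n) k.+1) /\
    yt n k.+1 = G i (yt n k) (ut n i).
  have Ni := near_uv i.
  near=> n.
  have zr : `|yt n k - zb k| < r2 by near: n; exact: Nz.
  have wr : `|ut n i - wb i| < r2 by near: n; exact: Nw.
  have [_ _] := rr_dom rr (@inW i _ _ (ltW zr) (ltW wr)).
  have yE : yv k (yt n k) = state F q0 (uk n) k.
    by rewrite /yt (ltnW km) /yv riem_chartK //; near: n; exact: dk.
  have uE : uk n i = uv i (ut n i) by near: n; exact: Ni.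
  have sE : state F q0 (uk n) k.+1 = F i (yv i (yt n k), uv i (ut n i)).
    by rewrite (stateS _ i) -uE /= yE.
  by move=> d; rewrite GE /yt km sE.
split; first by apply: filterS N => n [].
have := @G_cvg i (fun n => yt n k) (fun n => ut n i) ck ci; apply: cvg_trans; apply: near_eq_cvg.
by apply: filterS N => n [_ ->].
Unshelve. all: by end_near. Qed.

Lemma near_recursion : \forall n \near \oo,
  [/\ uk n = control_of (ut n), forall k, KY k (yt n k), forall i, `|ut n i - wb i| <= r2 &
    forall i : 'I_m.+1, yt n i.+1 = G i (yt n i) (ut n i)].
Proof.
have N1 : \forall n \near \oo, forall i, uk n i = uv i (ut n i).
  exact: filter_forall near_uv.
have N2 : \forall n \near \oo, forall i, `|ut n i - wb i| < r2.
  by apply: filter_forall => i; exact: near_cvg_ball (@ut_cvg i).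
have N3 : \forall n \near \oo, forall k : 'I_m.+2, dom (q k) (state F q0 (uk n) k).
  by apply: filter_forall => k; have [] := @state_cvg k (ltn_ord k).
have N4 : \forall n \near \oo, forall k : 'I_m.+2, `|yt n k - zb k| < r2.
  by apply: filter_forall => k; apply: near_cvg_ball => //; have [] := @state_cvg k (ltn_ord k).
near=> n.
have E1 : forall i, uk n i = uv i (ut n i) by near: n; exact: N1.
have E2 : forall i, `|ut n i - wb i| < r2 by near: n; exact: N2.
have E3 : forall k : 'I_m.+2, dom (q k) (state F q0 (uk n) k) by near: n; exact: N3.
have E4 : forall k : 'I_m.+2, `|yt n k - zb k| < r2 by near: n; exact: N4.
split.
- by apply: functional_extensionality_dep => i; exact: E1.
- move=> k; rewrite /KY /=; case: ifPn => [/eqP ->|k0]; first by rewrite subrr normr0.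
  case: (leqP k m.+1) => km; first exact: ltW (E4 (Ordinal (km : (k < m.+2)%N))).
  by rewrite /yt leqNgt km subrr normr0 ltW.
- by move=> i; exact: ltW.
- move=> i; rewrite GE /yt (ltn_ord i) (ltnW (ltn_ord i)) stateS -E1 /yv riem_chartK //.
  exact: (E3 (widen_ord (leqnSn _) i)).
Unshelve. all: by end_near. Qed.

Lemma norm_sub_cvg0 (V : normedModType R) (v : nat -> V) (a : V) :
  v @ \oo --> a -> (fun n => `|v n - a|) @ \oo --> (0 : R).
Proof.
move=> /cvgrPdist_lt va; apply/cvgrPdist_lt => e e0; apply: filterS (va _ e0) => n.
by rewrite sub0r normrN normr_id distrC.
Qed.

Hypothesis pen0 : penalty F q0 phi0 phi phin ebar ubar = 0.
Hypothesis pen_cont :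
  {for ebar, continuous (fun e => penalty F q0 phi0 phi phin e ubar)}.

(** The Lipschitz constants are uniform in [e], so for the same parameter [ek n] the penalties at
    [uk n] and at [ubar] differ by a null sequence; continuity in [e] is then used at [ubar]
    alone. *)
Lemma penalty_cvg : Pk @ \oo --> (0 : R).
Proof.
pose D n := L * (`|ut n ord0 - wb ord0| + `|yt n m.+1 - zb m.+1| +
  \sum_(j < m) (`|yt n j.+1 - zb j.+1| + `|ut n (lift ord0 j) - wb (lift ord0 j)|)).
have L0 := rr_L rr.
have ubarE : control_of wb = ubar.
  by apply: functional_extensionality_dep => i; exact: chinv_self.
have r0 : 0 <= r2 by exact: ltW.
apply: (@cvg_of_norm_le R R^o _ (fun n => penalty F q0 phi0 phi phin (ek n) ubar) D).
- apply: filterS near_recursion => n [uE Ky Kx yG].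
  have yr k := KY_r2 (Ky k).
  have -> : Pk n = cost (f0 (ek n)) (f (ek n)) (fn (ek n)) (yt n) (ut n).
    by rewrite /Pk uE; apply: coord_penalty.
  have -> : penalty F q0 phi0 phi phin (ek n) ubar =
      cost (f0 (ek n)) (f (ek n)) (fn (ek n)) zb wb.
    have := @coord_penalty (ek n) zb wb erefl; rewrite ubarE; apply.
    - by move=> k _; rewrite subrr normr0.
    - by move=> i; rewrite subrr normr0.
    - by move=> i; rewrite Gb.
  have tri (a b a' b' : R) : `|(a + b) - (a' + b')| <= `|a - a'| + `|b - b'|.
    by rewrite opprD addrACA ler_normD.
  have yr' k : `|yt n k - zb k| <= r by exact/ltW/ltr2.
  have xr' i : `|ut n i - wb i| <= r by exact/ltW/ltr2.
  have zr' k : `|zb k - zb k| <= r by rewrite subrr normr0 ltW // (rr_gt0 rr).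
  have wr' i : `|wb i - wb i| <= r by rewrite subrr normr0 ltW // (rr_gt0 rr).
  rewrite /cost /D !mulrDr; apply: le_trans (tri _ _ _ _) _; apply: lerD.
    apply: le_trans (tri _ _ _ _) _; apply: lerD; first exact: (rr_phi0 rr).
    exact: (rr_phin rr).
  rewrite -sumrB mulr_sumr; apply: le_trans (ler_norm_sum _ _ _) _.
  apply: ler_sum => j _; 
  have H := @rr_phi _ _ _ _ rr j (ek n) _ _ _ _ (yr' j.+1) (zr' j.+1)
    (xr' (lift ord0 j)) (wr' (lift ord0 j)).
  apply: le_trans H _.
  rewrite ler_wpM2l // opp_row_mx add_row_mx; apply: row_mx_norm_le.
    by rewrite lerDl.
  by rewrite lerDr.
- have -> : (0 : R) = L * (0 + 0 + \sum_(j < m) (0 + 0)).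
    by rewrite big1 ?addr0 ?mulr0 // => j _; rewrite addr0.
  have ci i := norm_sub_cvg0 (@ut_cvg i).
  have cy k km := norm_sub_cvg0 (@state_cvg k km).2.
  apply: (@cvgM R); first exact: cvg_cst.
  apply: (@cvgD _ R^o); first by apply: (@cvgD _ R^o); [exact: ci|exact: cy].
  apply: (@sum_cvg R _ _ _ _ R^o) => j _.
  by apply: (@cvgD _ R^o); [apply: cy; exact: leqW (ltn_ord j)|exact: ci].
- by rewrite -pen0; exact: (cvg_comp ek _ ek_cvg pen_cont).
Qed.

Hypothesis far : forall n,
  ((n.+1%:R * Pk n)%:E <
     @dist_set R (prodn U) (admissible F q0 UU phi0 phi phin (ek n)) (uk n))%E.

(** With zero penalty [uk n] would itself be admissible, hence at distance 0 from the admissible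
    set, against [far]. *)
Lemma near_penalty_gt0 : \forall n \near \oo, 0 < Pk n.
Proof.
apply: filterS near_recursion => n [uE Ky Kx yG].
rewrite lt_neqAle penalty_ge0 andbT; apply/eqP => P0.
have := far n; rewrite -P0 mulr0 ltNge => /negP; apply.
apply: (@le_trans _ _ (@rdist R (prodn U) (uk n) (uk n))).
  apply: ereal_inf_lbound; exists (uk n) => //.
  by apply: penalty_eq0_admissible => //; exact: uk_UU.
have xr' i : `|ut n i - wb i| <= r by exact/ltW/ltr2.
rewrite uE; apply: le_trans (rr_dist rr xr' xr') _.
by rewrite big1 ?mulr0 // => i _; rewrite subrr normr0.
Qed.

Lemma exists_stationary_sequence :
  exists e N l u y x s, stationary_sequence ebar e N l u y x s.
Proof.
pose Good n := [/\ uk n = control_of (ut n), forall k, KY k (yt n k),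
  forall i, `|ut n i - wb i| <= r2,
  forall i : 'I_m.+1, yt n i.+1 = G i (yt n i) (ut n i) & 0 < Pk n].
have nGood : \forall n \near \oo, Good n.
  by apply: filterS2 near_recursion near_penalty_gt0 => n [].
have C0 := rr_C rr.
(* The data of one minimizer form a single tuple, so that one use of choice yields the whole
   sequence. *)
pose T := (R * R * (nat -> 'rV[R]_(dim Q)) * (forall i, 'rV[R]_(dim (U i))) *
  (forall i, 'rV[R]_(dim (U i))))%type.
(* Dominates the maximum in [exists_penalized_minimizer] for [K = n.+1], and tends to 0. *)
pose del n := Num.sqrt (Pk n) + C * m.+1%:R / n.+1%:R.
have sqP : (fun n => Num.sqrt (Pk n)) @ \oo --> (0 : R).
  by rewrite -{1}(sqrtr0 R); exact: (cvg_comp Pk _ penalty_cvg (@sqrt_continuous R 0)).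
have del0 : del @ \oo --> (0 : R).
  rewrite -[0]addr0 -{2}(mulr0 (C * m.+1%:R)).
  apply: (@cvgD _ R^o); first exact: sqP.
  by apply: (@cvgM R); [exact: cvg_cst|exact: cvg_harmonic].
have /choice [d Hd] n : exists d : T, Good n ->
    let: (N, l, y, x, s) := d in
    [/\ @feasible R m _ _ KY KX KS y x s, 0 < cost (f0 (ek n)) (f (ek n)) (fn (ek n)) y x,
      forall y' x' s', @feasible R m _ _ KY KX KS y' x' s' ->
        penalized G (f0 (ek n)) (f (ek n)) (fn (ek n)) (ut n) N l y x s <=
        penalized G (f0 (ek n)) (f (ek n)) (fn (ek n)) (ut n) N l y' x' s' &
      [/\ forall i, `|x i - s i| <= Num.sqrt (Pk n),
        forall i : 'I_m.+1, `|y i.+1 - G i (y i) (s i)| <= Num.sqrt (Pk n),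
        forall i, `|s i - ut n i| <= Num.sqrt (Pk n) &
        forall i, `|(2 * l) *: (s i - ut n i)| <= 2 * del n]].
  have [G1|nG] := pselect (Good n); last first.
    by exists (0, 0, yt n, ut n, ut n) => /nG.
  have [uE Ky Kx yG P0] := G1.
  have [N [l [y [x [s [N1 fyxs cpos hg [mn sP lP]]]]]]] :=
    exists_penalized_minimizer (yt := yt n) (@uk_UU n) uE erefl Ky Kx yG P0 (ltr0Sn _ n) (far n).
  exists (N, l, y, x, s) => _.
  have hg' : defect G y x s <= Pk n.
    by apply: le_trans hg; rewrite ler_peMl // defect_ge0.
  have [d1 d2] : \sum_(i < m.+1) sq (x i - s i) <= Pk n /\
      \sum_(i < m.+1) sq (y i.+1 - G i (y i) (s i)) <= Pk n.
    by split; apply: le_trans hg'; rewrite (lerDl, lerDr) sumr_ge0 // => i _; exact: sq_ge0.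
  have le1 (a : 'I_m.+1 -> R) i : (forall i, 0 <= a i) -> \sum_i a i <= Pk n -> a i <= Pk n.
    by move=> a0; apply: le_trans; rewrite (bigD1 i) //= lerDl sumr_ge0.
  split=> //; split.
  - move=> i; apply: le_trans (norm_le_sqrt_sq _) _; rewrite ler_sqrt ?(ltW P0) //.
    by apply: (le1 (fun i => sq (x i - s i))) => // j; exact: sq_ge0.
  - move=> i; apply: le_trans (norm_le_sqrt_sq _) _; rewrite ler_sqrt ?(ltW P0) //.
    by apply: (le1 (fun i : 'I_m.+1 => sq (y i.+1 - G i (y i) (s i)))) => // j; exact: sq_ge0.
  - exact: sP.
  - move=> i; apply: le_trans (lP i) _; rewrite ler_wpM2l ?ler0n // ge_max.
    by rewrite lerDl lerDr sqrtr_ge0 divr_ge0 // mulr_ge0 // ltW.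
pose N n := (d n).1.1.1.1; pose l n := (d n).1.1.1.2.
pose y n := (d n).1.1.2; pose x n := (d n).1.2; pose s n := (d n).2.
have {}Hd n : Good n ->
    [/\ @feasible R m _ _ KY KX KS (y n) (x n) (s n),
      0 < cost (f0 (ek n)) (f (ek n)) (fn (ek n)) (y n) (x n),
      forall y' x' s', @feasible R m _ _ KY KX KS y' x' s' ->
        penalized G (f0 (ek n)) (f (ek n)) (fn (ek n)) (ut n) (N n) (l n) (y n) (x n) (s n) <=
        penalized G (f0 (ek n)) (f (ek n)) (fn (ek n)) (ut n) (N n) (l n) y' x' s' &
      [/\ forall i, `|x n i - s n i| <= Num.sqrt (Pk n),
        forall i : 'I_m.+1, `|y n i.+1 - G i (y n i) (s n i)| <= Num.sqrt (Pk n),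
        forall i, `|s n i - ut n i| <= Num.sqrt (Pk n) &
        forall i, `|(2 * l n) *: (s n i - ut n i)| <= 2 * del n]].
  by move/Hd; rewrite /N /l /y /x /s; case: (d n) => -[[[? ?] ?] ?] ?.
have cs i : (fun n => s n i) @ \oo --> wb i.
  apply: (cvg_of_norm_le (v := fun n => ut n i) (d := fun n => Num.sqrt (Pk n))) => //.
    by apply: filterS nGood => n /Hd [_ _ _ [_ _ H _]]; exact: H.
  exact: ut_cvg.
have cx i : (fun n => x n i) @ \oo --> wb i.
  apply: (cvg_of_norm_le (v := fun n => s n i) (d := fun n => Num.sqrt (Pk n))) => //.
    by apply: filterS nGood => n /Hd [_ _ _ [H _ _ _]]; exact: H.
  exact: cs.
have cy k : (k <= m.+1)%N -> (fun n => y n k) @ \oo --> zb k.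
  (* The initial state is pinned by [KY 0]; afterwards [y n k.+1] is within the square root of the
     penalty of the image of [y n k] and [s n i]. *)
  elim: k => [_|k IH km].
    apply: (cvg_of_norm_le (v := fun _ => zb 0%N) (d := fun _ => 0)).
    - by apply: filterS nGood => n /Hd [[H _ _] _ _ _]; exact: (H 0%N).
    - exact: cvg_cst.
    - exact: cvg_cst.
  pose i := Ordinal km.
  apply: (cvg_of_norm_le (v := fun n => G i (y n k) (s n i)) (d := fun n => Num.sqrt (Pk n))) => //.
    by apply: filterS nGood => n /Hd [_ _ _ [_ H _ _]]; exact: (H i).
  by apply: (@G_cvg i) => //; exact: IH (ltnW km).
have cl i : (fun n => (2 * l n) *: (s n i - ut n i)) @ \oo --> (0 : 'rV[R]_(dim (U i))).
  apply: (cvg_of_norm_le (v := fun _ => 0) (d := fun n => 2 * del n)).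
  - by apply: filterS nGood => n /Hd [_ _ _ [_ _ _ H]]; rewrite subr0; exact: H.
  - by rewrite -(mulr0 2); apply: (@cvgM R); [exact: cvg_cst|exact: del0].
  - exact: cvg_cst.
have nY : \forall n \near \oo, forall k : 'I_m.+2, `|y n k - zb k| < r2.
  by apply: filter_forall => k; apply: near_cvg_ball => //; exact: (@cy k (ltn_ord k)).
have nX : \forall n \near \oo, forall i, `|x n i - wb i| < r2.
  by apply: filter_forall => i; apply: near_cvg_ball => //; exact: cx.
have nS : \forall n \near \oo, forall i, `|s n i - wb i| < r2.
  by apply: filter_forall => i; apply: near_cvg_ball => //; exact: cs.
(* The first [n0] terms are dropped, so that all properties hold for every index. *)
have [n0 _ Hn] := filterI (filterI nGood nY) (filterI nX nS).
pose sh n := (n + n0)%N.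
have hsh : {homo sh : a b / (a < b)%N} by move=> a b; rewrite /sh ltn_add2r.
have {}Hn n : [/\ Good (sh n), forall k : 'I_m.+2, `|y (sh n) k - zb k| < r2,
    forall i, `|x (sh n) i - wb i| < r2 & forall i, `|s (sh n) i - wb i| < r2].
  by have [|[? ?] [? ?]] := Hn (sh n); [rewrite /= leq_addl|split].
exists (ek \o sh), (N \o sh), (l \o sh), (ut \o sh), (y \o sh), (x \o sh), (s \o sh); split.
- move=> n; have [/Hd [fyxs _ mn _] yr xr sr] := Hn n.
  apply: minimizer_stationary fyxs mn _ xr sr => k km.
  exact: (yr (Ordinal (km : (k < m.+2)%N))).
- by move=> n; have [/Hd []] := Hn n.
- move=> n k km; have [_ yr _ _] := Hn n; apply: ltW.
  exact: (yr (Ordinal (km : (k < m.+2)%N))).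
- by move=> n i; have [_ _ xr _] := Hn n; exact: ltW.
- by move=> n i; have [_ _ _ sr] := Hn n; exact: ltW.
- exact: cvg_subseq ek_cvg.
- by move=> k km; exact: cvg_subseq (cy k km).
- by move=> i; exact: cvg_subseq (cx i).
- by move=> i; exact: cvg_subseq (cs i).
- by move=> i; exact: cvg_subseq (cl i).
Qed.

End Sequences.

(** * Passage to the limit in the first-order conditions *)

Section Contradiction.
Variables (ebar : E) (e : nat -> E) (N l : nat -> R)
  (u : nat -> forall i, 'rV[R]_(dim (U i))) (y : nat -> nat -> 'rV[R]_(dim Q))
  (x s : nat -> forall i, 'rV[R]_(dim (U i))).
Hypothesis ss : stationary_sequence ebar e N l u y x s.
Hypotheses (ubar_UU : controls UU ubar) (UU_regular : forall i, clarke_regular (UU i))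
  (phi_reg : regular_along F q0 phi0 phi phin ebar ubar)
  (ubar_normal : strictly_normal F q0 UU phi0 phi phin ebar ubar).

Let M n i := multiplier (N n) (y n) (s n) i.
Let B n i := control_subgrad (N n) (x n) (s n) i.
Let A n j := state_subgrad (N n) (y n) (s n) j.
Let J (i : 'I_m.+1) := jacobian (Gh i) (row_mx (zb i) (wb i)).

Lemma stage_jacobian_cvg i : (fun n => stage_jacobian (y n) (s n) i) @ \oo --> J i.
Proof.
have Wb : W i (row_mx (zb i) (wb i)) by apply: inW; rewrite subrr normr0 ltW.
have cJ : {for row_mx (zb i) (wb i), continuous (jacobian (Gh i))}.
  exact: (@jacobian_continuous R _ _ (W i) (Gh i) _ (@rr_open _ _ _ _ rr i) Wb (rr_C1 rr i)).
have cyi : (fun n => y n i) @ \oo --> zb i by apply: (ss_y ss); exact: ltnW.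
have cp : (fun n => (y n i, s n i)) @ \oo --> (zb i, wb i).
  exact: cvg_pair cyi (ss_s ss (i := i)).
have cr := cvg_comp (fun n => (y n i, s n i)) (fun p => row_mx p.1 p.2) cp
  (@row_mx_continuous _ _ (zb i) (wb i)).
exact: (cvg_comp (fun n => row_mx (y n i) (s n i)) _ cr cJ).
Qed.

Lemma uv_cvg i (w : nat -> 'rV[R]_(dim (U i))) : w @ \oo --> wb i ->
  (fun n => uv i (w n)) @ \oo --> ubar i.
Proof.
move=> wc; have cu := riem_chinv_continuous (hU i) (chart_self (hU i) (ubar i)).
have := cvg_comp w (uv i) wc cu.
by rewrite /uv chinv_self.
Qed.

Lemma yv_cvg k (z : nat -> 'rV[R]_(dim Q)) : z @ \oo --> zb k ->
  (fun n => yv k (z n)) @ \oo --> q k.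
Proof.
move=> zc; have cu := riem_chinv_continuous hQ (chart_self hQ (q k)).
have := cvg_comp z (yv k) zc cu.
by rewrite /yv chinv_self.
Qed.

(** * Limits along an arbitrary subsequence, for use in successive extractions *)

Section Subsequence.
Variable sg : nat -> nat.
Hypothesis hsg : {homo sg : a b / (a < b)%N}.

Let e_cvg : (e \o sg) @ \oo --> ebar. Proof. exact: cvg_subseq (ss_e ss). Qed.

Let x_cvg i : (fun n => x (sg n) i) @ \oo --> wb i.
Proof. exact: (cvg_subseq hsg (ss_x ss (i := i))). Qed.

Let y_cvg k : (k <= m.+1)%N -> (fun n => y (sg n) k) @ \oo --> zb k.
Proof. by move=> km; exact: (cvg_subseq hsg (ss_y ss km)). Qed.

Let s_cvg i : (fun n => s (sg n) i) @ \oo --> wb i.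
Proof. exact: (cvg_subseq hsg (ss_s ss (i := i))). Qed.

Let cyx (j : 'I_m) : (fun n => (yv j.+1 (y (sg n) j.+1), uv (lift ord0 j) (x (sg n) (lift ord0 j))))
  @ \oo --> (q j.+1, ubar (lift ord0 j)).
Proof.
apply: cvg_pair; last by apply: uv_cvg; exact: x_cvg.
by apply: yv_cvg; apply: y_cvg; exact: leqW (ltn_ord j).
Qed.

Let subgrad0 n b :=
  frechet_subdiff (EFin \o phi0 (e (sg n))) (uv ord0 (x (sg n) ord0)) b /\
  cot_coord (ubar ord0) (uv ord0 (x (sg n) ord0)) b = B (sg n) ord0.

Let subgradn n a :=
  frechet_subdiff (EFin \o phin (e (sg n))) (yv m.+1 (y (sg n) m.+1)) a /\
  cot_coord (q m.+1) (yv m.+1 (y (sg n) m.+1)) a = - M (sg n) ord_max.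

Let subgradj (j : 'I_m) n p :=
  @frechet_subdiff R (prod2 Q (U (lift ord0 j))) (EFin \o phi j (e (sg n)))
    (yv j.+1 (y (sg n) j.+1), uv (lift ord0 j) (x (sg n) (lift ord0 j))) p /\
  @cot_coord R (prod2 Q (U (lift ord0 j))) (q j.+1, ubar (lift ord0 j))
    (yv j.+1 (y (sg n) j.+1), uv (lift ord0 j) (x (sg n) (lift ord0 j))) p =
  row_mx (A (sg n) j) (B (sg n) (lift ord0 j)).

Arguments subgradj : clear implicits.

Let choose_initial : exists p, forall n, subgrad0 n (p n).
Proof.
have /choice [p Hp] n : exists b, subgrad0 n b; last by exists p.
by have [b fb cb] := st_initial (ss_stationary ss (sg n)); exists b.
Qed.

Let choose_terminal : exists p, forall n, subgradn n (p n).
Proof.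
have /choice [p Hp] n : exists b, subgradn n b; last by exists p.
by have [b fb cb] := st_terminal (ss_stationary ss (sg n)); exists b.
Qed.

Let choose_intermediate (j : 'I_m) : exists p, forall n, subgradj j n (p n).
Proof.
have /choice [p Hp] n : exists b, subgradj j n b; last by exists p.
have [a [b [fab ca cb]]] := st_intermediate (ss_stationary ss (sg n)) j.
exists (row_mx a b); split=> //.
have jm : (j.+1 <= m.+1)%N := leqW (ltn_ord j).
rewrite cot_coord_prod2 ?ca ?cb //.
- by apply: dom_chinv => //; apply: codm_yv => //; exact: (ss_y_ball ss).
- by apply: dom_chinv => //; apply: codm_uv; exact: (ss_x_ball ss).
Qed.

Lemma initial_limit : exists (t : nat -> nat) p, [/\ {homo t : a b / (a < b)%N},
  subdiffL (phi0 ebar) (ubar ord0) p & (fun n => B (sg (t n)) ord0) @ \oo --> p].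
Proof.
have [p Hp] := choose_initial; have [reg _ _] := phi_reg.
have [t [p0 [ht sp cp]]] := phi_regular_subseq
  (fun z v => cot_coord_self z v (hU ord0)) reg e_cvg (uv_cvg (@x_cvg ord0))
  (fun n => (Hp n).1).
exists t, p0; split=> //.
suff -> : (fun n => B (sg (t n)) ord0) = (fun n => cot_coord (ubar ord0)
  (uv ord0 (x (sg (t n)) ord0)) (p (t n))) by exact: cp.
by apply/funext => n; rewrite (Hp (t n)).2.
Qed.

Lemma terminal_limit : exists (t : nat -> nat) p, [/\ {homo t : a b / (a < b)%N},
  subdiffL (phin ebar) (q m.+1) p & (fun n => - M (sg (t n)) ord_max) @ \oo --> p].
Proof.
have [p Hp] := choose_terminal; have [_ _ reg] := phi_reg.
have [t [p0 [ht sp cp]]] := phi_regular_subseq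
  (fun z v => cot_coord_self z v hQ) reg e_cvg (yv_cvg (y_cvg (leqnn m.+1)))
  (fun n => (Hp n).1).
exists t, p0; split=> //.
suff -> : (fun n => - M (sg (t n)) ord_max) = (fun n => cot_coord (q m.+1)
  (yv m.+1 (y (sg (t n)) m.+1)) (p (t n))) by exact: cp.
by apply/funext => n; rewrite (Hp (t n)).2.
Qed.

Lemma intermediate_limit (j : 'I_m) : exists (t : nat -> nat) a b,
  [/\ {homo t : a b / (a < b)%N},
    subdiffL (phi j ebar) (stage F q0 ubar (lift ord0 j)) (row_mx a b),
    (fun n => A (sg (t n)) j) @ \oo --> a &
    (fun n => B (sg (t n)) (lift ord0 j)) @ \oo --> b].
Proof.
have [p Hp] := @choose_intermediate j; have [_ reg _] := phi_reg.
have [t [p0 [ht sp cp]]] := phi_regular_subseq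
  (cot_coord_self_prod2 hQ (hU _)) (reg j) e_cvg (@cyx j) (fun n => (Hp n).1).
have {}cp : (fun n => row_mx (A (sg (t n)) j) (B (sg (t n)) (lift ord0 j))) @ \oo --> p0.
  suff -> : (fun n => row_mx (A (sg (t n)) j) (B (sg (t n)) (lift ord0 j))) =
    (fun n => @cot_coord R (prod2 Q (U (lift ord0 j))) (q j.+1, ubar (lift ord0 j))
      (yv j.+1 (y (sg (t n)) j.+1), uv (lift ord0 j) (x (sg (t n)) (lift ord0 j)))
      (p (t n))) by exact: cp.
  by apply/funext => n; rewrite (Hp (t n)).2.
exists t, (lsubmx p0), (rsubmx p0); split=> //; first by rewrite hsubmxK.
- suff -> : (fun n => A (sg (t n)) j) =
      (fun n => lsubmx (row_mx (A (sg (t n)) j) (B (sg (t n)) (lift ord0 j)))).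
    exact: (cvg_linear_mx (f := @lsubmx R 1 (dim Q) (dim (U (lift ord0 j)))) cp).
  by apply/funext => n; rewrite row_mxKl.
- suff -> : (fun n => B (sg (t n)) (lift ord0 j)) =
      (fun n => rsubmx (row_mx (A (sg (t n)) j) (B (sg (t n)) (lift ord0 j)))).
    exact: (cvg_linear_mx (f := @rsubmx R 1 (dim Q) (dim (U (lift ord0 j)))) cp).
  by apply/funext => n; rewrite row_mxKr.
Qed.

Lemma initial_slope : (fun n => B (sg n) ord0) @ \oo --> (0 : 'rV[R]_(dim (U ord0))) ->
  \forall n \near \oo, ~ 0 < phi0 (e (sg n)) (uv ord0 (x (sg n) ord0)).
Proof.
move=> cB0; have [p Hp] := choose_initial; have [reg _ _] := phi_reg.
have hX := hU ord0.
have H := phi_regular_slope (fun z v => cot_coord_self z v hX) reg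
  (riemannian_short_curves _ hX) (riemannian_cotangent_bound _ hX) (chinv_self hX _)
  (riem_chinv_continuous hX (chart_self hX _)) e_cvg (@x_cvg ord0) (fun n => (Hp n).1).
suff cp : (fun n => cot_coord (ubar ord0) (uv ord0 (x (sg n) ord0)) (p n)) @ \oo -->
  (0 : 'rV[R]_(dim (U ord0))) by exact: (H cp).
suff -> : (fun n => cot_coord (ubar ord0) (uv ord0 (x (sg n) ord0)) (p n)) =
  (fun n => B (sg n) ord0) by exact: cB0.
by apply/funext => n; rewrite (Hp n).2.
Qed.

Lemma terminal_slope : (fun n => - M (sg n) ord_max) @ \oo --> (0 : 'rV[R]_(dim Q)) ->
  \forall n \near \oo, ~ 0 < phin (e (sg n)) (yv m.+1 (y (sg n) m.+1)).
Proof.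
move=> cM0; have [p Hp] := choose_terminal; have [_ _ reg] := phi_reg.
have H := phi_regular_slope (fun z v => cot_coord_self z v hQ) reg
  (riemannian_short_curves _ hQ) (riemannian_cotangent_bound _ hQ) (chinv_self hQ _)
  (riem_chinv_continuous hQ (chart_self hQ _)) e_cvg (y_cvg (leqnn m.+1)) (fun n => (Hp n).1).
suff cp : (fun n => cot_coord (q m.+1) (yv m.+1 (y (sg n) m.+1)) (p n)) @ \oo -->
  (0 : 'rV[R]_(dim Q)) by exact: (H cp).
suff -> : (fun n => cot_coord (q m.+1) (yv m.+1 (y (sg n) m.+1)) (p n)) =
  (fun n => - M (sg n) ord_max) by exact: cM0.
by apply/funext => n; rewrite (Hp n).2.
Qed.

Lemma intermediate_slope (j : 'I_m) :
  (fun n => A (sg n) j) @ \oo --> (0 : 'rV[R]_(dim Q)) ->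
  (fun n => B (sg n) (lift ord0 j)) @ \oo --> (0 : 'rV[R]_(dim (U (lift ord0 j)))) ->
  \forall n \near \oo, ~ 0 < phi j (e (sg n))
    (yv j.+1 (y (sg n) j.+1), uv (lift ord0 j) (x (sg n) (lift ord0 j))).
Proof.
move=> cA0 cB0; have [p Hp] := @choose_intermediate j; have [_ reg _] := phi_reg.
have hX := hU (lift ord0 j).
have rowc (V1 V2 : nat) (a : nat -> 'rV[R]_V1) (b : nat -> 'rV[R]_V2)
    (a0 : 'rV[R]_V1) (b0 : 'rV[R]_V2) :
    a @ \oo --> a0 -> b @ \oo --> b0 -> (fun n => row_mx (a n) (b n)) @ \oo --> row_mx a0 b0.
  move=> ca cb; exact: (cvg_comp (fun n => (a n, b n)) (fun p => row_mx p.1 p.2)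
    (cvg_pair ca cb) (@row_mx_continuous _ _ a0 b0)).
have cz := rowc _ _ _ _ _ _ (@y_cvg j.+1 (leqW (ltn_ord j))) (@x_cvg (lift ord0 j)).
have H := @phi_regular_slope R E (prod2 Q (U (lift ord0 j))) (phi j) ebar
  (q j.+1, ubar (lift ord0 j)) (e \o sg)
  (fun n => row_mx (y (sg n) j.+1) (x (sg n) (lift ord0 j))) p
  (cot_coord_self_prod2 hQ hX) (reg j)
  (short_curves_prod2 hQ hX (riemannian_short_curves _ hQ) (riemannian_short_curves _ hX))
  (cotangent_bound_prod2 hQ hX (riemannian_cotangent_bound _ hQ) (riemannian_cotangent_bound _ hX))
  (chinv_self_prod2 hQ hX _) (@chinv_continuous_prod2 _ _ _ hQ hX _) e_cvg cz.
have zE n : @chinv R (prod2 Q (U (lift ord0 j))) (q j.+1, ubar (lift ord0 j))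
    (row_mx (y (sg n) j.+1) (x (sg n) (lift ord0 j))) =
    (yv j.+1 (y (sg n) j.+1), uv (lift ord0 j) (x (sg n) (lift ord0 j))).
  by rewrite /= row_mxKl row_mxKr.
have {}H : \forall n \near \oo, ~ 0 < phi j ((e \o sg) n)
    (@chinv R (prod2 Q (U (lift ord0 j))) (q j.+1, ubar (lift ord0 j))
    (row_mx (y (sg n) j.+1) (x (sg n) (lift ord0 j)))).
  apply: H => [n|]; first by rewrite zE; exact: (Hp n).1.
  suff -> : (fun n => @cot_coord R (prod2 Q (U (lift ord0 j))) (q j.+1, ubar (lift ord0 j))
      (@chinv R (prod2 Q (U (lift ord0 j))) (q j.+1, ubar (lift ord0 j))
      (row_mx (y (sg n) j.+1) (x (sg n) (lift ord0 j)))) (p n)) =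
    (fun n => row_mx (A (sg n) j) (B (sg n) (lift ord0 j))).
    by rewrite -[0](@row_mx0 R 1 (dim Q) (dim (U (lift ord0 j)))); exact: rowc.
  by apply/funext => n; rewrite zE; exact: (Hp n).2.
by apply: filterS H => n; rewrite zE.
Qed.

(** The gradient of the deviation tends to 0 by [ss_l], so [- b] is a limit of normals to the
    control set. *)
Lemma normal_limit (i : 'I_m.+1) b v :
  (fun n => B (sg n) i - M (sg n) i *m (dsubmx (stage_jacobian (y (sg n)) (s (sg n)) i))^T)
    @ \oo --> (b : 'rV[R]_(dim (U i))) ->
  clarke_tangent (UU i) (ubar i) v -> 0 <= pairing b v.
Proof.
move=> cb Tv.
pose nrm n p := frechet_subdiff (chi (UU i)) (uv i (s (sg n) i)) p /\
  cot_coord (ubar i) (uv i (s (sg n) i)) p =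
    - (B (sg n) i - M (sg n) i *m (dsubmx (stage_jacobian (y (sg n)) (s (sg n)) i))^T
       + (2 * l (sg n)) *: (s (sg n) i - u (sg n) i)).
have /choice [p Hp] n : exists p, nrm n p.
  by have [p fp cp] := st_normal (ss_stationary ss (sg n)) i; exists p.
rewrite -oppr_le0 -pairingNl.
apply: (clarke_normal_limit (hU i) (UU_regular (i := i)) (ubar_UU i) _ (@s_cvg i)
  (fun n => (Hp n).1)) Tv.
  by move=> n; apply: codm_uv; exact: (ss_s_ball ss).
suff -> : (fun n => cot_coord (ubar i) (uv i (s (sg n) i)) (p n)) = (fun n =>
    - (B (sg n) i - M (sg n) i *m (dsubmx (stage_jacobian (y (sg n)) (s (sg n)) i))^T
       + (2 * l (sg n)) *: (s (sg n) i - u (sg n) i))).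
  apply: cvgN; rewrite -[b]addr0; apply: cvgD; first exact: cb.
  exact: (cvg_subseq hsg (ss_l ss (i := i))).
by apply/funext => n; exact: (Hp n).2.
Qed.

End Subsequence.

Let Ju i := (usubmx (J i))^T.
Let Jd i := (dsubmx (J i))^T.

Lemma stage_jacobianu_cvg i :
  (fun n => (usubmx (stage_jacobian (y n) (s n) i))^T) @ \oo --> Ju i.
Proof.
have c1 := cvg_linear_mx (f := @usubmx R (dim Q) (dim (U i)) (dim Q)) (@stage_jacobian_cvg i).
exact: (cvg_linear_mx (f := @trmx R (dim Q) (dim Q)) c1).
Qed.

Lemma stage_jacobiand_cvg i :
  (fun n => (dsubmx (stage_jacobian (y n) (s n) i))^T) @ \oo --> Jd i.
Proof.
have c1 := cvg_linear_mx (f := @dsubmx R (dim Q) (dim (U i)) (dim Q)) (@stage_jacobian_cvg i).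
exact: (cvg_linear_mx (f := @trmx R (dim (U i)) (dim Q)) c1).
Qed.

(** Regularity makes subgradients converge, not multipliers. The last multiplier is minus a
    subgradient, and each earlier one is recovered from the next one and from [A], whose limit is
    known. *)
Lemma critical_limits : exists (sg : nat -> nat) (p : 'I_m.+1 -> 'rV[R]_(dim Q))
    (b : forall i, 'rV[R]_(dim (U i))),
  [/\ {homo sg : i j / (i < j)%N},
    forall i, (fun n => M (sg n) i) @ \oo --> p i,
    forall i, (fun n => B (sg n) i) @ \oo --> b i,
    subdiffL (phi0 ebar) (ubar ord0) (b ord0) &
    (forall j : 'I_m, subdiffL (phi j ebar) (stage F q0 ubar (lift ord0 j))
      (row_mx (- p (widen_ord (leqnSn m) j) + p (lift ord0 j) *m Ju (lift ord0 j))
        (b (lift ord0 j)))) /\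
    subdiffL (phin ebar) (q m.+1) (- p ord_max)].
Proof.
(* Indexed by [nat] to fit [common_subsequence], and vacuous for [k >= m]. *)
pose D k sg := forall j : 'I_m, j = k :> nat -> 
  exists (a : 'rV[R]_(dim Q)) (b : 'rV[R]_(dim (U (lift ord0 j)))),
  [/\ subdiffL (phi j ebar) (stage F q0 ubar (lift ord0 j)) (row_mx a b),
    (fun n => A (sg n) j) @ \oo --> a & (fun n => B (sg n) (lift ord0 j)) @ \oo --> b].
have herD k sg t : D k sg -> {homo t : i j / (i < j)%N} -> D k (sg \o t).
  move=> Dk ht j jk; have [a [b [sab ca cb]]] := Dk j jk; exists a, b; split.
  - exact: sab.
  - exact: (cvg_subseq (u := fun n => A (sg n) j) ht ca).
  - exact: (cvg_subseq (u := fun n => B (sg n) (lift ord0 j)) ht cb).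
have extD k sg : {homo sg : i j / (i < j)%N} ->
    exists2 t, {homo t : i j / (i < j)%N} & D k (sg \o t).
  move=> hsg; case: (ltnP k m) => km; last first.
    by exists id => // j jk; move: km; rewrite -jk leqNgt ltn_ord.
  have [t [a [b [ht sab ca cb]]]] := intermediate_limit hsg (Ordinal km).
  exists t => // j jk; have -> : j = Ordinal km by exact: val_inj.
  by exists a, b.
have [sg1 h1 D1] := common_subsequence herD extD m.
have [t1 [b0 [ht1 sb0 cb0]]] := initial_limit h1.
have h2 : {homo sg1 \o t1 : i j / (i < j)%N} by move=> i j /ht1 /h1.
have [t2 [pn [ht2 spn cpn]]] := terminal_limit h2.
pose sg := sg1 \o t1 \o t2.
have hsg : {homo sg : i j / (i < j)%N} by move=> i j /ht2 /h2.
have {}cb0 : (fun n => B (sg n) ord0) @ \oo --> b0.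
  exact: (cvg_subseq (u := fun n => B (sg1 (t1 n)) ord0) ht2 cb0).
have Cj (j : 'I_m) : exists a b,
    [/\ subdiffL (phi j ebar) (stage F q0 ubar (lift ord0 j)) (row_mx a b),
    (fun n => A (sg n) j) @ \oo --> a & (fun n => B (sg n) (lift ord0 j)) @ \oo --> b].
  by apply: (herD _ _ _ (herD _ _ _ (D1 j (ltn_ord j)) ht1) ht2).
have cJ i : (fun n => (usubmx (stage_jacobian (y (sg n)) (s (sg n)) i))^T) @ \oo --> Ju i.
  exact: (cvg_subseq hsg (@stage_jacobianu_cvg i)).
(* Backward induction: [k] counts the stages after [i]. *)
have limM k (i : 'I_m.+1) : (i + k)%N = m ->
    exists p : 'rV[R]_(dim Q), (fun n => M (sg n) i) @ \oo --> p.
  elim: k i => [i im|k IH i im].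
    have -> : i = ord_max by apply: val_inj; rewrite /= -[RHS]im addn0.
    exists (- pn).
    suff -> : (fun n => M (sg n) ord_max) = (fun n => - - M (sg n) ord_max) by exact: cvgN.
    by apply/funext => n; rewrite opprK.
  have ilt : (i < m)%N by rewrite -[X in (_ < X)%N]im -addSnnS leq_addr.
  pose j := Ordinal ilt; have [a [b [_ ca _]]] := Cj j.
  have [|p cp] := IH (lift ord0 j); first by rewrite /= /bump leq0n add1n addSnnS.
  exists (p *m Ju (lift ord0 j) - a).
  suff -> : (fun n => M (sg n) i) = (fun n => M (sg n) (lift ord0 j) *m
      (usubmx (stage_jacobian (y (sg n)) (s (sg n)) (lift ord0 j)))^T - A (sg n) j).
    exact: (cvgB (cvg_mulmx cp (@cJ (lift ord0 j))) ca).
  apply/funext => n; rewrite /A /state_subgrad.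
  have -> : widen_ord (leqnSn m) j = i by exact: val_inj.
  by rewrite opprD opprK addrCA subrr addr0.
have limB i : exists b : 'rV[R]_(dim (U i)), (fun n => B (sg n) i) @ \oo --> b.
  case: (unliftP ord0 i) => [j ->|->]; last by exists b0.
  by have [a [b [_ _ cb]]] := Cj j; exists b.
have limM' i : exists p : 'rV[R]_(dim Q), (fun n => M (sg n) i) @ \oo --> p.
  by apply: (limM (m - i)%N); rewrite subnKC // -ltnS.
pose p i := sval (cid (limM' i)); pose b i := sval (cid (limB i)).
have cM i : (fun n => M (sg n) i) @ \oo --> p i := svalP (cid (limM' i)).
have cB i : (fun n => B (sg n) i) @ \oo --> b i := svalP (cid (limB i)).
have sb : subdiffL (phi0 ebar) (ubar ord0) (b ord0).
  by have -> : b ord0 = b0 by exact: (cvg_unique _ (cB ord0) cb0).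
exists sg, p, b; split; [exact: hsg|exact: cM|exact: cB|exact: sb|split=> [j|]].
  have [a [b' [sab ca cb]]] := Cj j.
  have -> : b (lift ord0 j) = b' by exact: (cvg_unique _ (cB (lift ord0 j)) cb).
  suff -> : - p (widen_ord (leqnSn m) j) + p (lift ord0 j) *m Ju (lift ord0 j) = a by [].
  have cA : (fun n => A (sg n) j) @ \oo -->
      - p (widen_ord (leqnSn m) j) + p (lift ord0 j) *m Ju (lift ord0 j).
    exact: (cvgD (cvgN (cM _)) (cvg_mulmx (cM (lift ord0 j)) (@cJ (lift ord0 j)))).
  exact: (cvg_unique _ cA ca).
have cN : (fun n => - M (sg n) ord_max) @ \oo --> - p ord_max by exact: cvgN.
by have -> : - p ord_max = pn by exact: (cvg_unique _ cN cpn).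
Qed.

Let dGb (i : 'I_m.+1) : differentiable (Gh i) (row_mx (zb i) (wb i)).
Proof. by apply: dGh; rewrite subrr normr0 ltW. Qed.

Let DqFE (i : 'I_m.+1) p : DqF F (q i) (ubar i) p = p *m Ju i.
Proof.
have hG : chart (F i (q i, ubar i)) \o (fun q' => F i (q', ubar i)) \o chinv (q i) =
    (fun z => Gh i (row_mx z (wb i))).
  by apply/funext => z; rewrite /Gh /= row_mxKl row_mxKr /wb chinv_self.
have Jq : mjac (fun q' => F i (q', ubar i)) (q i) = usubmx (J i).
  apply: etrans (jacobian_partiall (dGb i)).
  exact: (congr1 (fun h => jacobian h (zb i)) hG).
exact: (congr1 (fun D => p *m D^T) Jq).
Qed.

Let DuFE (i : 'I_m.+1) p : DuF F (q i) (ubar i) p = p *m Jd i.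
Proof.
have hG : chart (F i (q i, ubar i)) \o (fun u' => F i (q i, u')) \o chinv (ubar i) =
    (fun w => Gh i (row_mx (zb i) w)).
  by apply/funext => w; rewrite /Gh /= row_mxKl row_mxKr /zb chinv_self.
have Jw : mjac (fun u' => F i (q i, u')) (ubar i) = dsubmx (J i).
  apply: etrans (jacobian_partialr (dGb i)).
  exact: (congr1 (fun h => jacobian h (wb i)) hG).
exact: (congr1 (fun D => p *m D^T) Jw).
Qed.

(** A change of indexing: [strictly_normal] takes sequences over [nat], and its costate number
    [i.+1] is [p i] here. The costate equations hold because [a] is defined by them. *)
Lemma critical_eq0 (p : 'I_m.+1 -> 'rV[R]_(dim Q)) (b : forall i, 'rV[R]_(dim (U i))) :
  subdiffL (phi0 ebar) (ubar ord0) (b ord0) ->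
  (forall j : 'I_m, subdiffL (phi j ebar) (stage F q0 ubar (lift ord0 j))
    (row_mx (- p (widen_ord (leqnSn m) j) + p (lift ord0 j) *m Ju (lift ord0 j))
      (b (lift ord0 j)))) ->
  subdiffL (phin ebar) (q m.+1) (- p ord_max) ->
  (forall (i : 'I_m.+1) v, clarke_tangent (UU i) (ubar i) v ->
    0 <= pairing (b i - p i *m Jd i) v) ->
  [/\ forall j : 'I_m, - p (widen_ord (leqnSn m) j) + p (lift ord0 j) *m Ju (lift ord0 j) = 0,
    - p ord_max = 0 & forall i, b i = 0].
Proof.
move=> sb sj sn nc.
(* The value [pp 0] repeats [pp 1] and belongs to no costate. *)
pose pp k := if insub k.-1 is Some i then p i else 0.
have ppS (i : 'I_m.+1) : pp i.+1 = p i by rewrite /pp valK.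
(* At [k = m.+1] no stage follows and the second term is 0, which gives the terminal condition. *)
pose a k := - pp k + (if insub k is Some i then pp k.+1 *m Ju i else 0).
have aS (i : 'I_m.+1) : a i = - pp i + p i *m Ju i by rewrite /a valK ppS.
have aj (j : 'I_m) : a j.+1 =
    - p (widen_ord (leqnSn m) j) + p (lift ord0 j) *m Ju (lift ord0 j).
  have -> : j.+1 = lift ord0 j :> nat by [].
  by rewrite aS -(ppS (widen_ord _ _)).
have an : a m.+1 = - p ord_max.
  by rewrite /a insubN ?ltnn // addr0 -(ppS ord_max).
have [||||||a0 b0] := ubar_normal (a := a) (p := pp) (b := b).
- exact: sb.
- by move=> j; rewrite aj; exact: sj.
- by rewrite an; exact: sn.
- by rewrite an -(ppS ord_max).
- move=> i _; have -> : state F q0 ubar i = q i by [].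
  by rewrite DqFE aS ppS opprD opprK subrK.
- move=> i v Tv; have -> : state F q0 ubar i = q i by [].
  by rewrite DuFE ppS; exact: nc.
split; [|by rewrite -an; apply: a0; rewrite leqnn|exact: b0].
by move=> j; rewrite -aj; apply: a0; rewrite /= leqW.
Qed.

(** Once all limiting subgradients vanish, eventually no constraint function is positive at the
    minimizer, whereas [ss_cost] says that their sum is. *)
Lemma stationary_sequence_absurd : False.
Proof.
have [sg [p [b [hsg cM cB sb [sj sn]]]]] := critical_limits.
have nc (i : 'I_m.+1) v : clarke_tangent (UU i) (ubar i) v ->
    0 <= pairing (b i - p i *m Jd i) v.
  apply: (normal_limit hsg).
  exact: (cvgB (cB i) (cvg_mulmx (cM i) (cvg_subseq hsg (@stage_jacobiand_cvg i)))).
have [a0 pn0 b0] := critical_eq0 sb sj sn nc.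
have cB0 i : (fun n => B (sg n) i) @ \oo --> (0 : 'rV[R]_(dim (U i))).
  by rewrite -(b0 i); exact: cB.
have cA0 (j : 'I_m) : (fun n => A (sg n) j) @ \oo --> (0 : 'rV[R]_(dim Q)).
  rewrite -(a0 j); apply: (cvgD (cvgN (cM _))); apply: (cvg_mulmx (cM (lift ord0 j))).
  exact: (cvg_subseq hsg (@stage_jacobianu_cvg (lift ord0 j))).
have cM0 : (fun n => - M (sg n) ord_max) @ \oo --> (0 : 'rV[R]_(dim Q)).
  by rewrite -pn0; exact: (cvgN (cM ord_max)).
have N0 := initial_slope hsg (cB0 ord0).
have Nn := terminal_slope hsg cM0.
have Nj : \forall n \near \oo, forall j : 'I_m, ~ 0 < phi j (e (sg n))
    (yv j.+1 (y (sg n) j.+1), uv (lift ord0 j) (x (sg n) (lift ord0 j))).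
  by apply: filter_forall => j; exact: (intermediate_slope hsg (cA0 j) (cB0 (lift ord0 j))).
have [n _ /(_ n (leqnn n)) [[H0 Hn] Hj]] := filterI (filterI N0 Nn) Nj.
have := ss_cost ss (sg n).
have z0 (t : R) : 0 <= t -> ~ 0 < t -> t = 0.
  by move=> t0 nt; apply/eqP; rewrite eq_le t0 andbT leNgt; apply/negP.
rewrite /cost /f0 /fn /f (z0 _ _ H0) // (z0 _ _ Hn) // big1 ?addr0 ?ltxx //.
by move=> j _; apply: z0 => //; exact: Hj.
Qed.

End Contradiction.

End LocalProblem.

Lemma no_far_sequence (ebar : E) (ek : nat -> E) (uk : nat -> forall i, U i) :
  admissible F q0 UU phi0 phi phin ebar ubar ->
  {for ebar, continuous (fun e => penalty F q0 phi0 phi phin e ubar)} ->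
  (forall i, clarke_regular (UU i)) ->
  regular_along F q0 phi0 phi phin ebar ubar ->
  strictly_normal F q0 UU phi0 phi phin ebar ubar ->
  ek @ \oo --> ebar -> (forall i, (fun n => uk n i) @ \oo --> ubar i) ->
  (forall n, controls UU (uk n)) ->
  (forall n, ((n.+1%:R * penalty F q0 phi0 phi phin (ek n) (uk n))%:E <
     @dist_set R (prodn U) (admissible F q0 UU phi0 phi phin (ek n)) (uk n))%E) ->
  False.
Proof.
move=> [Su z0 zj zn] pc cr reg nrm ce cu Suk far.
have [r [L [C [W rr]]]] := exists_regular_radius.
have pen0 : penalty F q0 phi0 phi phin ebar ubar = 0.
  by rewrite /penalty [phi0 _ _]z0 [phin _ _]zn big1 ?addr0 // => j _; exact: zj.
have [e [N [l [u [y [x [s ss]]]]]]] :=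
  exists_stationary_sequence rr ce cu Suk pen0 pc far.
exact: (stationary_sequence_absurd rr ss Su cr reg nrm).
Qed.

End ControlProblem.

(* penalty_cont: without some continuity in e the conclusion fails.  Take
   n = 1, all spaces R, F arbitrary, phi_1 = 0, phi_0(ebar, u) = |u| and
   phi_0(e, u) = max(1, 5 + u) for e <> ebar, with ebar not isolated in E: every
   other hypothesis holds at ubar = 0, but A(e) is empty for e <> ebar. *)
Theorem corollary4p13 (R : realType) (m : nat)
  (Q : ratlas R) (U : 'I_m.+1 -> ratlas R)
  (hQ : riemannian Q) (hU : forall i, riemannian (U i))
  (UU : forall i, set (U i)) (UU_closed : forall i, closed (UU i))
  (F : forall i, prod2 Q (U i) -> Q) (F_C1 : forall i, C1_map (F i))
  (q0 : Q)
  (E : metricType R)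
  (phi0 : E -> U ord0 -> R)
  (phi : forall j : 'I_m, E -> prod2 Q (U (lift ord0 j)) -> R)
  (phin : E -> Q -> R)
  (phi0_ge0 : forall e u, 0 <= phi0 e u)
  (phi_ge0 : forall j e x, 0 <= phi j e x)
  (phin_ge0 : forall e q, 0 <= phin e q)
  (phi0_lip : loc_lipschitz phi0)
  (phi_lip : forall j, loc_lipschitz (phi j))
  (phin_lip : loc_lipschitz phin)
  (ebar : E) (ubar : forall i, U i)
  (ubar_adm : admissible F q0 UU phi0 phi phin ebar ubar)
  (penalty_cont :
    {for ebar, continuous (fun e => penalty F q0 phi0 phi phin e ubar)})
  (UU_regular : forall i, clarke_regular (UU i))
  (phi_reg : regular_along F q0 phi0 phi phin ebar ubar)
  (ubar_normal : strictly_normal F q0 UU phi0 phi phin ebar ubar) :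
  exists eps kappa : R, [/\ 0 < eps, 0 < kappa,
    forall (e : E) (u : forall i, U i), controls UU u ->
      ((mdist e ebar)%:E + @rdist R (prodn U) u ubar < eps%:E)%E ->
      (@dist_set R (prodn U) (admissible F q0 UU phi0 phi phin e) u
        <= (kappa * penalty F q0 phi0 phi phin e u)%:E)%E &
    forall e : E, mdist e ebar < eps ->
      admissible F q0 UU phi0 phi phin e !=set0].

Proof.
(* For the nonemptiness claim, where the estimate is applied to [ubar] itself. *)
have rd0 : (@rdist R (prodn U) ubar ubar <= 0)%E.
  have sU i : short_curves (ubar i) by exact: riemannian_short_curves.
  have [r [C [r0 C0]]] := short_curves_rdist (short_curves_prodn (x := ubar) hU sU).
  set z := chart _ _ => /(_ z z); rewrite subrr normr0 mulr0 => H.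
  have -> : ubar = @chinv R (prodn U) ubar z.
    by apply: functional_extensionality_dep => i; rewrite /z /= mxrowK chinv_self.
  exact: H (ltW r0) (ltW r0).
have [n Hn] : exists n : nat, forall (e : E) (u : forall i, U i), controls UU u ->
    ((mdist e ebar)%:E + @rdist R (prodn U) u ubar < (n.+1%:R^-1)%:E)%E ->
    (@dist_set R (prodn U) (admissible F q0 UU phi0 phi phin e) u
      <= (n.+1%:R * penalty F q0 phi0 phi phin e u)%:E)%E.
  (* If no [n] works with radius [n.+1%:R^-1] and constant [n.+1%:R], then a choice of
     counterexamples is a sequence excluded by [no_far_sequence]. *)
  apply: contrapT => /forallNP H.
  pose bad n (d : E * (forall i, U i)) := [/\ controls UU d.2,
    ((mdist d.1 ebar)%:E + @rdist R (prodn U) d.2 ubar < (n.+1%:R^-1)%:E)%E &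
    ((n.+1%:R * penalty F q0 phi0 phi phin d.1 d.2)%:E <
      @dist_set R (prodn U) (admissible F q0 UU phi0 phi phin d.1) d.2)%E].
  have /choice [d Hd] n : exists d, bad n d.
    have /existsNP [e /existsNP [u /not_implyP [Su /not_implyP [de /negP]]]] := H n.
    by rewrite -ltNge => far; exists (e, u).
  have dE n : mdist (d n).1 ebar < n.+1%:R^-1.
    have [_ + _] := Hd n; rewrite -lte_fin; apply: le_lt_trans.
    by rewrite leeDl // rdist_ge0.
  have dU n : (@rdist R (prodn U) (d n).2 ubar < (n.+1%:R^-1)%:E)%E.
    have [_ + _] := Hd n; apply: le_lt_trans.
    by rewrite leeDr // lee_fin mdist_ge0.
  apply: (no_far_sequence hQ hU UU_closed F_C1 phi0_ge0 phi_ge0 phin_ge0 phi0_lip phi_lip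
    phin_lip ubar_adm penalty_cont UU_regular phi_reg ubar_normal
    (ek := fun n => (d n).1) (uk := fun n => (d n).2)).
  - apply/cvg_ballP => eps eps0; have := near_infty_natSinv_lt (PosNum eps0).
    by apply: filterS => n /= ne; rewrite ballEmdist /= metric_sym (lt_trans (dE n)).
  (* Convergence in the topology of [U i]: the product distance bounds the distance of each control,
     and small balls lie in [A]. *)
  - move=> i A /(rdist_nbhs (hU i)) [eps eps0 HA].
    have := near_infty_natSinv_lt (PosNum eps0).
    apply: filterS => n /= ne; apply: HA.
    apply: (le_lt_trans (@rdist_proj R _ U (d n).2 ubar i hU)).
    by apply: lt_trans (dU n) _; rewrite lte_fin.
  - by move=> n; have [] := Hd n.
  - by move=> n; have [] := Hd n.
exists n.+1%:R^-1, n.+1%:R; split=> //.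
(* An empty admissible set would be at distance [+oo] from [ubar], against the finite bound. *)
move=> e de; apply: contrapT => /set0P/negP; rewrite negbK => /eqP A0.
have [Su _ _ _] := ubar_adm.
have {}de : ((mdist e ebar)%:E + @rdist R (prodn U) ubar ubar < (n.+1%:R^-1)%:E)%E.
  by apply: le_lt_trans (leeD2l _ rd0) _; rewrite adde0 lte_fin.
by have := Hn e ubar Su de; rewrite A0 /dist_set image_set0 ereal_inf0 leye_eq.
Qed.
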